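(* There is a universal radius $r_0$ with $0<r_0<1$ such that for every analytic function $f:\mathbb{D}\to\mathbb{C}$ with $f(0)=0$, and for every real $M$ with $0\leq M\leq \max_{|z|=r_0}|f(z)|$, \[ A(M)\geq \pi M^2, \] where $A(M)=\int_{\Omega(M)}|f'(z)|^2\,dA(z)$ and $\Omega(M)=\{z\in\mathbb{D}:|f(z)|<M\}$.
   Context: $\mathbb{D}=\{z\in\mathbb{C}:|z|<1\}$ is the open unit disk. The symbol $dA(z)$ denotes two-dimensional Lebesgue measure; $A(M)\in[0,+\infty]$ is the Euclidean area of $f(\Omega(M))$ counting multiplicity. For $M=0$ the set $\Omega(0)$ is empty and $A(0)=0$. ''Universal'' means that $r_0$ does not depend on $f$ or $M$. *)

(* Defs.v *)
From HB Require Import structures.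
From mathcomp Require Export all_boot all_order all_algebra.
From mathcomp Require Export complex.
From mathcomp Require Export all_classical all_reals all_analysis.
Export numFieldNormedType.Exports.
Export Order.TTheory GRing.Theory Num.Theory.

Set Implicit Arguments.
Unset Strict Implicit.
Unset Printing Implicit Defensive.

Local Open Scope classical_set_scope.
Local Open Scope complex_scope.
Local Open Scope ring_scope.

(* complex.v gives R[i] its normed field structure; these instances add the
   associated topology and the structure of a normed space over itself. *)
HB.instance Definition _ (R : rcfType) := GRing.ComAlgebra.copy R[i] R[i]^o.
HB.instance Definition _ (R : rcfType) := Vector.copy R[i] R[i]^o.
HB.instance Definition _ (R : rcfType) := NormedModule.copy R[i] R[i]^o.

(* The library norm on R[i] takes values in R[i]; [cabs] is the same modulus
   as an element of R. *)
Definition cabs (R : realType) (z : R[i]) : R := complex.Re `|z|.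

Definition unit_disk (R : realType) : set R[i] := [set z | cabs z < 1].

(* Functions on the disk are represented by total functions on R[i]; only their
   values on the disk matter.  The derivative is taken over the field R[i], so
   [derivable f z 1] is complex differentiability at z. *)
Definition analytic_on_disk (R : realType) (f : R[i] -> R[i]) : Prop :=
  forall z : R[i], unit_disk z -> derivable f z 1.

(* For f continuous on the compact circle |z| = r, r >= 0, this supremum is
   attained. *)
Definition circle_max (R : realType) (f : R[i] -> R[i]) (r : R) : R :=
  sup [set cabs (f z) | z in [set z | cabs z = r]].

Definition Omega (R : realType) (f : R[i] -> R[i]) (M : R) : set R[i] :=
  [set z | unit_disk z /\ cabs (f z) < M].

(* The integral is over the points (x, y) of R * R such that x + iy is in
   Omega f M, for the product of the Lebesgue measures on the axes. *)
Definition Area (R : realType) (f : R[i] -> R[i]) (M : R) : \bar R :=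
  (\int[lebesgue_measure \x lebesgue_measure]_(
      p in [set p : measurableTypeR R * measurableTypeR R |
              Omega f M (p.1 +i* p.2)])
     ((cabs (derive1 f (p.1 +i* p.2)) ^+ 2)%:E))%E.

(* Main.v *)
Require Import Defs.
From mathcomp Require Import measurable_realfun.
From mathcomp Require Import ring lra.

(** Suppose that [M > 0] and that the area [A] of [f] over [{|f| < M}] is less
    than [pi M^2], although [|f|] reaches [M] on a circle of tiny radius [r0].
    The squares [max(|Re z|, |Im z|) <= t] play the role of the concentric
    circles: their edges are parallel to the axes, so that Fubini's theorem
    can be used without polar coordinates.

    Length and area ([good_square]).  By the maximum principle, the boundary of
    every square of size [t > r0] contains a point where [|f| > 7 M / 8].  If
    for all [t] in [[al, be]] it also contained a point where [|f| < 3 M / 4],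
    then a truncation of [|f|^2] would oscillate along the boundary by a fixed
    fraction of [M^2], so that the integral of [|f'|^2] over the part of the
    boundary where [|f| < M] would be at least [c M^2 / t].  Integrating over
    [t] gives [c M^2 ln (be / al) <= A].  Hence as soon as [ln (be / al)]
    exceeds an absolute constant, some square between [al] and [be] is good:
    [|f| >= 3 M / 4] on its boundary.

    Winding ([pi_winding_le_Area]).  Green's theorem for the form
    [H(|f|^2) f'/f dz], where [H] is a truncation of the identity, shows the
    following: if [|f| >= m] on the boundary of a square, with [m <= M], and if
    [f] winds [k] times about 0 along this boundary, then [A >= k pi m^2].

    Conclusion.  Take a good square of tiny size [t1] and another one of
    moderate size [t2], and write [f = z g].  If [g] has a zero in the second
    square, then [f] winds at least twice along its boundary and
    [A >= 2 pi (3 M / 4)^2 > pi M^2].  Otherwise [ln |g|] is harmonic there.  It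
    is at least [ln (3 M / 4)] because the second square is good, and it is very
    large at 0 because the first one is good.  Harnack's inequality ([harnack])
    then makes [|g|] so large on an intermediate square that [|f| >= M] on its
    boundary ([large_on_small_square]).  Since [f] winds at least once along
    it, [A >= pi M^2].  Both cases contradict the assumption.

    The complex analysis rests on one principle ([additive_rect_eq0]): an
    additive function of rectangles that is [o(diameter^2)] at every point
    vanishes.  Applied to the difference between a boundary integral and an
    area integral, it yields at once Goursat's theorem, for functions that are
    only assumed differentiable, and Green's theorem, for the non-holomorphic
    form above.  Cauchy's formula on squares, the differentiability of [f'],
    the factorization at a zero and the maximum principle follow. *)

Set Implicit Arguments.
Unset Strict Implicit.
Unset Printing Implicit Defensive.

Local Open Scope classical_set_scope.
Local Open Scope complex_scope.
Local Open Scope ring_scope.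

(** * The modulus as a real number, and Wirtinger derivatives *)

Section Modulus.
Variable R : realType.
Implicit Types (z w : R[i]) (x y : R).

Lemma cabsE z : cabs z = Num.sqrt (complex.Re z ^+ 2 + complex.Im z ^+ 2).
Proof. by rewrite /cabs normc_def. Qed.

Lemma cabsC z : `|z| = (cabs z)%:C.
Proof. by rewrite cabsE normc_def. Qed.

Lemma cabs_ge0 z : 0 <= cabs z.
Proof. by rewrite cabsE sqrtr_ge0. Qed.

Lemma cabs_sqr z : cabs z ^+ 2 = complex.Re z ^+ 2 + complex.Im z ^+ 2.
Proof. by rewrite cabsE sqr_sqrtr // addr_ge0 // sqr_ge0. Qed.

Lemma cabsM z w : cabs (z * w) = cabs z * cabs w.
Proof. by apply: complexI; rewrite rmorphM /= -!cabsC normrM. Qed.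

Lemma cabsD z w : cabs (z + w) <= cabs z + cabs w.
Proof. by rewrite -lecR rmorphD /= -!cabsC ler_normD. Qed.

Lemma cabsN z : cabs (- z) = cabs z.
Proof. by apply: complexI; rewrite -!cabsC normrN. Qed.

Lemma cabsB z w : cabs (z - w) <= cabs z + cabs w.
Proof. by rewrite -(cabsN w) cabsD. Qed.

Lemma cabs_distC z w : cabs (z - w) = cabs (w - z).
Proof. by rewrite -cabsN opprB. Qed.

Lemma cabs_ge_sub z w : cabs z - cabs w <= cabs (z - w).
Proof. by rewrite lerBlDr -{1}(subrK w z) cabsD. Qed.

Lemma cabs0 : cabs (0 : R[i]) = 0.
Proof. by apply: complexI; rewrite -cabsC normr0. Qed.

Lemma cabs1 : cabs (1 : R[i]) = 1.
Proof. by apply: complexI; rewrite -cabsC normr1. Qed.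

Lemma cabs_eq0 z : (cabs z == 0) = (z == 0).
Proof. by rewrite -[RHS]normr_eq0 cabsC eq_complex /= eqxx andbT. Qed.

Lemma cabs_gt0 z : (0 < cabs z) = (z != 0).
Proof. by rewrite lt_def cabs_ge0 andbT cabs_eq0. Qed.

Lemma cabsV z : cabs z^-1 = (cabs z)^-1.
Proof. by apply: complexI; rewrite -cabsC normfV cabsC fmorphV. Qed.

Lemma cabsX z n : cabs (z ^+ n) = cabs z ^+ n.
Proof. by apply: complexI; rewrite -cabsC normrX cabsC rmorphXn. Qed.

Lemma cabs_conj z : cabs z^*%C = cabs z.
Proof. by apply: complexI; rewrite -!cabsC normcJ. Qed.

Lemma cabs_real x : cabs x%:C = `|x|.
Proof. by rewrite cabsE /= expr0n addr0 sqrtr_sqr. Qed.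

Lemma cabs_i : cabs (0 +i* 1 : R[i]) = 1.
Proof. by rewrite cabsE /= expr0n add0r expr1n sqrtr1. Qed.

Lemma Re_cabs z : `|complex.Re z| <= cabs z.
Proof. by rewrite -lecR -cabsC normc_ge_Re. Qed.

Lemma Im_cabs z : `|complex.Im z| <= cabs z.
Proof.
rewrite -ler_sqr ?nnegrE ?cabs_ge0 // cabs_sqr real_normK ?num_real //.
by rewrite lerDr sqr_ge0.
Qed.

Lemma cabs_ReIm z : cabs z <= `|complex.Re z| + `|complex.Im z|.
Proof.
rewrite -ler_sqr ?nnegrE ?cabs_ge0 ?addr_ge0 // cabs_sqr sqrrD.
rewrite !real_normK ?num_real // lerD2r lerDl.
by rewrite mulrn_wge0 // mulr_ge0.
Qed.

Lemma mul_conj z : z * z^*%C = (cabs z ^+ 2)%:C.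
Proof. by rewrite -sqr_normc cabsC rmorphXn. Qed.

Lemma complexP z w : complex.Re z = complex.Re w -> complex.Im z = complex.Im w -> z = w.
Proof. by case: z w => a b [c d] /= -> ->. Qed.

Lemma ReD z w : complex.Re (z + w) = complex.Re z + complex.Re w.
Proof. by case: z w => a b [c d]. Qed.
Lemma ImD z w : complex.Im (z + w) = complex.Im z + complex.Im w.
Proof. by case: z w => a b [c d]. Qed.
Lemma ReN z : complex.Re (- z) = - complex.Re z.
Proof. by case: z. Qed.
Lemma ImN z : complex.Im (- z) = - complex.Im z.
Proof. by case: z. Qed.
Lemma ReM z w : complex.Re (z * w) =
  complex.Re z * complex.Re w - complex.Im z * complex.Im w.
Proof. by case: z w => a b [c d]. Qed.
Lemma ImM z w : complex.Im (z * w) =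
  complex.Re z * complex.Im w + complex.Im z * complex.Re w.
Proof. by case: z w => a b [c d]. Qed.
Definition ReImE := (ReD, ImD, ReN, ImN, ReM, ImM).

(** [A] and [B] are the Wirtinger derivatives of [F] with respect to [z] and
    its conjugate. Holomorphy is the case [B = 0], so that one calculus serves
    both the holomorphic functions and the form to which Green's theorem is
    applied. The derivatives are arguments, not chosen limits, which keeps the
    rules below free of existence conditions. *)
Definition wdiff (F : R[i] -> R[i]) z A B := forall e : R, 0 < e ->
  exists2 d : R, 0 < d & forall h, cabs h < d ->
    cabs (F (z + h) - F z - (A * h + B * h^*%C)) <= e * cabs h.

Definition ccont (F : R[i] -> R[i]) z := forall e : R, 0 < e ->
  exists2 d : R, 0 < d & forall h, cabs h < d -> cabs (F (z + h) - F z) <= e.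

Definition holo F z d := wdiff F z d 0.

Lemma wdiff_bound F z A B : wdiff F z A B ->
  exists2 d : R, 0 < d & forall h, cabs h < d ->
    cabs (F (z + h) - F z) <= (cabs A + cabs B + 1) * cabs h.
Proof.
move=> /(_ 1 ltr01)[d d0 H]; exists d => // h /H {}H.
rewrite -[X in cabs X](subrK (A * h + B * h^*%C)).
apply: le_trans (cabsD _ _) _.
have := cabsD (A * h) (B * h^*%C); rewrite !cabsM cabs_conj.
lra.
Qed.

Lemma wdiff_cont F z A B : wdiff F z A B -> ccont F z.
Proof.
move=> /wdiff_bound[d d0 H] e e0.
set K := cabs A + cabs B + 1.
have K0 : 0 < K by have := cabs_ge0 A; have := cabs_ge0 B; rewrite /K; lra.
exists (Num.min d (e / K)); first by rewrite lt_min d0 divr_gt0.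
move=> h; rewrite lt_min => /andP[/H hd he].
apply: le_trans hd _; rewrite -/K mulrC -ler_pdivlMr //; exact: ltW.
Qed.

Lemma wdiff_local F G z A B r : 0 < r ->
  (forall w, cabs (w - z) < r -> F w = G w) -> wdiff F z A B -> wdiff G z A B.
Proof.
move=> r0 FG H e /H[d d0 {}H].
exists (Num.min d r); first by rewrite lt_min d0 r0.
move=> h; rewrite lt_min => /andP[hd hr].
rewrite -(FG (z + h)); last by rewrite [z + h]addrC addrK.
by rewrite -FG ?subrr ?cabs0 //; exact: H.
Qed.

Lemma wdiff_ext F G z A B : F =1 G -> wdiff F z A B -> wdiff G z A B.
Proof. by move=> FG; apply: (wdiff_local ltr01) => w _. Qed.

Lemma wdiff_cst c z : wdiff (fun=> c) z 0 0.
Proof.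
move=> e e0; exists 1 => // h _.
by rewrite !mul0r addr0 subrr subr0 cabs0 mulr_ge0 ?cabs_ge0 // ltW.
Qed.

Lemma wdiff_id z : wdiff id z 1 0.
Proof.
move=> e e0; exists 1 => // h _.
by rewrite mul0r mul1r addr0 [z + h]addrC addrK subrr cabs0 mulr_ge0 ?cabs_ge0 // ltW.
Qed.

Lemma wdiffD F G z A B A' B' : wdiff F z A B -> wdiff G z A' B' ->
  wdiff (fun w => F w + G w) z (A + A') (B + B').
Proof.
move=> HF HG e e0.
have e20 : 0 < e / 2 by rewrite divr_gt0.
have [d d0 {}HF] := HF _ e20; have [d' d'0 {}HG] := HG _ e20.
exists (Num.min d d'); first by rewrite lt_min d0 d'0.
move=> h; rewrite lt_min => /andP[/HF hf /HG hg].
have -> : F (z + h) + G (z + h) - (F z + G z) - ((A + A') * h + (B + B') * h^*%C)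
 = (F (z + h) - F z - (A * h + B * h^*%C)) +
   (G (z + h) - G z - (A' * h + B' * h^*%C)) by ring.
apply: le_trans (cabsD _ _) _; lra.
Qed.

Lemma wdiffM F G z A B A' B' : wdiff F z A B -> wdiff G z A' B' ->
  wdiff (fun w => F w * G w) z (A * G z + F z * A') (B * G z + F z * B').
Proof.
move=> HF HG e e0.
have [d1 d10 bF] := wdiff_bound HF.
have [d2 d20 bG] := wdiff_bound HG.
set KF := _ + 1 in bF; set KG := _ + 1 in bG.
have KF0 : 0 <= KF.
  by have := cabs_ge0 A; have := cabs_ge0 B; rewrite /KF; lra.
have KG0 : 0 <= KG.
  by have := cabs_ge0 A'; have := cabs_ge0 B'; rewrite /KG; lra.
set c := cabs (F z) + cabs (G z) + KF * KG + 1.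
have F0 := cabs_ge0 (F z); have G0 := cabs_ge0 (G z).
have KK0 : 0 <= KF * KG by rewrite mulr_ge0.
have c0 : 0 < c by rewrite /c; lra.
have ec0 : 0 < e / c by rewrite divr_gt0.
have [d3 d30 {}HF] := HF _ ec0; have [d4 d40 {}HG] := HG _ ec0.
exists (Num.min (Num.min d1 d2) (Num.min (Num.min d3 d4) (e / c))).
  by rewrite !lt_min d10 d20 d30 d40 ec0.
move=> h; rewrite !lt_min => /andP[/andP[/bF {}bF /bG {}bG]
  /andP[/andP[/HF {}HF /HG {}HG] hc]].
have -> : F (z + h) * G (z + h) - F z * G z -
    ((A * G z + F z * A') * h + (B * G z + F z * B') * h^*%C)
  = (F (z + h) - F z - (A * h + B * h^*%C)) * G z
  + F z * (G (z + h) - G z - (A' * h + B' * h^*%C))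
  + (F (z + h) - F z) * (G (z + h) - G z) by ring.
apply: le_trans (cabsD _ _) _.
apply: le_trans (lerD (cabsD _ _) (lexx _)) _.
rewrite !cabsM.
have h0 := cabs_ge0 h.
have t1 := ler_wpM2r G0 HF.
have t2 := ler_wpM2l F0 HG.
have t3 : cabs (F (z + h) - F z) * cabs (G (z + h) - G z) <= KF * KG * (e / c * cabs h).
  apply: le_trans (ler_pM (cabs_ge0 _) (cabs_ge0 _) bF bG) _.
  rewrite mulrACA ler_wpM2l // ler_wpM2r //; exact: ltW.
apply: le_trans (lerD (lerD t1 t2) t3) _.
have -> : e / c * cabs h * cabs (G z) + cabs (F z) * (e / c * cabs h) +
    KF * KG * (e / c * cabs h) = (e / c * cabs h) * (c - 1) by rewrite /c; ring.
have -> : e * cabs h = (e / c * cabs h) * c by field; rewrite gt_eqF.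
apply: ler_wpM2l; first by rewrite mulr_ge0 // ltW.
by rewrite gerBl.
Qed.

Lemma wdiff_conj F z A B : wdiff F z A B -> wdiff (fun w => (F w)^*%C) z B^*%C A^*%C.
Proof.
move=> H e /H[d d0 {}H]; exists d => // h /H.
rewrite -(cabs_conj (F _ - _ - _)) => {}H.
have <- : ((F (z + h) - F z - (A * h + B * h^*%C)))^*%C =
  (F (z + h))^*%C - (F z)^*%C - (B^*%C * h + A^*%C * h^*%C) => //.
by rewrite !(rmorphB, rmorphD, rmorphM) /= conjcK [X in _ - X]addrC.
Qed.

End Modulus.

(** * Inverses, real functions of the modulus, and restriction to lines *)

Section ChainRules.
Variable R : realType.
Implicit Types (z w : R[i]) (x y : R).

Lemma wdiffV (F : R[i] -> R[i]) z A B : F z != 0 -> wdiff F z A B ->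
  wdiff (fun w => (F w)^-1) z (- A / F z ^+ 2) (- B / F z ^+ 2).
Proof.
move=> Fz0 HF e e0.
have [d1 d10 bF] := wdiff_bound HF.
set KF := _ + 1 in bF.
have KF0 : 0 < KF.
  by have := cabs_ge0 A; have := cabs_ge0 B; rewrite /KF; lra.
set m := cabs (F z).
have m0 : 0 < m by rewrite cabs_gt0.
set e1 := e * m ^+ 2 / 2.
have e10 : 0 < e1 by rewrite /e1 divr_gt0 // mulr_gt0 // exprn_gt0.
have [d2 d20 {}HF] := HF _ e10.
have [d3 d30 cF] : exists2 d : R, 0 < d & forall h, cabs h < d ->
    cabs (F (z + h) - F z) <= m / 2.
  exists (Num.min d1 (m / 2 / KF)); first by rewrite lt_min d10 !divr_gt0.
  move=> h; rewrite lt_min => /andP[/bF bh hm]; apply: le_trans bh _.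
  by rewrite mulrC -ler_pdivlMr // ltW.
set d4 := e * m ^+ 3 / 4 / KF ^+ 2.
have d40 : 0 < d4 by rewrite !divr_gt0 // ?mulr_gt0 // exprn_gt0.
exists (Num.min (Num.min d1 d2) (Num.min d3 d4)).
  by rewrite !lt_min d10 d20 d30 d40.
move=> h; rewrite !lt_min => /andP[/andP[/bF {}bF /HF {}HF] /andP[/cF {}cF hd4]].
have Fh : m / 2 <= cabs (F (z + h)).
  have := cabs_ge_sub (F z) (F z - F (z + h)).
  rewrite subKr cabs_distC -/m; lra.
have Fh0 : F (z + h) != 0 by rewrite -cabs_gt0; lra.
have -> : (F (z + h))^-1 - (F z)^-1 -
   (- A / F z ^+ 2 * h + - B / F z ^+ 2 * h^*%C) =
  - ((F (z + h) - F z - (A * h + B * h^*%C)) / F z ^+ 2)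
  + (F (z + h) - F z) ^+ 2 / (F z ^+ 2 * F (z + h)) by field; rewrite Fz0 Fh0.
apply: le_trans (cabsD _ _) _; rewrite cabsN !(cabsX, cabsV, cabsM) -/m.
have h0 := cabs_ge0 h.
have -> : e * cabs h = e / 2 * cabs h + e / 2 * cabs h by field.
apply: lerD.
  rewrite ler_pdivrMr ?exprn_gt0 //.
  by apply: le_trans HF _; rewrite /e1; lra.
rewrite ler_pdivrMr; last by rewrite mulr_gt0 ?exprn_gt0 //; lra.
apply: (@le_trans _ _ ((KF * cabs h) ^+ 2)).
  by rewrite ler_sqr ?nnegrE ?cabs_ge0 // mulr_ge0 // ltW.
apply: (@le_trans _ _ (e / 2 * cabs h * (m ^+ 2 * (m / 2)))); last first.
  rewrite ler_wpM2l // ?ler_wpM2l // ?exprn_ge0 //; last exact: ltW.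
  by rewrite mulr_ge0 // divr_ge0 // ltW.
have -> : (KF * cabs h) ^+ 2 = cabs h * (KF ^+ 2 * cabs h) by ring.
have -> : e / 2 * cabs h * (m ^+ 2 * (m / 2)) = cabs h * (e * m ^+ 3 / 4) by field.
by rewrite ler_wpM2l // mulrC -ler_pdivlMr ?exprn_gt0 // ltW.
Qed.

Definition rdiff (f : R -> R) x d := forall e : R, 0 < e ->
  exists2 r : R, 0 < r & forall k, `|k| < r -> `|f (x + k) - f x - d * k| <= e * `|k|.

(** Meant for the functions of the squared modulus that truncate a holomorphic
    function. *)
Lemma wdiff_comp_real (U : R[i] -> R) (f : R -> R) z A B s :
  wdiff (fun w => (U w)%:C) z A B -> rdiff f (U z) s ->
  wdiff (fun w => (f (U w))%:C) z (s%:C * A) (s%:C * B).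
Proof.
move=> HU Hf e e0.
have [d1 d10 bU] := wdiff_bound HU.
set K := _ + 1 in bU.
have K0 : 0 < K.
  by have := cabs_ge0 A; have := cabs_ge0 B; rewrite /K; lra.
have eK0 : 0 < e / 2 / K by rewrite !divr_gt0.
have [r1 r10 {}Hf] := Hf _ eK0.
have s0 : 0 < `|s| + 1 by have := normr_ge0 s; lra.
have e20 : 0 < e / 2 / (`|s| + 1) by rewrite !divr_gt0.
have [d2 d20 {}HU] := HU _ e20.
exists (Num.min (Num.min d1 d2) (r1 / K)).
  by rewrite !lt_min d10 d20 divr_gt0.
move=> h; rewrite !lt_min => /andP[/andP[/bU {}bU /HU {}HU] hr].
set k := U (z + h) - U z.
have kb : `|k| <= K * cabs h by rewrite -cabs_real rmorphB.
have kr : `|k| < r1.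
  by apply: le_lt_trans kb _; rewrite mulrC -ltr_pdivlMr.
have {}Hf := Hf _ kr.
have Uk : U z + k = U (z + h) by rewrite /k addrC subrK.
rewrite Uk in Hf.
have -> : (f (U (z + h)))%:C - (f (U z))%:C - (s%:C * A * h + s%:C * B * h^*%C)
  = (f (U (z + h)) - f (U z) - s * k)%:C
  + s%:C * ((U (z + h))%:C - (U z)%:C - (A * h + B * h^*%C)).
  by rewrite /k !(rmorphB, rmorphM) /=; ring.
apply: le_trans (cabsD _ _) _; rewrite cabsM !cabs_real.
have h0 := cabs_ge0 h.
have -> : e * cabs h = e / 2 / K * (K * cabs h) + e / 2 * cabs h.
  by field; rewrite gt_eqF.
apply: lerD.
  by apply: le_trans Hf _; rewrite ler_wpM2l // !divr_ge0 // ltW.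
apply: (@le_trans _ _ ((`|s| + 1) * (e / 2 / (`|s| + 1) * cabs h))).
  by apply: ler_pM => //; rewrite ?cabs_ge0 // lerDl.
by rewrite mulrA [(_ + 1) * _]mulrC divfK // gt_eqF.
Qed.

Lemma wdiff_line F z v A B (x : R) : wdiff F (z + x%:C * v) A B ->
  rdiff (fun t => complex.Re (F (z + t%:C * v))) x (complex.Re (A * v + B * v^*%C))
  /\ rdiff (fun t => complex.Im (F (z + t%:C * v))) x (complex.Im (A * v + B * v^*%C)).
Proof.
move=> H.
have K : forall e : R, 0 < e -> exists2 r : R, 0 < r & forall k, `|k| < r ->
  cabs (F (z + (x + k)%:C * v) - F (z + x%:C * v) - k%:C * (A * v + B * v^*%C)) <=
    e * `|k|.
  move=> e e0; have v1 : 0 < cabs v + 1 by have := cabs_ge0 v; lra.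
  have [d d0 {}H] := H (e / (cabs v + 1)) (divr_gt0 e0 v1).
  exists (d / (cabs v + 1)); first by rewrite divr_gt0.
  move=> k kd; have hd : cabs (k%:C * v) < d.
    rewrite cabsM cabs_real; rewrite ltr_pdivlMr // in kd.
    by apply: le_lt_trans kd; rewrite ler_wpM2l // lerDl.
  have := H _ hd.
  have -> : (z + x%:C * v + k%:C * v) = (z + (x + k)%:C * v).
    by rewrite rmorphD /=; ring.
  have -> : (k%:C * v)^*%C = k%:C * v^*%C.
    by case: (v) => a b; apply: complexP => /=; ring.
  have -> : k%:C * (A * v + B * v^*%C) = A * (k%:C * v) + B * (k%:C * v^*%C) by ring.
  move=> {}H; apply: le_trans H _; rewrite cabsM cabs_real.
  rewrite -mulrA ler_wpM2l //; first exact: ltW.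
  by rewrite mulrC ler_pdivrMr // ler_wpM2l // lerDl.
have E1 y (X : R[i]) : complex.Re (y%:C * X) = y * complex.Re X.
  by rewrite ReM /= mul0r subr0.
have E2 y (X : R[i]) : complex.Im (y%:C * X) = y * complex.Im X.
  by rewrite ImM /= mul0r addr0.
split=> e /K[r r0 {}H]; exists r => // k /H {}H.
  rewrite [_ * k]mulrC -E1 -!ReN -!ReD.
  exact: le_trans (Re_cabs _) H.
rewrite [_ * k]mulrC -E2 -!ImN -!ImD.
exact: le_trans (Im_cabs _) H.
Qed.

(** The quotient-free form of derivability, common to the real line and to the
    complex plane. *)
Lemma is_derive_near (K : numFieldType) (V : normedModType K) (f : K -> V)
    (x : K) (d : V) :
  is_derive x (1 : K) f d <->
  forall e : K, 0 < e -> exists2 r : K, 0 < r &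
    forall h, `|h| < r -> `|f (x + h) - f x - h *: d| <= e * `|h|.
Proof.
have E : is_derive x (1 : K) f d <->
   (fun h => h^-1 *: ((f \o shift x) (h *: 1) - f x)) @ 0^' --> d.
  split=> [[ex <-]|H]; first exact: ex.
  by split; [apply/cvg_ex; exists d | apply: cvg_lim].
rewrite E; split.
  move=> /cvgr_dist_le H e e0.
  have /= [r /= r0 {}H] := H e e0.
  exists r => // h hr; have [->|h0] := eqVneq h 0.
    by rewrite addr0 subrr scale0r subrr !normr0 mulr0.
  have := H h; rewrite /= sub0r normrN => /(_ hr h0).
  rewrite -[h *: 1]/(h * 1) mulr1 [h + x]addrC distrC => {}H.
  have -> : f (x + h) - f x - h *: d = h *: (h^-1 *: (f (x + h) - f x) - d).
    by rewrite scalerBr scalerA divff // scale1r.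
  by rewrite normrZ mulrC ler_wpM2r.
move=> H; apply/cvgrPdist_le => e e0.
have [r r0 {}H] := H e e0.
exists r => // h /=; rewrite sub0r normrN => hr h0.
rewrite -[h *: 1]/(h * 1) mulr1 [h + x]addrC distrC.
have -> : h^-1 *: (f (x + h) - f x) - d = h^-1 *: (f (x + h) - f x - h *: d).
  by rewrite [RHS]scalerBr scalerA mulVf // scale1r.
rewrite normrZ normfV ler_pdivrMl ?normr_gt0 // mulrC.
exact: H.
Qed.

Lemma rdiffP (f : R -> R) x d : rdiff f x d <-> is_derive x (1 : R) f d.
Proof.
rewrite is_derive_near; split=> H e /H[r r0 {}H]; exists r => // k /H.
  by rewrite [d * k]mulrC.
by rewrite [d * k]mulrC.
Qed.

Lemma holoP (f : R[i] -> R[i]) z d : holo f z d <-> is_derive z (1 : R[i]) f d.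
Proof.
rewrite is_derive_near; split=> H e e0.
  have [er e0r] : exists2 er : R, 0 < er & e = er%:C.
    move: e0; case: e => a b; rewrite ltcE /= => /andP[/eqP -> a0].
    by exists a.
  move=> ->; have [r r0 {}H] := H _ e0r; exists r%:C; first by rewrite ltcR.
  move=> h; rewrite !cabsC -rmorphM /= ltcR lecR => /H.
  by rewrite mul0r addr0 [d * h]mulrC.
have e0C : 0 < e%:C by rewrite ltcR.
have [r r0 {}H] := H _ e0C.
move: r0 H; case: r => a b; rewrite ltcE /= => /andP[/eqP -> a0] H.
exists a => // h ha; have := H h; rewrite !cabsC -rmorphM /= ltcR lecR.
by rewrite mul0r addr0 [d * h]mulrC; apply.
Qed.

Lemma holo_derive1 (f : R[i] -> R[i]) z d : holo f z d -> derive1 f z = d.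
Proof. by move=> /holoP H; rewrite derive1E; apply: derive_val. Qed.

Lemma derivable_holo (f : R[i] -> R[i]) z :
  derivable f z 1 -> holo f z (derive1 f z).
Proof.
move=> H; apply/holoP; rewrite derive1E; split => //.
Qed.

End ChainRules.

(** * Integrals of continuous functions on a real interval *)

Section IntervalIntegral.
Variable R : realType.
Implicit Types (f g : R -> R) (a b c x y : R).

Definition rcont f x := forall e : R, 0 < e ->
  exists2 r : R, 0 < r & forall k, `|k| < r -> `|f (x + k) - f x| <= e.

Lemma rcontP f x : rcont f x <-> {for x, continuous f}.
Proof.
rewrite /prop_for /continuous_at; split.
  move=> H; apply/cvgrPdist_le => e /H[r r0 {}H].
  exists r => //= y yx; have := H (y - x); rewrite [x + _]addrC subrK => H'.
  by rewrite distrC; apply: H'; rewrite distrC.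
move=> /cvgr_dist_le H e e0; have /= [r /= r0 {}H] := H e e0.
exists r => // k kr; have := H (x + k); rewrite /= opprD addrA subrr add0r normrN.
by rewrite distrC; apply.
Qed.

Lemma rdiff_cont f x d : rdiff f x d -> rcont f x.
Proof.
move=> /rdiffP H; apply/rcontP; apply: differentiable_continuous.
by apply/derivable1_diffP; apply: ex_derive.
Qed.

(** Two-sided continuity is required at the endpoints too: the integrands
    below are restrictions of functions that are continuous on a
    neighbourhood. *)
Definition rcont_on a b f := forall x, a <= x <= b -> rcont f x.

Definition rint a b f : R := (\int[@lebesgue_measure R]_(x in `[a, b]) f x)%R.

Lemma rcont_on_within a b f : rcont_on a b f -> {within `[a, b], continuous f}.
Proof.
move=> H; apply: continuous_in_subspaceT => x.
by rewrite inE /= in_itv /= => /H /rcontP.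
Qed.

Lemma rcont_on_integrable a b f : rcont_on a b f ->
  lebesgue_measure.-integrable `[a, b] (EFin \o f).
Proof.
by move=> /rcont_on_within; apply: continuous_compact_integrable; apply: segment_compact.
Qed.

Lemma rcont_on_cst a b c : rcont_on a b (fun=> c).
Proof. by move=> x _ e e0; exists 1 => // k _; rewrite subrr normr0 ltW. Qed.

Lemma rcont_onD a b f g : rcont_on a b f -> rcont_on a b g ->
  rcont_on a b (fun x => f x + g x).
Proof.
move=> F G x xab; apply/rcontP.
by apply: (@continuousD R R R f g x); apply/rcontP; [apply: F|apply: G].
Qed.

Lemma rcont_onZ a b k f : rcont_on a b f -> rcont_on a b (fun x => k * f x).
Proof.
move=> F x xab; apply/rcontP.
apply: (@continuousM R R (fun=> k) f x); last by apply/rcontP; apply: F.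
exact: cst_continuous.
Qed.

Lemma rcont_on_sub a b a' b' f : a <= a' -> b' <= b -> rcont_on a b f -> rcont_on a' b' f.
Proof. by move=> aa bb H x /andP[ax xb]; apply: H; lra. Qed.

Lemma rintD a b f g : rcont_on a b f -> rcont_on a b g ->
  rint a b (fun x => f x + g x) = rint a b f + rint a b g.
Proof. by move=> F G; rewrite /rint RintegralD //; apply: rcont_on_integrable. Qed.

Lemma rintZ a b k f : rcont_on a b f -> rint a b (fun x => k * f x) = k * rint a b f.
Proof. by move=> F; rewrite /rint RintegralZl //; apply: rcont_on_integrable. Qed.

Lemma rint_ext a b f g : (forall x, a <= x <= b -> f x = g x) -> rint a b f = rint a b g.
Proof.
by move=> H; apply: eq_Rintegral => x; rewrite inE /= in_itv /= => /H.
Qed.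

Lemma rint_cst a b c : a <= b -> rint a b (fun=> c) = c * (b - a).
Proof.
move=> ab; rewrite /rint Rintegral_cst //= lebesgue_measure_itv /= lte_fin.
case: ltP => [ab'|ba]; first by [].
have -> : b = a by apply/eqP; rewrite eq_le ab ba.
by rewrite subrr mulr0.
Qed.

Lemma rint_le a b f g : rcont_on a b f -> rcont_on a b g ->
  (forall x, a <= x <= b -> f x <= g x) -> rint a b f <= rint a b g.
Proof.
move=> F G H; apply: le_Rintegral => //; exact: rcont_on_integrable.
Qed.

Lemma rint_bound a b f B : a <= b -> rcont_on a b f ->
  (forall x, a <= x <= b -> `|f x| <= B) -> `|rint a b f| <= B * (b - a).
Proof.
move=> ab F H; rewrite ler_norml; apply/andP; split.
  rewrite -mulNr -rint_cst //; apply: rint_le => //; first exact: rcont_on_cst.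
  by move=> x /H; rewrite ler_norml => /andP[].
rewrite -rint_cst //; apply: rint_le => //; first exact: rcont_on_cst.
by move=> x /H; rewrite ler_norml => /andP[].
Qed.

Lemma rint_cat a b c f : a <= c <= b -> rcont_on a b f ->
  rint a b f = rint a c f + rint c b f.
Proof.
move=> /andP[ac cb] F.
have Fi := rcont_on_integrable F.
have := @Rintegral_itvB R f (BLeft a) (BRight b) c Fi.
rewrite !bnd_simp => /(_ ac cb).
rewrite Rintegral_itv_obnd_cbnd; last first.
  apply: (integrableS _ _ _ Fi) => //.
  by apply: subset_itvr; rewrite bnd_simp.
by rewrite -/(rint a b f) -/(rint a c f) -/(rint c b f) => <-; rewrite addrC subrK.
Qed.

Lemma rint_FTC a b f F : a <= b -> rcont_on a b f ->
  (forall x, a <= x <= b -> rdiff F x (f x)) -> rint a b f = F b - F a.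
Proof.
rewrite le_eqVlt => /orP[/eqP <- _ _|ab Hf HF].
  by rewrite /rint set_itv1 Rintegral_set1 subrr.
rewrite /rint /Rintegral (@continuous_FTC2 _ f F) //.
- exact: rcont_on_within.
- have C x : a <= x <= b -> F x @[x --> x] --> F x.
    by move=> /HF/rdiff_cont/rcontP.
  split.
  + move=> x; rewrite in_itv /= => xab.
    have /HF/rdiffP H : a <= x <= b by lra.
    exact: ex_derive.
  + by apply: cvg_at_right_filter; apply: C; lra.
  + by apply: cvg_at_left_filter; apply: C; lra.
- move=> x; rewrite in_itv /= => xab.
  have /HF/rdiffP H : a <= x <= b by lra.
  by rewrite derive1E derive_val.
Qed.

Lemma rint_ge_cst a b f B : a <= b -> rcont_on a b f ->
  (forall x, a <= x <= b -> B <= f x) -> B * (b - a) <= rint a b f.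
Proof.
move=> ab F H; rewrite -rint_cst //; apply: rint_le => //; exact: rcont_on_cst.
Qed.

Definition pcont (F : R -> R[i]) x := forall e : R, 0 < e ->
  exists2 r : R, 0 < r & forall k, `|k| < r -> cabs (F (x + k) - F x) <= e.

Definition pcont_on a b F := forall x, a <= x <= b -> pcont F x.

Definition cint a b (F : R -> R[i]) : R[i] :=
  rint a b (fun x => complex.Re (F x)) +i* rint a b (fun x => complex.Im (F x)).

Lemma pcont_on_Re a b F : pcont_on a b F -> rcont_on a b (fun x => complex.Re (F x)).
Proof.
move=> H x /H{}H e /H[r r0 {}H]; exists r => // k /H; apply: le_trans.
by rewrite -ReN -ReD Re_cabs.
Qed.

Lemma pcont_on_Im a b F : pcont_on a b F -> rcont_on a b (fun x => complex.Im (F x)).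
Proof.
move=> H x /H{}H e /H[r r0 {}H]; exists r => // k /H; apply: le_trans.
by rewrite -ImN -ImD Im_cabs.
Qed.

Lemma cint_ext a b F G : (forall x, a <= x <= b -> F x = G x) -> cint a b F = cint a b G.
Proof. by move=> H; congr (_ +i* _); apply: rint_ext => x /H ->. Qed.

Lemma cintD a b F G : pcont_on a b F -> pcont_on a b G ->
  cint a b (fun x => F x + G x) = cint a b F + cint a b G.
Proof.
move=> HF HG; apply: complexP => /=.
  rewrite -rintD; [|exact: pcont_on_Re..]; by apply: rint_ext => x _; rewrite ReD.
rewrite -rintD; [|exact: pcont_on_Im..]; by apply: rint_ext => x _; rewrite ImD.
Qed.

Lemma cintZ a b (c : R[i]) F : pcont_on a b F ->
  cint a b (fun x => c * F x) = c * cint a b F.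
Proof.
move=> HF; have HR := pcont_on_Re HF; have HI := pcont_on_Im HF.
apply: complexP; rewrite ?ReM ?ImM /=.
  rewrite -!rintZ // -mulN1r -rintZ; last exact: rcont_onZ.
  rewrite -rintD; [|by do ?apply: rcont_onZ..].
  by apply: rint_ext => x _; rewrite ReM mulN1r.
rewrite -!rintZ // -rintD; [|by do ?apply: rcont_onZ..].
by apply: rint_ext => x _; rewrite ImM.
Qed.

Lemma cint_cat a b c F : a <= c <= b -> pcont_on a b F ->
  cint a b F = cint a c F + cint c b F.
Proof.
move=> acb HF; apply: complexP => /=; apply: rint_cat => //.
  exact: pcont_on_Re.
exact: pcont_on_Im.
Qed.

(** The factor 2 comes from bounding the real and imaginary parts separately.
    It is harmless, since only orders of magnitude matter below. *)
Lemma cint_bound a b F B : a <= b -> pcont_on a b F ->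
  (forall x, a <= x <= b -> cabs (F x) <= B) -> cabs (cint a b F) <= 2 * B * (b - a).
Proof.
move=> ab HF H; apply: le_trans (cabs_ReIm _) _ => /=.
have -> : 2 * B * (b - a) = B * (b - a) + B * (b - a) by ring.
apply: lerD; apply: rint_bound => //; try exact: pcont_on_Re; try exact: pcont_on_Im.
  by move=> x /H; apply: le_trans (Re_cabs _).
by move=> x /H; apply: le_trans (Im_cabs _).
Qed.

Lemma cint_FTC a b (F f : R -> R[i]) : a <= b -> pcont_on a b f ->
  (forall x, a <= x <= b -> rdiff (fun t => complex.Re (F t)) x (complex.Re (f x)) /\
     rdiff (fun t => complex.Im (F t)) x (complex.Im (f x))) ->
  cint a b f = F b - F a.
Proof.
move=> ab Hf HF; apply: complexP; rewrite ?ReD ?ReN ?ImD ?ImN /=.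
  rewrite (@rint_FTC a b _ (fun t => complex.Re (F t))) //; first exact: pcont_on_Re.
  by move=> x /HF[].
rewrite (@rint_FTC a b _ (fun t => complex.Im (F t))) //; first exact: pcont_on_Im.
by move=> x /HF[].
Qed.

Lemma cint_cst a b (c : R[i]) : a <= b -> cint a b (fun=> c) = c * (b - a)%:C.
Proof.
by move=> ab; apply: complexP; rewrite ?ReM ?ImM /= rint_cst //; ring.
Qed.

End IntervalIntegral.

(** * Boundary integrals over rectangles *)

Section Rect.
Variable R : realType.
Implicit Types (F G : R[i] -> R[i]) (z w : R[i]) (a b x y : R).

Lemma ccontD F G z : ccont F z -> ccont G z -> ccont (fun w => F w + G w) z.
Proof.
move=> HF HG e e0; have e2 : 0 < e / 2 by rewrite divr_gt0.
have [d d0 {}HF] := HF _ e2; have [d' d'0 {}HG] := HG _ e2.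
exists (Num.min d d'); first by rewrite lt_min d0 d'0.
move=> h; rewrite lt_min => /andP[/HF hf /HG hg].
rewrite opprD addrACA; apply: le_trans (cabsD _ _) _; lra.
Qed.

Lemma ccontM F G z : ccont F z -> ccont G z -> ccont (fun w => F w * G w) z.
Proof.
move=> HF HG e e0.
have F0 := cabs_ge0 (F z); have G0 := cabs_ge0 (G z).
set c := cabs (F z) + cabs (G z) + 1; have c0 : 0 < c by rewrite /c; lra.
set e' := Num.min 1 (e / c).
have e'0 : 0 < e' by rewrite lt_min ltr01 divr_gt0.
have e'1 : e' <= 1 by rewrite ge_min lexx.
have e'c : e' * c <= e by rewrite -ler_pdivlMr // ge_min lexx orbT.
have [d d0 {}HF] := HF _ e'0; have [d' d'0 {}HG] := HG _ e'0.
exists (Num.min d d'); first by rewrite lt_min d0 d'0.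
move=> h; rewrite lt_min => /andP[/HF hf /HG hg].
have -> : F (z + h) * G (z + h) - F z * G z =
  (F (z + h) - F z) * (G (z + h) - G z) + (F (z + h) - F z) * G z
  + F z * (G (z + h) - G z) by ring.
apply: le_trans (cabsD _ _) _; apply: le_trans (lerD (cabsD _ _) (lexx _)) _.
rewrite !cabsM; apply: le_trans e'c.
have t1 : cabs (F (z + h) - F z) * cabs (G (z + h) - G z) <= e' * 1.
  by apply: ler_pM; rewrite ?cabs_ge0 //; apply: le_trans hg _.
have t2 := ler_wpM2r G0 hf; have t3 := ler_wpM2l F0 hg.
by rewrite /c; lra.
Qed.

Lemma ccontV F z : F z != 0 -> ccont F z -> ccont (fun w => (F w)^-1) z.
Proof.
move=> F0 HF e e0; set m := cabs (F z).
have m0 : 0 < m by rewrite cabs_gt0.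
set e' := Num.min (m / 2) (e * (m * (m / 2))).
have e'0 : 0 < e' by rewrite lt_min divr_gt0 // !mulr_gt0 // divr_gt0.
have [d d0 {}HF] := HF _ e'0; exists d => // h /HF {}HF.
have [h1 h2] : cabs (F (z + h) - F z) <= m / 2 /\
    cabs (F (z + h) - F z) <= e * (m * (m / 2)).
  by split; apply: le_trans HF _; rewrite ge_min lexx ?orbT.
have Fh : m / 2 <= cabs (F (z + h)).
  have := cabs_ge_sub (F z) (F z - F (z + h)).
  rewrite subKr cabs_distC -/m; lra.
have Fh0 : F (z + h) != 0 by rewrite -cabs_gt0; lra.
have -> : (F (z + h))^-1 - (F z)^-1 = - (F (z + h) - F z) / (F z * F (z + h)).
  by field; rewrite F0 Fh0.
rewrite !(cabsM, cabsV, cabsN) -/m ler_pdivrMr; last by rewrite mulr_gt0 //; lra.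
apply: le_trans h2 _; apply: ler_wpM2l; first exact: ltW.
by apply: ler_wpM2l => //; exact: ltW.
Qed.

Lemma ccont_cst c z : ccont (fun=> c) z.
Proof. exact: wdiff_cont (wdiff_cst c z). Qed.

Lemma ccont_id z : ccont id z.
Proof. exact: wdiff_cont (wdiff_id z). Qed.

Lemma ccont_conj F z : ccont F z -> ccont (fun w => (F w)^*%C) z.
Proof.
move=> H e /H[d d0 {}H]; exists d => // h /H.
by rewrite -(cabs_conj (_ - _)) rmorphB.
Qed.

Lemma ccont_local F G z r : 0 < r ->
  (forall w, cabs (w - z) < r -> F w = G w) -> ccont F z -> ccont G z.
Proof.
move=> r0 FG H e /H[d d0 {}H].
exists (Num.min d r); first by rewrite lt_min d0 r0.
move=> h; rewrite lt_min => /andP[hd hr].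
rewrite -(FG (z + h)); last by rewrite [z + h]addrC addrK.
by rewrite -FG ?subrr ?cabs0 //; exact: H.
Qed.

Lemma ccont_hor F x y : ccont F (x +i* y) -> pcont (fun t => F (t +i* y)) x.
Proof.
move=> H e /H[d d0 {}H]; exists d => // k kd.
have := H k%:C; rewrite cabs_real => /(_ kd).
by rewrite [x +i* y + _](_ : _ = (x + k) +i* y) //; apply: complexP => //=; rewrite addr0.
Qed.

Lemma ccont_ver F x y : ccont F (x +i* y) -> pcont (fun t => F (x +i* t)) y.
Proof.
move=> H e /H[d d0 {}H]; exists d => // k kd.
have := H (k%:C * (0 +i* 1)); rewrite cabsM cabs_real cabs_i mulr1 => /(_ kd).
rewrite [x +i* y + _](_ : _ = x +i* (y + k)) //.
by apply: complexP => /=; ring.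
Qed.

Lemma wdiff_eq F z (A B A' B' : R[i]) : wdiff F z A B -> A = A' -> B = B' ->
  wdiff F z A' B'.
Proof. by move=> H <- <-. Qed.

Lemma rdiff_ext (f g : R -> R) x d : f =1 g -> rdiff f x d -> rdiff g x d.
Proof. by move=> fg H e /H[r r0 {}H]; exists r => // k; rewrite -!fg; apply: H. Qed.

Definition crect x0 x1 y0 y1 z :=
  (x0 <= complex.Re z <= x1) && (y0 <= complex.Im z <= y1).

Definition brect x0 x1 y0 y1 z := crect x0 x1 y0 y1 z &&
  [|| complex.Re z == x0, complex.Re z == x1, complex.Im z == y0 |
      complex.Im z == y1].

Definition rect_cont F x0 x1 y0 y1 := forall z, brect x0 x1 y0 y1 z -> ccont F z.

Definition hseg_int F x0 x1 y := cint x0 x1 (fun t => F (t +i* y)).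
Definition vseg_int F x y0 y1 := cint y0 y1 (fun t => F (x +i* t)).

(** The contour integral of [F(z) dz] along the boundary, counterclockwise:
    bottom minus top, plus [i] times right minus left. *)
Definition rect_int F x0 x1 y0 y1 : R[i] :=
  (hseg_int F x0 x1 y0 - hseg_int F x0 x1 y1)
  + (0 +i* 1) * (vseg_int F x1 y0 y1 - vseg_int F x0 y0 y1).

Section OneRect.
Variables x0 x1 y0 y1 : R.
Hypotheses (x01 : x0 <= x1) (y01 : y0 <= y1).

Lemma brect_bottom t : x0 <= t <= x1 -> brect x0 x1 y0 y1 (t +i* y0).
Proof. by move=> H; rewrite /brect /crect /= H lexx y01 eqxx /= !orbT. Qed.
Lemma brect_top t : x0 <= t <= x1 -> brect x0 x1 y0 y1 (t +i* y1).
Proof. by move=> H; rewrite /brect /crect /= H lexx y01 eqxx /= !orbT. Qed.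
Lemma brect_left t : y0 <= t <= y1 -> brect x0 x1 y0 y1 (x0 +i* t).
Proof. by move=> H; rewrite /brect /crect /= H lexx x01 eqxx /=. Qed.
Lemma brect_right t : y0 <= t <= y1 -> brect x0 x1 y0 y1 (x1 +i* t).
Proof. by move=> H; rewrite /brect /crect /= H lexx x01 eqxx /= !orbT. Qed.

Lemma rect_cont_sides F : rect_cont F x0 x1 y0 y1 ->
  [/\ pcont_on x0 x1 (fun t => F (t +i* y0)), pcont_on x0 x1 (fun t => F (t +i* y1)),
      pcont_on y0 y1 (fun t => F (x0 +i* t)) & pcont_on y0 y1 (fun t => F (x1 +i* t))].
Proof.
move=> H; split => t tI.
- by apply: ccont_hor; apply/H/brect_bottom.
- by apply: ccont_hor; apply/H/brect_top.
- by apply: ccont_ver; apply/H/brect_left.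
- by apply: ccont_ver; apply/H/brect_right.
Qed.

Lemma rect_int_ext F G : (forall z, brect x0 x1 y0 y1 z -> F z = G z) ->
  rect_int F x0 x1 y0 y1 = rect_int G x0 x1 y0 y1.
Proof.
move=> H; rewrite /rect_int /hseg_int /vseg_int.
by do ![congr (_ + _) | congr (_ * _) | congr (- _)]; apply: cint_ext => t tI; apply: H;
 [apply: brect_bottom | apply: brect_top| apply: brect_right| apply: brect_left].
Qed.

Lemma rect_intD F G : rect_cont F x0 x1 y0 y1 -> rect_cont G x0 x1 y0 y1 ->
  rect_int (fun z => F z + G z) x0 x1 y0 y1 =
    rect_int F x0 x1 y0 y1 + rect_int G x0 x1 y0 y1.
Proof.
move=> /rect_cont_sides[F1 F2 F3 F4] /rect_cont_sides[G1 G2 G3 G4].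
by rewrite /rect_int /hseg_int /vseg_int !cintD //; ring.
Qed.

Lemma rect_intZ c F : rect_cont F x0 x1 y0 y1 ->
  rect_int (fun z => c * F z) x0 x1 y0 y1 = c * rect_int F x0 x1 y0 y1.
Proof.
by move=> /rect_cont_sides[F1 F2 F3 F4];
  rewrite /rect_int /hseg_int /vseg_int !cintZ //; ring.
Qed.

Lemma rect_int_bound F B : rect_cont F x0 x1 y0 y1 ->
  (forall z, brect x0 x1 y0 y1 z -> cabs (F z) <= B) ->
  cabs (rect_int F x0 x1 y0 y1) <= 4 * B * ((x1 - x0) + (y1 - y0)).
Proof.
move=> /rect_cont_sides[F1 F2 F3 F4] H; rewrite /rect_int /hseg_int /vseg_int.
have := @cint_bound _ _ _ _ B x01 F1 (fun t I => H _ (brect_bottom I)).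
have := @cint_bound _ _ _ _ B x01 F2 (fun t I => H _ (brect_top I)).
have := @cint_bound _ _ _ _ B y01 F3 (fun t I => H _ (brect_left I)).
have := @cint_bound _ _ _ _ B y01 F4 (fun t I => H _ (brect_right I)).
set a1 := cint _ _ _; set a2 := cint _ _ _; set a3 := cint _ _ _; set a4 := cint _ _ _.
move=> b1 b2 b3 b4.
have := cabsD (a4 - a3) ((0 +i* 1) * (a1 - a2)).
have := cabsB a4 a3; have := cabsB a1 a2.
rewrite cabsM cabs_i mul1r; lra.
Qed.

Lemma rect_int_exact F G : rect_cont F x0 x1 y0 y1 ->
  (forall z, brect x0 x1 y0 y1 z -> holo G z (F z)) -> rect_int F x0 x1 y0 y1 = 0.
Proof.
move=> /rect_cont_sides[F1 F2 F3 F4] H; rewrite /rect_int /hseg_int /vseg_int.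
have hh y : pcont_on x0 x1 (fun t => F (t +i* y)) ->
   (forall t, x0 <= t <= x1 -> holo G (t +i* y) (F (t +i* y))) ->
   cint x0 x1 (fun t => F (t +i* y)) = G (x1 +i* y) - G (x0 +i* y).
  move=> Fc Gh; rewrite (@cint_FTC _ x0 x1 (fun t => G (t +i* y))) // => x /Gh.
  rewrite /holo; have E t : t +i* y = (0 +i* y) + t%:C * 1.
    by apply: complexP => /=; ring.
  rewrite {1}E => /wdiff_line[]; rewrite mul0r addr0 mulr1 => H1 H2.
  by split; [apply: rdiff_ext H1|apply: rdiff_ext H2] => t; rewrite -E.
have vv x : pcont_on y0 y1 (fun t => F (x +i* t)) ->
   (forall t, y0 <= t <= y1 -> holo G (x +i* t) (F (x +i* t))) ->
   (0 +i* 1) * cint y0 y1 (fun t => F (x +i* t)) = G (x +i* y1) - G (x +i* y0).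
  move=> Fc Gh; rewrite -cintZ //.
  rewrite (@cint_FTC _ y0 y1 (fun t => G (x +i* t))) //.
    move=> t tI e e0; have [r r0 {}Fc] := Fc t tI e e0.
    by exists r => // k /Fc; rewrite -mulrBr cabsM cabs_i mul1r.
  move=> y /Gh.
  rewrite /holo; have E t : x +i* t = (x +i* 0) + t%:C * (0 +i* 1).
    by apply: complexP => /=; ring.
  rewrite {1}E => /wdiff_line[]; rewrite mul0r addr0 [F _ * _]mulrC => H1 H2.
  by split; [apply: rdiff_ext H1|apply: rdiff_ext H2] => t; rewrite -E.
rewrite mulrBr !hh ?vv //; try ring.
all: by move=> t tI; apply: H;
  solve [exact: brect_bottom|exact: brect_top| exact: brect_right| exact: brect_left].
Qed.

(** Twice [i] times the area: on linear functions, only the conjugate part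
    contributes to the contour integral. *)
Lemma rect_int_conj : rect_int (fun z => z^*%C) x0 x1 y0 y1 =
  (0 +i* 2) * ((x1 - x0) * (y1 - y0))%:C.
Proof.
have E F : (fun z => F z) = F by [].
have C1 c : rect_cont (fun=> c) x0 x1 y0 y1 by move=> z _; apply: ccont_cst.
rewrite (@rect_int_ext _ (fun z => (-1) * z + 2%:C * (complex.Re z)%:C)); last first.
  by move=> z _; apply: complexP; case: z => a b /=; ring.
have Cid : rect_cont id x0 x1 y0 y1 by move=> z _; apply: ccont_id.
have CRe : rect_cont (fun z => (complex.Re z)%:C) x0 x1 y0 y1.
  move=> z _ e e0; exists e => // h he; apply/ltW; apply: le_lt_trans he.
  rewrite -rmorphB cabs_real ReD addrAC subrr add0r; exact: Re_cabs.
rewrite rect_intD; [|by move=> z I; apply: ccontM; [exact: ccont_cst|auto]..].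
rewrite !rect_intZ //.
have -> : rect_int id x0 x1 y0 y1 = 0.
  apply: (@rect_int_exact _ (fun z => (1 / 2) * (z * z))) => // z _.
  apply: wdiff_eq (wdiffM (wdiff_cst (1 / 2) z) (wdiffM (wdiff_id z) (wdiff_id z))) _ _.
    by field.
  by ring.
rewrite mulr0 add0r.
rewrite /rect_int /hseg_int /vseg_int /=.
rewrite subrr add0r !cint_cst //.
by apply: complexP => /=; rewrite ?ReImE /=; ring.
Qed.

End OneRect.

Lemma crectP x0 x1 y0 y1 z : crect x0 x1 y0 y1 z =
  [&& x0 <= complex.Re z, complex.Re z <= x1, y0 <= complex.Im z & complex.Im z <= y1].
Proof. by rewrite /crect -!andbA. Qed.

Lemma rect_int_cutx F x0 x1 y0 y1 c : y0 <= y1 -> x0 <= c <= x1 ->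
  rect_cont F x0 x1 y0 y1 ->
  rect_int F x0 x1 y0 y1 = rect_int F x0 c y0 y1 + rect_int F c x1 y0 y1.
Proof.
move=> y01 cI Fc; have x01 : x0 <= x1 by case/andP: cI; apply: le_trans.
have [F1 F2 F3 F4] := rect_cont_sides x01 y01 Fc.
rewrite /rect_int /hseg_int /vseg_int (cint_cat cI F1) (cint_cat cI F2); ring.
Qed.

Lemma rect_int_cuty F x0 x1 y0 y1 c : x0 <= x1 -> y0 <= c <= y1 ->
  rect_cont F x0 x1 y0 y1 ->
  rect_int F x0 x1 y0 y1 = rect_int F x0 x1 y0 c + rect_int F x0 x1 c y1.
Proof.
move=> x01 cI Fc; have y01 : y0 <= y1 by case/andP: cI; apply: le_trans.
have [F1 F2 F3 F4] := rect_cont_sides x01 y01 Fc.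
rewrite /rect_int /hseg_int /vseg_int (cint_cat cI F3) (cint_cat cI F4); ring.
Qed.

End Rect.

(** * Additive functions of rectangles *)

Section Bisection.
Variable R : realType.

(** The sides of the nested rectangles below become arbitrarily small. *)
Lemma exists_lt_div_pow2 (W d : R) : 0 < d -> exists n, W / 2 ^+ n < d.
Proof.
move=> d0; exists (Num.truncn (`|W| / d)).+1.
have p0 : 0 < (2 : R) ^+ (Num.truncn (`|W| / d)).+1 by rewrite exprn_gt0.
rewrite ltr_pdivrMr // mulrC -ltr_pdivrMr //.
apply: (@le_lt_trans _ _ (`|W| / d)).
  by rewrite ler_pM2r ?invr_gt0 // ler_norm.
have := Num.Theory.truncnS_gt (`|W| / d); move=> /lt_le_trans; apply.
by rewrite -natrX ler_nat ltnW // ltn_expl.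
Qed.

Variables (D : R -> R -> R -> R -> R[i]) (X0 X1 Y0 Y1 : R).
Hypotheses (X01 : X0 <= X1) (Y01 : Y0 <= Y1).
Hypothesis cutx : forall x0 x1 y0 y1 c, X0 <= x0 -> x0 <= c <= x1 -> x1 <= X1 ->
  Y0 <= y0 -> y0 <= y1 -> y1 <= Y1 ->
  D x0 x1 y0 y1 = D x0 c y0 y1 + D c x1 y0 y1.
Hypothesis cuty : forall x0 x1 y0 y1 c, Y0 <= y0 -> y0 <= c <= y1 -> y1 <= Y1 ->
  X0 <= x0 -> x0 <= x1 -> x1 <= X1 ->
  D x0 x1 y0 y1 = D x0 x1 y0 c + D x0 x1 c y1.
Hypothesis loc : forall x y, X0 <= x <= X1 -> Y0 <= y <= Y1 -> forall e, 0 < e ->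
  exists2 d : R, 0 < d & forall x0 x1 y0 y1, X0 <= x0 -> x0 <= x <= x1 -> x1 <= X1 ->
  Y0 <= y0 -> y0 <= y <= y1 -> y1 <= Y1 -> x1 - x0 < d -> y1 - y0 < d ->
  cabs (D x0 x1 y0 y1) <= e * ((x1 - x0) + (y1 - y0)) ^+ 2.

Let ok (r : (R * R) * (R * R)) :=
  [/\ X0 <= r.1.1, r.1.1 <= r.1.2 & r.1.2 <= X1] /\
  [/\ Y0 <= r.2.1, r.2.1 <= r.2.2 & r.2.2 <= Y1].
Let sz (r : (R * R) * (R * R)) := (r.1.2 - r.1.1) + (r.2.2 - r.2.1).
Let Dr (r : (R * R) * (R * R)) := D r.1.1 r.1.2 r.2.1 r.2.2.
Let sub (r s : (R * R) * (R * R)) :=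
  [/\ s.1.1 <= r.1.1, r.1.2 <= s.1.2 & r.1.2 - r.1.1 = (s.1.2 - s.1.1) / 2] /\
  [/\ s.2.1 <= r.2.1, r.2.2 <= s.2.2 & r.2.2 - r.2.1 = (s.2.2 - s.2.1) / 2].

Local Ltac rect_bounds :=
  split; split; solve [assumption | reflexivity | lra].

(** Of four quarters, one is at least as bad as the whole rectangle, because
    [sz r ^+ 2] is the sum of the squares of the sizes of the quarters. *)
Lemma bisection_step e r : ok r -> e * sz r ^+ 2 < cabs (Dr r) ->
  exists s, [/\ ok s, sub s r & e * sz s ^+ 2 < cabs (Dr s)].
Proof.
case: r => [[x0 x1] [y0 y1]]; rewrite /ok /sz /Dr /= => -[[h1 h2 h3] [h4 h5 h6]] big.
set c := (x0 + x1) / 2; set d := (y0 + y1) / 2.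
have cI : x0 <= c <= x1 by rewrite /c; lra.
have dI : y0 <= d <= y1 by rewrite /d; lra.
apply: contrapT => none.
have nb s : ok s -> sub s ((x0, x1), (y0, y1)) -> cabs (Dr s) <= e * sz s ^+ 2.
  by move=> oks subs; rewrite leNgt; apply/negP => B; apply: none; exists s.
move: big; rewrite ltNge => /negP; apply.
rewrite (cutx h1 cI h3 h4 h5 h6).
rewrite (@cuty x0 c y0 y1 d) //; [|lra..].
rewrite (@cuty c x1 y0 y1 d) //; [|lra..].
have := nb ((x0, c), (y0, d)); rewrite /ok /sub /sz /Dr /=.
have := nb ((x0, c), (d, y1)); rewrite /ok /sub /sz /Dr /=.
have := nb ((c, x1), (y0, d)); rewrite /ok /sub /sz /Dr /=.
have := nb ((c, x1), (d, y1)); rewrite /ok /sub /sz /Dr /=.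
have -> : c - x0 = (x1 - x0) / 2 by rewrite /c; field.
have -> : x1 - c = (x1 - x0) / 2 by rewrite /c; field.
have -> : d - y0 = (y1 - y0) / 2 by rewrite /d; field.
have -> : y1 - d = (y1 - y0) / 2 by rewrite /d; field.
have -> : e * (x1 - x0 + (y1 - y0)) ^+ 2 =
   4 * (e * ((x1 - x0) / 2 + (y1 - y0) / 2) ^+ 2) by field.
set a := D _ _ _ _; set b := D _ _ _ _; set a' := D _ _ _ _; set b' := D _ _ _ _.
have [cI1 cI2] := andP cI; have [dI1 dI2] := andP dI.
move=> E1 E2 E3 E4.
have {}E1 := E1 ltac:(rect_bounds) ltac:(rect_bounds).
have {}E2 := E2 ltac:(rect_bounds) ltac:(rect_bounds).
have {}E3 := E3 ltac:(rect_bounds) ltac:(rect_bounds).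
have {}E4 := E4 ltac:(rect_bounds) ltac:(rect_bounds).
apply: le_trans (cabsD _ _) _.
apply: le_trans (lerD (cabsD _ _) (cabsD _ _)) _.
lra.
Qed.

(** Goursat's bisection argument, isolated from contour integrals: if [D] did
    not vanish, nested quarters would shrink to a point at which the local
    estimate [loc] fails. *)
Lemma additive_rect_eq0 : D X0 X1 Y0 Y1 = 0.
Proof.
apply/eqP; rewrite -cabs_eq0; apply/negP => /negP Dn0.
have D0 : 0 < cabs (D X0 X1 Y0 Y1) by rewrite lt_def Dn0 cabs_ge0.
set p := (X1 - X0) + (Y1 - Y0).
have p0 : 0 <= p by rewrite /p addr_ge0 // subr_ge0.
(* Small enough for the whole rectangle to be bad, even if it is a point. *)
set e := cabs (D X0 X1 Y0 Y1) / 2 / (p ^+ 2 + 1).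
have p1 : 0 < p ^+ 2 + 1 by rewrite ltr_wpDl // sqr_ge0.
have e0 : 0 < e by rewrite !divr_gt0.
set r0 := ((X0, X1), (Y0, Y1)).
pose good r := ok r /\ e * sz r ^+ 2 < cabs (Dr r).
have g0 : good r0.
  split; first by rewrite /ok /=; repeat split.
  rewrite /sz /Dr /= -/p.
  have -> : e * p ^+ 2 = cabs (D X0 X1 Y0 Y1) / 2 * (p ^+ 2 / (p ^+ 2 + 1)).
    by rewrite /e; field; rewrite gt_eqF.
  have : p ^+ 2 / (p ^+ 2 + 1) <= 1 by rewrite ler_pdivrMr // mul1r lerDl.
  move=> H; apply: (@le_lt_trans _ _ (cabs (D X0 X1 Y0 Y1) / 2 * 1)).
    by rewrite ler_wpM2l // divr_ge0 // ltW.
  by rewrite mulr1; lra.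
have [f Hf] : exists f, forall r, good r -> good (f r) /\ sub (f r) r.
  have /choice[f Hf] : forall r, exists s, good r -> good s /\ sub s r.
    move=> r; have [[okr bad]|nr] := pselect (good r); last by exists r.
    by have [s [h1 h2 h3]] := bisection_step okr bad; exists s.
  by exists f.
pose q n := iter n f r0.
have gq n : good (q n) by elim: n => // n /Hf[].
have csquare n : sub (q n.+1) (q n) by have /Hf[] := gq n.
have mono n m : (n <= m)%N ->
  [/\ (q n).1.1 <= (q m).1.1, (q m).1.2 <= (q n).1.2,
      (q n).2.1 <= (q m).2.1 & (q m).2.2 <= (q n).2.2].
  move=> /subnK <-; elim: (m - n)%N => [|k [i1 i2 i3 i4]]; first by split; rewrite add0n.
  have [[s1 s2 _] [s3 s4 _]] := csquare (k + n)%N; rewrite addSn.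
  split; [exact: le_trans s1|exact: le_trans i2|exact: le_trans s3|exact: le_trans i4].
have w n : (q n).1.2 - (q n).1.1 = (X1 - X0) / 2 ^+ n /\
           (q n).2.2 - (q n).2.1 = (Y1 - Y0) / 2 ^+ n.
  elim: n => [|n [IH1 IH2]]; first by rewrite /q /= expr0 !divr1.
  have [[_ _ ->] [_ _ ->]] := csquare n; rewrite IH1 IH2 exprSr !invfM.
  by split; rewrite mulrA.
have lower_upper (g h : nat -> R) :
   (forall n m, (n <= m)%N -> g n <= g m) -> (forall n m, (n <= m)%N -> h m <= h n) ->
   (forall n, g n <= h n) -> exists x, forall n, g n <= x <= h n.
  move=> jcont_measurable_EFin hm gh; have gh' n m : g n <= h m.
    have [nm|mn] := leqP n m; first exact: le_trans (jcont_measurable_EFin _ _ nm) (gh m).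
    by apply: le_trans (gh n) (hm _ _ _); apply: ltnW.
  exists (sup (range g)) => n; apply/andP; split.
    apply: ub_le_sup; last by exists n.
    by exists (h 0%N) => _ [k _ <-].
  apply: ge_sup; first by exists (g 0%N); exists 0%N.
  by move=> _ [k _ <-].
have [x Hx] : exists x, forall n, (q n).1.1 <= x <= (q n).1.2.
  apply: lower_upper => [n m /mono[]|n m /mono[]|n] //.
  by have [[[]]] := gq n.
have [y Hy] : exists y, forall n, (q n).2.1 <= y <= (q n).2.2.
  apply: lower_upper => [n m /mono[]|n m /mono[]|n] //.
  by have [[_ []]] := gq n.
have [d d0 Hd] := loc (Hx 0%N) (Hy 0%N) e0.
have [n1 Hn1] := exists_lt_div_pow2 (X1 - X0) d0.
have [n2 Hn2] := exists_lt_div_pow2 (Y1 - Y0) d0.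
set n := maxn n1 n2.
have dec (W : R) k l : 0 <= W -> (k <= l)%N -> W / 2 ^+ l <= W / 2 ^+ k.
  move=> W0 kl; rewrite ler_wpM2l // lef_pV2 ?posrE ?exprn_gt0 //.
  by rewrite ler_weXn2l // ler1n.
have [okq bad] := gq n.
have [[h1 h2 h3] [h4 h5 h6]] := okq.
have [w1 w2] := w n.
move: bad; rewrite ltNge => /negP; apply; apply: Hd => //.
  rewrite w1; apply: le_lt_trans Hn1; apply: dec; [lra|exact: leq_maxl].
rewrite w2; apply: le_lt_trans Hn2; apply: dec; [lra|exact: leq_maxr].
Qed.

End Bisection.

(** * The theorems of Green and Goursat *)

Section Green.
Variable R : realType.
Implicit Types (F G : R[i] -> R[i]) (z w : R[i]) (a b x y : R).

Lemma rect_cont_sub F X0 X1 Y0 Y1 x0 x1 y0 y1 :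
  (forall z, crect X0 X1 Y0 Y1 z -> ccont F z) ->
  X0 <= x0 -> x1 <= X1 -> Y0 <= y0 -> y1 <= Y1 -> rect_cont F x0 x1 y0 y1.
Proof.
move=> H h1 h2 h3 h4 z /andP[]; rewrite crectP => /and4P[z1 z2 z3 z4] _.
apply: H; rewrite crectP; apply/and4P; split; lra.
Qed.

Lemma rect_int_affine c A B x0 x1 y0 y1 : x0 <= x1 -> y0 <= y1 ->
  rect_int (fun z => (c + A * z) + B * z^*%C) x0 x1 y0 y1 =
  B * ((0 +i* 2) * ((x1 - x0) * (y1 - y0))%:C).
Proof.
move=> x01 y01.
have Cc : rect_cont (fun z => z^*%C) x0 x1 y0 y1.
  by move=> z _; apply: ccont_conj; apply: ccont_id.
have CA : rect_cont (fun z => c + A * z) x0 x1 y0 y1.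
  move=> z _; apply: ccontD; first exact: ccont_cst.
  by apply: ccontM; [exact: ccont_cst|exact: ccont_id].
have CB : rect_cont (fun z => B * z^*%C) x0 x1 y0 y1.
  by move=> z I; apply: ccontM; [exact: ccont_cst|exact: Cc].
rewrite rect_intD // rect_intZ // rect_int_conj //.
rewrite (@rect_int_exact _ _ _ _ _ x01 y01 _
  (fun z => c * z + (A / 2) * (z * z))) ?add0r //.
move=> z _.
apply: wdiff_eq (wdiffD (wdiffM (wdiff_cst c z) (wdiff_id z))
  (wdiffM (wdiff_cst (A / 2) z) (wdiffM (wdiff_id z) (wdiff_id z)))) _ _.
  by field.
by ring.
Qed.

Lemma crect_dist x0 x1 y0 y1 z w : crect x0 x1 y0 y1 z -> crect x0 x1 y0 y1 w ->
  cabs (w - z) <= (x1 - x0) + (y1 - y0).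
Proof.
rewrite !crectP => /and4P[z1 z2 z3 z4] /and4P[w1 w2 w3 w4].
apply: le_trans (cabs_ReIm _) _; rewrite ReD ImD ReN ImN.
by apply: lerD; rewrite ler_norml; apply/andP; split; lra.
Qed.

(** [L] stands for [2 i] times the integral of [B], the derivative of [F] with
    respect to the conjugate variable. It is only required to be additive and
    to have the right density at each point: near [z], the affine part of [F]
    has exactly the contour integral [2 i B z] times the area, and the
    remainder contributes [o(diameter^2)]. *)
Lemma green F (B : R[i] -> R[i]) (L : R -> R -> R -> R -> R[i]) X0 X1 Y0 Y1 :
  X0 <= X1 -> Y0 <= Y1 ->
  (forall z, crect X0 X1 Y0 Y1 z -> exists A, wdiff F z A (B z)) ->
  (forall x0 x1 y0 y1 c, X0 <= x0 -> x0 <= c <= x1 -> x1 <= X1 ->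
    Y0 <= y0 -> y0 <= y1 -> y1 <= Y1 ->
    L x0 x1 y0 y1 = L x0 c y0 y1 + L c x1 y0 y1) ->
  (forall x0 x1 y0 y1 c, Y0 <= y0 -> y0 <= c <= y1 -> y1 <= Y1 ->
    X0 <= x0 -> x0 <= x1 -> x1 <= X1 ->
    L x0 x1 y0 y1 = L x0 x1 y0 c + L x0 x1 c y1) ->
  (forall z, crect X0 X1 Y0 Y1 z -> forall e, 0 < e ->
    exists2 d : R, 0 < d & forall x0 x1 y0 y1,
    X0 <= x0 -> x1 <= X1 -> Y0 <= y0 -> y1 <= Y1 -> crect x0 x1 y0 y1 z ->
    x1 - x0 < d -> y1 - y0 < d ->
    cabs (L x0 x1 y0 y1 - B z * ((0 +i* 2) * ((x1 - x0) * (y1 - y0))%:C)) <=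
      e * ((x1 - x0) + (y1 - y0)) ^+ 2) ->
  rect_int F X0 X1 Y0 Y1 = L X0 X1 Y0 Y1.
Proof.
move=> X01 Y01 HF Lx Ly Lloc.
have Fc z : crect X0 X1 Y0 Y1 z -> ccont F z.
  by move=> /HF[A]; apply: wdiff_cont.
apply/eqP; rewrite -subr_eq0; apply/eqP.
pose D x0 x1 y0 y1 := rect_int F x0 x1 y0 y1 - L x0 x1 y0 y1.
apply: (@additive_rect_eq0 _ D) => //.
- move=> x0 x1 y0 y1 c h1 h2 h3 h4 h5 h6; rewrite /D (Lx _ _ _ _ c) //.
  rewrite (@rect_int_cutx _ _ x0 x1 y0 y1 c) //; first by ring.
  exact: rect_cont_sub Fc _ _ _ _.
- move=> x0 x1 y0 y1 c h1 h2 h3 h4 h5 h6; rewrite /D (Ly _ _ _ _ c) //.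
  rewrite (@rect_int_cuty _ _ x0 x1 y0 y1 c) //; first by ring.
  exact: rect_cont_sub Fc _ _ _ _.
move=> x y xI yI e e0.
have zI : crect X0 X1 Y0 Y1 (x +i* y) by rewrite /crect /= xI yI.
set z := x +i* y in zI *.
have e2 : 0 < e / 2 by rewrite divr_gt0.
have e8 : 0 < e / 8 by rewrite divr_gt0.
have [d1 d10 {}Lloc] := Lloc z zI _ e2.
have [A HA] := HF z zI.
have [d2 d20 {}HA] := HA _ e8.
exists (Num.min d1 (d2 / 2)); first by rewrite lt_min d10 divr_gt0.
move=> x0 x1 y0 y1 h1 h2 h3 h4 h5 h6; rewrite !lt_min.
move=> /andP[w1 w2] /andP[v1 v2].
have x01 : x0 <= x1 by case/andP: h2; apply: le_trans.
have y01 : y0 <= y1 by case/andP: h5; apply: le_trans.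
have zr : crect x0 x1 y0 y1 z by rewrite /crect /= h2 h5.
have Fbc : rect_cont F x0 x1 y0 y1 by exact: rect_cont_sub Fc _ _ _ _.
(* The Taylor polynomial of F at z is c + A w + B w^*. *)
pose c := F z - A * z - B z * z^*%C.
pose Aff w := (c + A * w) + B z * w^*%C.
have Affc : rect_cont (fun w => -1 * Aff w) x0 x1 y0 y1.
  move=> w _; apply: ccontM; first exact: ccont_cst.
  apply: ccontD; last by apply: ccontM; [exact: ccont_cst|apply: ccont_conj;
    exact: ccont_id].
  apply: ccontD; first exact: ccont_cst.
  by apply: ccontM; [exact: ccont_cst|exact: ccont_id].
have Affc' : rect_cont Aff x0 x1 y0 y1.
  move=> w /Affc H; have := ccontM (ccont_cst (-1) w) H.
  by apply: (ccont_local ltr01) => v _; rewrite mulrA mulrNN !mul1r.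
have bb : cabs (rect_int (fun w => F w + (-1) * Aff w) x0 x1 y0 y1) <=
    e / 2 * (x1 - x0 + (y1 - y0)) ^+ 2.
  have -> : e / 2 * (x1 - x0 + (y1 - y0)) ^+ 2 =
    4 * (e / 8 * (x1 - x0 + (y1 - y0))) * (x1 - x0 + (y1 - y0)) by field.
  apply: rect_int_bound => //; first by move=> w I; apply: ccontD;
    [exact: Fbc|exact: Affc].
  move=> w /andP[wI _]; have wz := crect_dist zr wI.
  have := HA (w - z); rewrite [z + _]addrC subrK => H.
  have -> : F w + -1 * Aff w = F w - F z - (A * (w - z) + B z * (w - z)^*%C).
    have -> : (w - z)^*%C = w^*%C - z^*%C by rewrite rmorphB.
    by rewrite /Aff /c; ring.
  apply: (le_trans (H _)); first by lra.
  by apply: ler_wpM2l => //; exact: ltW.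
move: bb; rewrite rect_intD // rect_intZ // rect_int_affine // => bb.
have := Lloc x0 x1 y0 y1 h1 h3 h4 h6 zr w1 v1.
set T := B z * _ in bb *; move=> Lb.
rewrite /D; have -> : rect_int F x0 x1 y0 y1 - L x0 x1 y0 y1 =
  (rect_int F x0 x1 y0 y1 + -1 * T) - (L x0 x1 y0 y1 - T) by ring.
apply: le_trans (cabsB _ _) _; lra.
Qed.

(** The case [B = 0] of Green's theorem. *)
Lemma goursat F X0 X1 Y0 Y1 : X0 <= X1 -> Y0 <= Y1 ->
  (forall z, crect X0 X1 Y0 Y1 z -> exists A, holo F z A) ->
  rect_int F X0 X1 Y0 Y1 = 0.
Proof.
move=> X01 Y01 HF.
rewrite (@green F (fun=> 0) (fun _ _ _ _ => 0) X0 X1 Y0 Y1) //.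
- by move=> *; rewrite addr0.
- by move=> *; rewrite addr0.
move=> z _ e e0; exists 1 => // *; rewrite mul0r subrr cabs0 mulr_ge0 ?sqr_ge0 //.
exact: ltW.
Qed.

(** Two vertical and two horizontal cuts separate the square around [a] from
    four rectangles on which [F] is holomorphic. *)
Lemma rect_int_puncture F (a : R[i]) (d X0 X1 Y0 Y1 : R) : 0 < d ->
  X0 <= complex.Re a - d -> complex.Re a + d <= X1 ->
  Y0 <= complex.Im a - d -> complex.Im a + d <= Y1 ->
  (forall z, crect X0 X1 Y0 Y1 z -> z != a -> exists A, holo F z A) ->
  rect_int F X0 X1 Y0 Y1 = rect_int F (complex.Re a - d) (complex.Re a + d)
                            (complex.Im a - d) (complex.Im a + d).
Proof.
set p := complex.Re a; set q := complex.Im a => d0 h1 h2 h3 h4 HF.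
have cont x0 x1 y0 y1 : X0 <= x0 -> x1 <= X1 -> Y0 <= y0 -> y1 <= Y1 ->
    x0 < p < x1 -> y0 < q < y1 -> rect_cont F x0 x1 y0 y1.
  move=> k1 k2 k3 k4 k5 k6 z /andP[]; rewrite crectP => /and4P[z1 z2 z3 z4] zb.
  have [||A] := HF z; last by apply: wdiff_cont.
    by rewrite crectP; apply/and4P; split; lra.
  apply/eqP => za; move: zb; rewrite za -/p -/q.
  by case/or4P => /eqP; lra.
have zero x0 x1 y0 y1 : X0 <= x0 -> x1 <= X1 -> Y0 <= y0 -> y1 <= Y1 ->
    x0 <= x1 -> y0 <= y1 ->
    [\/ x1 < p, p < x0, y1 < q | q < y0] -> rect_int F x0 x1 y0 y1 = 0.
  move=> k1 k2 k3 k4 x01 y01 k; apply: goursat => // z.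
  rewrite crectP => /and4P[z1 z2 z3 z4]; apply: HF.
    by rewrite crectP; apply/and4P; split; lra.
  apply/eqP => za; move: z1 z2 z3 z4; rewrite za -/p -/q.
  by case: k; lra.
clear HF.
have X01 : X0 <= X1 by clear cont zero; lra.
have Y01 : Y0 <= Y1 by lra.
rewrite (@rect_int_cutx _ F X0 X1 Y0 Y1 (p - d)); [|lra|lra|apply: cont; lra].
rewrite (zero X0 (p - d)); [|lra..|constructor 1; lra].
rewrite (@rect_int_cutx _ F (p - d) X1 Y0 Y1 (p + d)); [|lra|lra|apply: cont; lra].
rewrite (zero (p + d) X1); [|lra..|constructor 2; lra].
rewrite (@rect_int_cuty _ F (p - d) (p + d) Y0 Y1 (q - d)); [|lra|lra|apply: cont; lra].
rewrite (zero (p - d) (p + d) Y0 (q - d)); [|lra..|constructor 3; lra].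
rewrite (@rect_int_cuty _ F (p - d) (p + d) (q - d) Y1 (q + d));
  [|lra|lra|apply: cont; lra].
rewrite (zero (p - d) (p + d) (q + d) Y1); [|lra..|constructor 4; lra].
by rewrite !add0r !addr0.
Qed.

End Green.

(** * Squares centred at the origin *)

Section Squares.
Variable R : realType.
Implicit Types (F G f : R[i] -> R[i]) (z w a : R[i]) (s t x y : R).

Definition csquare t z := crect (- t) t (- t) t z.
Definition osquare t z :=
  (- t < complex.Re z < t) && (- t < complex.Im z < t).
Definition square_int t F := rect_int F (- t) t (- t) t.
Definition bsquare t z := brect (- t) t (- t) t z.
Definition square_cont t F := rect_cont F (- t) t (- t) t.

Lemma bsquare_csquare t z : bsquare t z -> csquare t z. Proof. by case/andP. Qed.

Lemma osquare_csquare t z : osquare t z -> csquare t z.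
Proof.
by case/andP => /andP[? ?] /andP[? ?]; rewrite /csquare crectP; apply/and4P; split;
  apply: ltW.
Qed.

Lemma osquare0 t : 0 < t -> osquare t (0 : R[i]).
Proof. by move=> t0; rewrite /osquare /= oppr_lt0 t0. Qed.

Lemma csquare_osquare s t z : s < t -> csquare s z -> osquare t z.
Proof.
move=> st; rewrite /csquare crectP => /and4P[? ? ? ?].
by apply/andP; split; apply/andP; split; lra.
Qed.

Lemma csquare_sub s t z : s <= t -> csquare s z -> csquare t z.
Proof.
move=> st; rewrite /csquare !crectP => /and4P[? ? ? ?]; apply/and4P; split; lra.
Qed.

(** The distance between concentric squares, from which all lower bounds of
    Cauchy kernels are taken. *)
Lemma bsquare_dist s t z a : bsquare t z -> csquare s a -> t - s <= cabs (z - a).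
Proof.
move=> /andP[_ zb]; rewrite /csquare crectP => /and4P[a1 a2 a3 a4].
have bR := Re_cabs (z - a); have bI := Im_cabs (z - a).
move: bR bI; rewrite !ReImE => bR bI.
have := ler_norm (complex.Re z - complex.Re a).
have := ler_norm (- (complex.Re z - complex.Re a)).
have := ler_norm (complex.Im z - complex.Im a).
have := ler_norm (- (complex.Im z - complex.Im a)); rewrite !normrN.
by case/or4P: zb => /eqP; lra.
Qed.

Lemma osquare_shrink t a : osquare t a -> exists s, [/\ 0 <= s, s < t & csquare s a].
Proof.
move=> /andP[/andP[a1 a2] /andP[a3 a4]].
exists (Num.max `|complex.Re a| `|complex.Im a|); split.
- by rewrite le_max normr_ge0.
- by rewrite gt_max !ltr_norml a1 a2 a3 a4.
- by rewrite /csquare /crect -!ler_norml !le_max !lexx orbT.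
Qed.

Lemma bsquare_sub_neq0 t z a : osquare t a -> bsquare t z -> z - a != 0.
Proof.
move=> /osquare_shrink[s [s0 st sa]] zt; rewrite -cabs_gt0.
by apply: lt_le_trans (bsquare_dist zt sa); rewrite subr_gt0.
Qed.

Lemma osquareD s t z h : s < t -> csquare s z -> cabs h < t - s -> osquare t (z + h).
Proof.
rewrite /csquare crectP => st /and4P[? ? ? ?] hb.
have hR := Re_cabs h; have hI := Im_cabs h.
have := ler_norm (complex.Re h); have := ler_norm (- complex.Re h).
have := ler_norm (complex.Im h); have := ler_norm (- complex.Im h).
rewrite !normrN => ? ? ? ?.
by rewrite /osquare ReD ImD; apply/andP; split; apply/andP; split; lra.
Qed.

(** The diagonal of the square is the reason why the squares used below have
    [t ^+ 2 < 1 / 2]: they lie in the unit disk. *)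
Lemma csquare_cabs t z : csquare t z -> cabs z ^+ 2 <= 2 * t ^+ 2.
Proof.
rewrite /csquare crectP => /and4P[? ? ? ?]; rewrite cabs_sqr.
have H x : - t <= x -> x <= t -> x ^+ 2 <= t ^+ 2.
  move=> h1 h2; have : 0 <= (t - x) * (t + x) by rewrite mulr_ge0; lra.
  by rewrite -subr_sqr subr_ge0.
have := H (complex.Re z); have := H (complex.Im z); lra.
Qed.

Lemma bsquare_cabs t z : bsquare t z -> t <= cabs z.
Proof.
move=> zt; have H0 : csquare 0 (0 : R[i]) by rewrite /csquare /crect /= oppr0 !lexx.
by have := bsquare_dist zt H0; rewrite !subr0.
Qed.

Lemma csquare_scale t z x : 0 <= x <= 1 -> 0 <= t -> csquare t z -> csquare t (x%:C * z).
Proof.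
move=> /andP[x0 x1] t0; rewrite /csquare !crectP !ReImE /= => /and4P[h1 h2 h3 h4].
rewrite !mul0r subr0 addr0.
have K u : - t <= u -> u <= t -> - t <= x * u /\ x * u <= t.
  move=> u1 u2; have : `|x * u| <= t.
    rewrite normrM ger0_norm // -[t]mul1r ler_pM // ler_norml; apply/andP; split; lra.
  by rewrite ler_norml => /andP.
by have [? ?] := K _ h1 h2; have [? ?] := K _ h3 h4; apply/and4P; split.
Qed.

Section SquareIntegral.
Variable t : R.
Hypothesis t0 : 0 < t.
Let tt : - t <= t.
Proof. by move: t0; lra. Qed.

Lemma square_intD F G : square_cont t F -> square_cont t G ->
  square_int t (fun z => F z + G z) = square_int t F + square_int t G.
Proof. by move=> HF HG; rewrite /square_int rect_intD. Qed.

Lemma square_intZ c F : square_cont t F ->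
  square_int t (fun z => c * F z) = c * square_int t F.
Proof. by move=> HF; rewrite /square_int rect_intZ. Qed.

Lemma square_int_ext F G : (forall z, bsquare t z -> F z = G z) ->
  square_int t F = square_int t G.
Proof. by move=> H; apply: rect_int_ext. Qed.

Lemma square_int_bound F B : square_cont t F ->
  (forall z, bsquare t z -> cabs (F z) <= B) ->
  cabs (square_int t F) <= 16 * B * t.
Proof.
move=> HF H; have := rect_int_bound tt tt HF H; congr (_ <= _); ring.
Qed.

Lemma pcont_on_bounded (F : R -> R[i]) x y : x <= y -> pcont_on x y F ->
  exists B, forall u, x <= u <= y -> cabs (F u) <= B.
Proof.
move=> xy HF.
have : {within `[x, y], continuous (fun u => cabs (F u))}.
  apply: rcont_on_within => u /HF{}HF e /HF[r r0 {}HF]; exists r => // k /HF.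
  apply: le_trans; rewrite ler_norml; apply/andP; split.
    by rewrite lerNl opprB cabs_distC cabs_ge_sub.
  exact: cabs_ge_sub.
move=> /(EVT_max xy)[c _ H]; exists (cabs (F c)) => u uI.
by apply: H; rewrite in_itv.
Qed.

Lemma square_cont_bounded F : square_cont t F ->
  exists2 B, 0 <= B & forall z, bsquare t z -> cabs (F z) <= B.
Proof.
move=> /(rect_cont_sides tt tt)[].
move=> /(pcont_on_bounded tt)[B1 H1] /(pcont_on_bounded tt)[B2 H2].
move=> /(pcont_on_bounded tt)[B3 H3] /(pcont_on_bounded tt)[B4 H4].
exists (Num.max 0 (Num.max (Num.max B1 B2) (Num.max B3 B4)));
  first by rewrite le_max lexx.
case=> u v /andP[/andP[uI vI] /or4P[]] /= /eqP E; rewrite !le_max;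
 move: uI vI => /= uI vI; rewrite E in uI vI *.
- by rewrite H3 ?orbT.
- by rewrite H4 ?orbT.
- by rewrite H1 ?orbT.
- by rewrite H2 ?orbT.
Qed.

(** Bound the continuous function [1 / f] on the compact boundary. *)
Lemma square_cont_min f : square_cont t f -> (forall z, bsquare t z -> f z != 0) ->
  exists2 m, 0 < m & forall z, bsquare t z -> m <= cabs (f z).
Proof.
move=> Hf f0.
have : square_cont t (fun z => (f z)^-1) by move=> z zI; apply: ccontV;
  [exact: f0|exact: Hf].
move=> /square_cont_bounded[B B0 HB]; exists (B + 1)^-1; first by rewrite invr_gt0; lra.
move=> z zI; have := HB z zI; rewrite cabsV => H.
have fz : 0 < cabs (f z) by rewrite cabs_gt0 f0.
rewrite -[cabs (f z)]invrK lef_pV2 ?posrE ?invr_gt0 //; lra.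
Qed.

End SquareIntegral.

Lemma cabs_le_eps_eq0 z : (forall e : R, 0 < e -> cabs z <= e) -> z = 0.
Proof.
move=> H; apply/eqP; rewrite -cabs_eq0; apply/negPn/negP => z0.
have zp : 0 < cabs z by rewrite lt_def z0 cabs_ge0.
have := H (cabs z / 2) ltac:(by rewrite divr_gt0); lra.
Qed.

Lemma rdiff_comp (f g : R -> R) (x a b : R) : rdiff f (g x) a -> rdiff g x b ->
  rdiff (fun u => f (g u)) x (a * b).
Proof.
move=> /rdiffP Hf /rdiffP Hg; apply/rdiffP.
Qed.

Lemma rdiff_affine (a b x : R) : rdiff (fun u => a * u + b) x a.
Proof.
move=> e e0; exists 1 => // k _.
have -> : a * (x + k) + b - (a * x + b) - a * k = 0 by ring.
by rewrite normr0 mulr_ge0 // ltW.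
Qed.

(** A primitive of the integrands that appear when opposite edges are paired
    in the next computation. *)
Lemma rdiff_atan (p d x : R) : 0 < d ->
  rdiff (fun u => 2 * atan (d^-1 * u + - p / d)) x (2 * d / (d ^+ 2 + (x - p) ^+ 2)).
Proof.
move=> d0; have H0 := iffRL (rdiffP _ _ _) (is_derive1_atan (d^-1 * x + - p / d)).
have H1 := @rdiff_comp (@atan R) (fun u => d^-1 * u + - p / d) x _ _ H0
  (rdiff_affine d^-1 (- p / d) x).
have H2 := @rdiff_comp (fun u => 2 * u + 0) _ x _ _ (rdiff_affine 2 0 _) H1.
have Q : 0 < d ^+ 2 + (x - p) ^+ 2 by rewrite ltr_wpDr ?sqr_ge0 // exprn_gt0.
have -> : 2 * d / (d ^+ 2 + (x - p) ^+ 2) =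
   2 * ((1 + (d^-1 * x + - p / d) ^+ 2)^-1 * d^-1).
  have -> : 1 + (d^-1 * x + - p / d) ^+ 2 = (d ^+ 2 + (x - p) ^+ 2) / d ^+ 2.
    by field; rewrite gt_eqF.
  by rewrite invf_div; field; rewrite !gt_eqF.
by apply: rdiff_ext H2 => u; rewrite addr0.
Qed.

(** By the puncture lemma it suffices to integrate over a small square centred
    at [a]. There the integrands on opposite edges combine into real or
    imaginary multiples of [2 d / (d^2 + u^2)], and each pair of edges
    contributes [i pi]. *)
Lemma square_int_inv t a : osquare t a ->
  square_int t (fun z => (z - a)^-1) = (0 +i* (2 * pi)).
Proof.
move=> /osquare_shrink[s [s0 st]]; rewrite /csquare crectP => /and4P[a1 a2 a3 a4].
set d := t - s; have d0 : 0 < d by rewrite /d; lra.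
have HF z : z != a -> holo (fun z => (z - a)^-1) z (- 1 / (z - a) ^+ 2).
  move=> za; have := wdiffD (wdiff_id z) (wdiff_cst (- a) z).
  move=> /wdiffV; rewrite subr_eq0 => /(_ za) H.
  by apply: wdiff_eq H _ _; rewrite ?addr0 ?oppr0 ?mul0r.
rewrite /square_int (@rect_int_puncture _ _ a d); [|rewrite // /d; lra..|]; last first.
  by move=> z _ /HF H; exists (- 1 / (z - a) ^+ 2).
set p := complex.Re a; set q := complex.Im a.
have pos_part : p - d <= p + d by lra.
have qq : q - d <= q + d by lra.
have Fc : rect_cont (fun z => (z - a)^-1) (p - d) (p + d) (q - d) (q + d).
  move=> z /andP[_ zb]; apply: wdiff_cont; apply: (HF z).
  by apply/eqP => E; move: zb; rewrite E -/p -/q => /or4P[]/eqP; lra.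
have [c1 c2 c3 c4] := rect_cont_sides pos_part qq Fc.
have Q u : 0 < d ^+ 2 + u ^+ 2 by rewrite ltr_wpDr ?sqr_ge0 // exprn_gt0.
have ea : a = p +i* q by apply: complexP.
have pi2 : 2 * atan (d^-1 * (p + d) + - p / d) - 2 * atan (d^-1 * (p - d) + - p / d) =
  pi :> R.
  have -> : d^-1 * (p + d) + - p / d = 1 by field; rewrite gt_eqF.
  have -> : d^-1 * (p - d) + - p / d = - 1 by field; rewrite gt_eqF.
  by rewrite atanN atan1; field.
have pi2' : 2 * atan (d^-1 * (q + d) + - q / d) - 2 * atan (d^-1 * (q - d) + - q / d) =
  pi :> R.
  have -> : d^-1 * (q + d) + - q / d = 1 by field; rewrite gt_eqF.
  have -> : d^-1 * (q - d) + - q / d = - 1 by field; rewrite gt_eqF.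
  by rewrite atanN atan1; field.
rewrite /rect_int /hseg_int /vseg_int.
pose h x := 0 +i* (2 * d / (d ^+ 2 + (x - p) ^+ 2)) : R[i].
pose v y := (2 * d / (d ^+ 2 + (y - q) ^+ 2)) +i* 0 : R[i].
have Z (F : R -> R[i]) x y (H : pcont_on x y F) : pcont_on x y (fun t => -1 * F t).
  move=> u /H{}H e /H[r r0 {}H]; exists r => // k /H.
  by rewrite -mulrBr cabsM cabsN cabs1 mul1r.
have AD (F G : R -> R[i]) x y : pcont_on x y F -> pcont_on x y G ->
  pcont_on x y (fun t => F t + G t).
  move=> H K u ui e e0; have e2 : 0 < e / 2 by rewrite divr_gt0.
  have [r r0 {}H] := H u ui _ e2; have [r' r'0 {}K] := K u ui _ e2.
  exists (Num.min r r'); first by rewrite lt_min r0.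
  move=> k; rewrite lt_min => /andP[/H h1 /K h2].
  rewrite opprD addrACA; apply: le_trans (cabsD _ _) _; lra.
have invcE (u u' : R) : (u +i* u')^-1 =
    (u / (u ^+ 2 + u' ^+ 2)) +i* (- (u' / (u ^+ 2 + u' ^+ 2))) :> R[i] by [].
have hE x : (x +i* (q - d) - a)^-1 + -1 * (x +i* (q + d) - a)^-1 = h x.
  have -> : x +i* (q - d) - a = (x - p) +i* (- d).
    by rewrite ea; apply: complexP => /=; ring.
  have -> : x +i* (q + d) - a = (x - p) +i* d.
    by rewrite ea; apply: complexP => /=; ring.
  have Q1 := Q (x - p); rewrite !invcE sqrrN; apply: complexP => /=; field;
   by rewrite gt_eqF // addrC.
have vE y : ((p + d) +i* y - a)^-1 + -1 * ((p - d) +i* y - a)^-1 = v y.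
  have -> : (p + d) +i* y - a = d +i* (y - q).
    by rewrite ea; apply: complexP => /=; ring.
  have -> : (p - d) +i* y - a = (- d) +i* (y - q).
    by rewrite ea; apply: complexP => /=; ring.
  have Q1 := Q (y - q); rewrite !invcE sqrrN; apply: complexP => /=; field;
   by rewrite gt_eqF.
have -> : cint (p - d) (p + d) (fun t0 => (t0 +i* (q - d) - a)^-1) -
   cint (p - d) (p + d) (fun t0 => (t0 +i* (q + d) - a)^-1) = 0 +i* pi.
  rewrite -[X in _ - X]mul1r -mulNr -cintZ // -cintD //; last exact: Z.
  rewrite (cint_ext (fun x _ => hE x)).
  rewrite (@cint_FTC _ _ _ (fun x => 0 +i* (2 * atan (d^-1 * x + - p / d)))) //=.
  - by apply: complexP => /=; rewrite ?subr0.
  - have := AD _ _ _ _ c1 (Z _ _ _ c2).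
    by congr (pcont_on _ _ _); apply/funext => x; rewrite hE.
  - move=> x _; split; last exact: rdiff_atan.
    by move=> e e0; exists 1 => // k _; rewrite !mul0r !subrr normr0 mulr_ge0 // ltW.
have -> : cint (q - d) (q + d) (fun t0 => ((p + d) +i* t0 - a)^-1) -
   cint (q - d) (q + d) (fun t0 => ((p - d) +i* t0 - a)^-1) = pi%:C.
  rewrite -[X in _ - X]mul1r -mulNr -cintZ // -cintD //; last exact: Z.
  rewrite (cint_ext (fun x _ => vE x)).
  rewrite (@cint_FTC _ _ _ (fun x => (2 * atan (d^-1 * x + - q / d)) +i* 0)) //=.
  - by apply: complexP => /=; rewrite ?subr0.
  - have := AD _ _ _ _ c4 (Z _ _ _ c3).
    by congr (pcont_on _ _ _); apply/funext => x; rewrite vE.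
  - move=> x _; split; first exact: rdiff_atan.
    by move=> e e0; exists 1 => // k _; rewrite !mul0r !subrr normr0 mulr_ge0 // ltW.
by apply: complexP => /=; ring.
Qed.

End Squares.

(** * Cauchy's formula and its consequences *)

Section Cauchy.
Variable R : realType.
Implicit Types (F G f : R[i] -> R[i]) (z a h : R[i]) (s t x y : R).

Definition two_pi_i : R[i] := 0 +i* (2 * pi).

Lemma two_pi_i_neq0 : two_pi_i != 0.
Proof.
rewrite eq_complex /= eqxx /= mulf_neq0 // ?pnatr_eq0 // gt_eqF //; exact: pi_gt0.
Qed.

Definition holo_on t f := forall z, csquare t z -> exists d, holo f z d.
Definition holo_in t f := forall z, osquare t z -> exists d, holo f z d.

Lemma holo_on_square_cont t f : holo_on t f -> square_cont t f.
Proof. by move=> H z /bsquare_csquare/H[d]; apply: wdiff_cont. Qed.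

Lemma ccont_sub a z : ccont (fun w => w - a) z.
Proof. by apply: ccontD; [exact: ccont_id|exact: ccont_cst]. Qed.

Lemma square_cont_kernel t a : osquare t a -> square_cont t (fun z => (z - a)^-1).
Proof.
by move=> ta z tz; apply: ccontV; [exact: bsquare_sub_neq0 ta tz|exact: ccont_sub].
Qed.

Lemma square_contM t F G : square_cont t F -> square_cont t G ->
  square_cont t (fun z => F z * G z).
Proof. by move=> HF HG z tz; apply: ccontM; [exact: HF|exact: HG]. Qed.

Lemma square_contD t F G : square_cont t F -> square_cont t G ->
  square_cont t (fun z => F z + G z).
Proof. by move=> HF HG z tz; apply: ccontD; [exact: HF|exact: HG]. Qed.

Lemma square_cont_cst t c : square_cont t (fun=> c).
Proof. by move=> z _; exact: ccont_cst. Qed.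

Lemma holo_sub a z : holo (fun w => w - a) z 1.
Proof.
by apply: wdiff_eq (wdiffD (wdiff_id z) (wdiff_cst (- a) z)) _ _; rewrite addr0.
Qed.

Lemma holoM F G z A A' : holo F z A -> holo G z A' ->
  holo (fun w => F w * G w) z (A * G z + F z * A').
Proof.
by move=> HF HG; apply: wdiff_eq (wdiffM HF HG) _ _ => //; rewrite mul0r mulr0 addr0.
Qed.

Lemma holoD F G z A A' : holo F z A -> holo G z A' ->
  holo (fun w => F w + G w) z (A + A').
Proof.
by move=> HF HG; apply: wdiff_eq (wdiffD HF HG) _ _ => //; rewrite addr0.
Qed.

Lemma holoV F z A : F z != 0 -> holo F z A ->
  holo (fun w => (F w)^-1) z (- A / F z ^+ 2).
Proof.
by move=> F0 HF; apply: wdiff_eq (wdiffV F0 HF) _ _; rewrite ?oppr0 ?mul0r.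
Qed.

Lemma holo_inv_sub a z : z - a != 0 ->
  holo (fun u => (u - a)^-1) z (- 1 / (z - a) ^+ 2).
Proof. by move=> za; apply: (@holoV (fun u => u - a)) => //; exact: holo_sub. Qed.

(** The function [(f z - f a) / (z - a)] is holomorphic off [a] and bounded
    near [a], so its integral equals the one over an arbitrarily small square
    and vanishes. *)
Lemma cauchy_formula t f a : holo_on t f -> osquare t a ->
  square_int t (fun z => f z * (z - a)^-1) = f a * two_pi_i.
Proof.
move=> Hf ta.
have t0 : 0 < t by case/andP: ta => /andP[]; lra.
have Kc := square_cont_kernel ta; have fc := holo_on_square_cont Hf.
have [d0 Hd] := Hf a (osquare_csquare ta).
suff E : square_int t (fun z => (f z + - f a) * (z - a)^-1) = 0.
  have -> : square_int t (fun z => f z * (z - a)^-1) =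
    square_int t (fun z => (f z + - f a) * (z - a)^-1 + f a * (z - a)^-1).
    by apply: square_int_ext => // z _; ring.
  rewrite square_intD //; last 1 first.
  - by apply: square_contM => //; exact: square_cont_cst.
  - by rewrite E add0r square_intZ // square_int_inv.
  - by apply: square_contM => //; apply: square_contD => //; exact: square_cont_cst.
have [r r0 Hr] := wdiff_bound Hd.
set K := _ + 1 in Hr.
have K0 : 0 < K by rewrite /K cabs0; have := cabs_ge0 d0; lra.
have [s [s0 st sa]] := osquare_shrink ta.
apply: cabs_le_eps_eq0 => e e0.
set d := Num.min (Num.min (t - s) (r / 3)) (e / (16 * K)).
have dd : 0 < d by rewrite !lt_min subr_gt0 st /= !divr_gt0 // mulr_gt0.
have d1 : d <= t - s by rewrite !ge_min lexx.
have d2 : d <= r / 3 by rewrite !ge_min lexx orbT.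
have d3 : d <= e / (16 * K) by rewrite !ge_min lexx !orbT.
have HF z : csquare t z -> z != a ->
    exists A, holo (fun z => (f z + - f a) * (z - a)^-1) z A.
  move=> /Hf[A HA] za; have za' : z - a != 0 by rewrite subr_eq0.
  have := holoM (holoD HA (wdiff_cst (- f a) z)) (holo_inv_sub za').
  by move=> HH; eexists; exact: HH.
move: (sa); rewrite /csquare crectP => /and4P[a1 a2 a3 a4].
rewrite /square_int (@rect_int_puncture _ _ a d); [|by []|lra|lra|lra|lra|by []].
set p := complex.Re a in a1 a2 *; set q := complex.Im a in a3 a4 *.
have pq : (p + d - (p - d)) + (q + d - (q - d)) = 4 * d by ring.
apply: (@le_trans _ _ (4 * K * (4 * d))); last first.
  rewrite ler_pdivlMr in d3; first by lra.
  by rewrite mulr_gt0.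
rewrite -pq; apply: rect_int_bound; [lra|lra| |].
- move=> z zb; have [||A] := HF z; last exact: wdiff_cont.
    move: zb => /andP[]; rewrite /csquare !crectP => /and4P[? ? ? ?] _.
    by apply/and4P; split; lra.
  apply/eqP => E; move: zb; rewrite E => /andP[_].
  by rewrite -/p -/q => /or4P[]/eqP; lra.
move=> z /andP[zI zb].
have za : z - a != 0.
  rewrite subr_eq0; apply/eqP => E; move: zb; rewrite E.
  by rewrite -/p -/q => /or4P[]/eqP; lra.
have aI : crect (p - d) (p + d) (q - d) (q + d) a.
  by rewrite crectP -/p -/q; apply/and4P; split; lra.
have zd : cabs (z - a) <= 2 * d.
  move: zI; rewrite crectP -/p -/q => /and4P[? ? ? ?].
  apply: le_trans (cabs_ReIm _) _; rewrite !ReImE -/p -/q.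
  have : `|complex.Re z - p| <= d by rewrite ler_norml; apply/andP; split; lra.
  have : `|complex.Im z - q| <= d by rewrite ler_norml; apply/andP; split; lra.
  lra.
have := Hr (z - a); rewrite [a + _]addrC subrK => {}Hr.
rewrite cabsM cabsV ler_pdivrMr ?cabs_gt0 //; apply: Hr; lra.
Qed.

(** Differentiation under the integral sign in quantitative form: a pointwise
    quadratic bound for the remainder of the kernel passes to the integral. *)
Lemma kernel_diff t F (k0 kh k1 : R[i] -> R[i]) h (W C : R) : 0 < t ->
  square_cont t F -> square_cont t k0 -> square_cont t kh -> square_cont t k1 ->
  (forall z, bsquare t z -> cabs (F z) <= W) -> 0 <= W -> 0 <= C ->
  (forall z, bsquare t z -> cabs (kh z - k0 z - h * k1 z) <= C * cabs h ^+ 2) ->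
  cabs (square_int t (fun z => F z * kh z) - square_int t (fun z => F z * k0 z)
    - h * square_int t (fun z => F z * k1 z)) <= 16 * (W * C) * t * cabs h ^+ 2.
Proof.
move=> t0 HF H0 Hh H1 HW W0 C0 H.
have C0' : square_cont t (fun z => F z * k0 z) by exact: square_contM.
have Ch' : square_cont t (fun z => F z * kh z) by exact: square_contM.
have C1' : square_cont t (fun z => F z * k1 z) by exact: square_contM.
have Z c G : square_cont t G -> square_cont t (fun z => c * G z).
  by move=> HG; apply: square_contM => //; exact: square_cont_cst.
have -> : square_int t (fun z => F z * kh z) - square_int t (fun z => F z * k0 z)
    - h * square_int t (fun z => F z * k1 z) =
  square_int t (fun z => (F z * kh z + (-1) * (F z * k0 z)) + (- h) * (F z * k1 z)).
  rewrite (square_intD t0 (square_contD Ch' (Z _ _ C0')) (Z _ _ C1')).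
  rewrite (square_intD t0 Ch' (Z _ _ C0')).
  by rewrite (square_intZ t0 _ C0') (square_intZ t0 _ C1'); ring.
rewrite (_ : 16 * (W * C) * t * _ = 16 * (W * (C * cabs h ^+ 2)) * t); last by ring.
apply: square_int_bound => //.
  by apply: square_contD; [apply: square_contD => //; apply: Z|apply: Z].
move=> z zt.
have -> : F z * kh z + -1 * (F z * k0 z) + - h * (F z * k1 z) =
  F z * (kh z - k0 z - h * k1 z) by ring.
by rewrite cabsM; apply: ler_pM; rewrite ?cabs_ge0 ?HW ?H.
Qed.

Definition cauchy_int t F a := square_int t (fun z => F z * (z - a)^-1).
(** The first two derivatives of the Cauchy integral, with the factorials left
    inside the integral. *)
Definition cauchy_int2 t F a := square_int t (fun z => F z * ((z - a)^-1 * (z - a)^-1)).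
Definition cauchy_int3 t F a :=
  square_int t (fun z => F z * (2%:R * ((z - a)^-1 * ((z - a)^-1 * (z - a)^-1)))).

(** The constant [C] is the same for all [a] in the smaller square. This
    uniformity allows the differentiation under the integral sign along rays
    later on. *)
Lemma cauchy_int_quad s t F : 0 <= s -> s < t -> square_cont t F -> exists2 C, 0 <= C &
  forall a h, csquare s a -> cabs h <= (t - s) / 2 ->
  cabs (cauchy_int t F (a + h) - cauchy_int t F a - h * cauchy_int2 t F a) <=
    C * cabs h ^+ 2 /\
  cabs (cauchy_int2 t F (a + h) - cauchy_int2 t F a - h * cauchy_int3 t F a) <=
    C * cabs h ^+ 2.
Proof.
move=> s0 st HF; have t0 : 0 < t by lra.
have [W W0 HW] := square_cont_bounded t0 HF.
set d := t - s; have d0 : 0 < d by rewrite /d; lra.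
pose C1 := 2 / d ^+ 3; pose C2 := (3 * (4 * t) + 2 * d) * 4 / d ^+ 5.
have dn n : 0 < d ^+ n by rewrite exprn_gt0.
have C10 : 0 <= C1 by rewrite /C1 divr_ge0 // ltW.
have t20 : 0 <= 3 * (4 * t) + 2 * d by lra.
have C20 : 0 <= C2 by rewrite /C2 divr_ge0 ?mulr_ge0 // ltW.
have e1 : 0 <= 16 * (W * C1) * t.
  by apply: mulr_ge0 (ltW t0); apply: mulr_ge0 => //; apply: mulr_ge0.
have e2 : 0 <= 16 * (W * C2) * t.
  by apply: mulr_ge0 (ltW t0); apply: mulr_ge0 => //; apply: mulr_ge0.
exists (16 * (W * C1) * t + 16 * (W * C2) * t); first by lra.
move=> a h sa hd.
have aht : osquare t (a + h) by apply: (osquareD st sa); rewrite -/d; lra.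
have at_ : osquare t a by exact: csquare_osquare sa.
have K1 := square_cont_kernel at_; have Kh := square_cont_kernel aht.
have lb z : bsquare t z -> d <= cabs (z - a) /\ d / 2 <= cabs (z - (a + h)).
  move=> zt; have := bsquare_dist zt sa; rewrite -/d => H; split => //.
  have := cabs_ge_sub (z - a) h; rewrite opprD addrA; lra.
have pos2 := sqr_ge0 (cabs h).
split.
  apply: (@le_trans _ _ (16 * (W * C1) * t * cabs h ^+ 2)); last first.
    by apply: ler_wpM2r => //; lra.
  apply: kernel_diff => //; first by apply: square_contM.
  move=> z zt; have [l1 l2] := lb z zt.
  have n1 : z - a != 0 by rewrite -cabs_gt0; lra.
  have n2 : z - (a + h) != 0 by rewrite -cabs_gt0; lra.
  have -> : (z - (a + h))^-1 - (z - a)^-1 - h * ((z - a)^-1 * (z - a)^-1) =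
     h ^+ 2 / ((z - a) ^+ 2 * (z - (a + h))) by field; rewrite n1 n2.
  rewrite !(cabsX, cabsM, cabsV) mulrC ler_wpM2r //.
  rewrite /C1 -[2 / _]invrK lef_pV2 ?posrE ?invr_gt0 ?divr_gt0 //; last first.
    by rewrite mulr_gt0 ?exprn_gt0 //; lra.
  have -> : (2 / d ^+ 3)^-1 = d ^+ 2 * (d / 2) by field; rewrite gt_eqF.
  apply: ler_pM => //; [exact: ltW|lra|].
  by rewrite lerXn2r // nnegrE; lra.
apply: (@le_trans _ _ (16 * (W * C2) * t * cabs h ^+ 2)); last first.
  by apply: ler_wpM2r => //; lra.
apply: kernel_diff => //; [exact: square_contM|exact: square_contM| |].
  by apply: square_contM; [exact: square_cont_cst|do ?[apply: square_contM]].
move=> z zt; have [l1 l2] := lb z zt.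
have n1 : z - a != 0 by rewrite -cabs_gt0; lra.
have n2 : z - (a + h) != 0 by rewrite -cabs_gt0; lra.
have -> : (z - (a + h))^-1 / (z - (a + h)) - (z - a)^-1 / (z - a) -
    h * (2%:R * ((z - a)^-1 * ((z - a)^-1 / (z - a)))) =
   (3%:R * (z - a) - 2%:R * h) * (h ^+ 2 / ((z - a) ^+ 3 * (z - (a + h)) ^+ 2)).
  by field; rewrite n1 n2.
rewrite !(cabsX, cabsM, cabsV) [cabs h ^+ 2 * _]mulrC mulrA ler_wpM2r //.
have za : cabs (z - a) <= 4 * t.
  have zI := bsquare_csquare zt; have := crect_dist (csquare_sub (ltW st) sa) zI.
  lra.
have num : cabs (3%:R * (z - a) - 2%:R * h) <= 3 * (4 * t) + 2 * d.
  apply: le_trans (cabsB _ _) _; rewrite !cabsM.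
  have cn n : cabs (n%:R : R[i]) = n%:R.
    by rewrite -(rmorph_nat (real_complex R)) cabs_real normr_nat.
  rewrite !cn; have := cabs_ge0 h; lra.
rewrite /C2 -mulrA; apply: ler_pM;
  rewrite ?cabs_ge0 ?invr_ge0 ?mulr_ge0 ?exprn_ge0 ?cabs_ge0 //.
rewrite -[4 / _]invrK lef_pV2 ?posrE ?invr_gt0 ?divr_gt0 //; last first.
  by rewrite mulr_gt0 ?exprn_gt0 //; lra.
have -> : (4 / d ^+ 5)^-1 = d ^+ 3 * (d / 2) ^+ 2 by field; rewrite gt_eqF.
have d20 : 0 <= d / 2 by lra.
by apply: ler_pM; rewrite ?exprn_ge0 //; [exact: ltW|rewrite lerXn2r // nnegrE; lra..].
Qed.

(** A quadratic remainder is in particular [o(h)]. *)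
Lemma holo_of_quad f z d r C : 0 < r -> 0 <= C ->
  (forall h, cabs h <= r -> cabs (f (z + h) - f z - h * d) <= C * cabs h ^+ 2) ->
  holo f z d.
Proof.
move=> r0 C0 H e e0; have C1 : 0 < C + 1 by lra.
exists (Num.min r (e / (C + 1))); first by rewrite lt_min r0 divr_gt0.
move=> h; rewrite lt_min => /andP[/ltW/H h1 h2].
rewrite mul0r addr0 [d * h]mulrC; apply: le_trans h1 _.
rewrite expr2 mulrA ler_wpM2r ?cabs_ge0 //.
rewrite ltr_pdivlMr // in h2; have := cabs_ge0 h; lra.
Qed.

Lemma cauchy_int_holo t F a : square_cont t F -> osquare t a ->
  holo (cauchy_int t F) a (cauchy_int2 t F a) /\
  holo (cauchy_int2 t F) a (cauchy_int3 t F a).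
Proof.
move=> HF /osquare_shrink[s [s0 st sa]].
have [C C0 HC] := cauchy_int_quad s0 st HF.
have d0 : 0 < (t - s) / 2 by lra.
by split; apply: (holo_of_quad d0 C0) => h /(HC _ _ sa)[].
Qed.

(** By Cauchy's formula [f] is a multiple of its own Cauchy integral, which
    can be differentiated twice. *)
Lemma holo_derivatives t f : holo_on t f -> forall a, osquare t a ->
  [/\ holo f a (cauchy_int2 t f a / two_pi_i), derive1 f a = cauchy_int2 t f a / two_pi_i
    & holo (derive1 f) a (cauchy_int3 t f a / two_pi_i)].
Proof.
move=> Hf; have Hc := holo_on_square_cont Hf.
have E a : osquare t a -> f a = two_pi_i^-1 * cauchy_int t f a.
  move=> ta; rewrite /cauchy_int cauchy_formula // mulrCA mulVf ?mulr1 //;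
    exact: two_pi_i_neq0.
have H1 a : osquare t a -> holo f a (cauchy_int2 t f a / two_pi_i).
  move=> ta; have [s [s0 st sa]] := osquare_shrink ta.
  have st' : 0 < t - s by rewrite subr_gt0.
  have H := holoM (wdiff_cst two_pi_i^-1 a) (cauchy_int_holo Hc ta).1.
  rewrite [_ / _]mulrC; rewrite mul0r add0r in H.
  apply: wdiff_local st' _ H => u ua.
  by rewrite -E // -[u](subrK a) addrC; apply: osquareD sa _.
have H2 a : osquare t a ->
  derive1 f a = cauchy_int2 t f a / two_pi_i by move=> /H1/holo_derive1.
move=> a ta; split; [exact: H1|exact: H2|].
have [s [s0 st sa]] := osquare_shrink ta.
have st' : 0 < t - s by rewrite subr_gt0.
have H := holoM (wdiff_cst two_pi_i^-1 a) (cauchy_int_holo Hc ta).2.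
rewrite [_ / _]mulrC; rewrite mul0r add0r in H.
apply: wdiff_local st' _ H => u ua.
by rewrite mulrC -H2 // -[u](subrK a) addrC; apply: osquareD sa _.
Qed.

Lemma holo_derive t f a : holo_on t f -> osquare t a -> holo f a (derive1 f a).
Proof. by move=> Hf /(holo_derivatives Hf)[H -> _]. Qed.

Lemma holo_derive2 t f a : holo_on t f -> osquare t a -> exists d, holo (derive1 f) a d.
Proof. by move=> Hf /(holo_derivatives Hf)[_ _ H]; eexists; exact: H. Qed.

Lemma holo_quad s t f : 0 <= s -> s < t -> holo_on t f -> exists2 C, 0 <= C &
  forall a h, csquare s a -> cabs h <= (t - s) / 2 ->
  cabs (f (a + h) - f a - h * derive1 f a) <= C * cabs h ^+ 2.
Proof.
move=> s0 st Hf; have Hc := holo_on_square_cont Hf.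
have [C C0 HC] := cauchy_int_quad s0 st Hc.
have p0 : 0 < cabs two_pi_i^-1 by rewrite cabs_gt0 invr_neq0 // two_pi_i_neq0.
exists (cabs two_pi_i^-1 * C); first by rewrite mulr_ge0 // ltW.
move=> a h sa hd; have [H _] := HC a h sa hd.
have at_ := csquare_osquare st sa.
have aht : osquare t (a + h) by apply: (osquareD st sa); lra.
have E u : osquare t u -> f u = two_pi_i^-1 * cauchy_int t f u.
  move=> ta; rewrite /cauchy_int cauchy_formula // mulrCA mulVf ?mulr1 //;
    exact: two_pi_i_neq0.
have [_ -> _] := holo_derivatives Hf at_.
rewrite !E //.
have -> : two_pi_i^-1 * cauchy_int t f (a + h) - two_pi_i^-1 * cauchy_int t f a -
  h * (cauchy_int2 t f a / two_pi_i) =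
  two_pi_i^-1 * (cauchy_int t f (a + h) - cauchy_int t f a -
    h * cauchy_int2 t f a) by ring.
by rewrite cabsM -mulrA ler_wpM2l // cabs_ge0.
Qed.

(** The quotient is defined as the Cauchy integral of [f z / (z - a)], which
    is holomorphic at [a] as well. *)
Lemma factor_root t f a : holo_on t f -> osquare t a -> f a = 0 ->
  exists2 g, holo_in t g & forall z, osquare t z -> f z = (z - a) * g z.
Proof.
move=> Hf ta fa; have Hc := holo_on_square_cont Hf.
have Ka := square_cont_kernel ta.
pose w z := f z * (z - a)^-1.
have wc : square_cont t w by exact: square_contM.
exists (fun z => two_pi_i^-1 * cauchy_int t w z).
  move=> z tz; have := holoM (wdiff_cst two_pi_i^-1 z) (cauchy_int_holo wc tz).1.
  by move=> H; eexists; exact: H.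
move=> z tz; have Kz := square_cont_kernel tz.
apply: (mulIf two_pi_i_neq0); rewrite -(cauchy_formula Hf tz).
have -> : (z - a) * (two_pi_i^-1 * cauchy_int t w z) * two_pi_i =
  (z - a) * cauchy_int t w z.
  by field; exact: two_pi_i_neq0.
have H0 : square_int t (fun z => f z * (z - a)^-1) = 0.
  by rewrite cauchy_formula // fa mul0r.
have t0 : 0 < t by case/andP: ta => /andP[]; lra.
rewrite /cauchy_int -(square_intZ t0); last by apply: square_contM.
rewrite -[LHS]subr0 -[X in _ - X]H0 -[X in _ - X]mul1r -mulNr -(square_intZ t0);
  last exact: square_contM.
rewrite -(square_intD t0); [|exact: square_contM|by apply: square_contM;
  [exact: square_cont_cst|exact: square_contM]].
apply: (square_int_ext t0) => u ut; rewrite /w; field.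
by rewrite (bsquare_sub_neq0 ta ut) (bsquare_sub_neq0 tz ut).
Qed.

(** If [x > b], the powers of [x / b] are unbounded by Bernoulli's inequality. *)
Lemma pow_bounded_le (x b K : R) : 0 <= x -> 0 <= b ->
  (forall n, x ^+ n <= K * b ^+ n) -> x <= b.
Proof.
move=> x0 b0 H; rewrite leNgt; apply/negP => bx.
have K1 : 1 <= K by have := H 0%N; rewrite !expr0 mulr1.
have xp : 0 < x by lra.
have [b00|bn0] := eqVneq b 0; first by have := H 1%N; rewrite b00 !expr1 mulr0; lra.
have bp : 0 < b by rewrite lt_def bn0.
(* Bernoulli's inequality for 1 + q. *)
set q := x / b - 1; have q0 : 0 < q by rewrite subr_gt0 ltr_pdivlMr ?mul1r.
have bern n : 1 + n%:R * q <= (x / b) ^+ n.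
  elim: n => [|n IH]; first by rewrite mul0r addr0 expr0.
  have E : x / b = 1 + q by rewrite /q addrC subrK.
  rewrite exprS; rewrite E in IH *.
  have nq : 0 <= n%:R * q by rewrite mulr_ge0 // ltW.
  apply: (@le_trans _ _ ((1 + q) * (1 + n%:R * q))); last by rewrite ler_wpM2l //; lra.
  rewrite -natr1; have := mulr_ge0 nq (ltW q0); lra.
have := bern (Num.bound (K / q)).
have := H (Num.bound (K / q)).
have := archi_boundP (divr_ge0 (le_trans ler01 K1) (ltW q0)).
rewrite ltr_pdivrMr // => h1 h2 h3.
move: h2; rewrite -ler_pdivrMr ?exprn_gt0 // -expr_div_n; lra.
Qed.

(** Cauchy's formula for [f ^+ n] bounds [cabs (f a) ^+ n] by [B ^+ n] times a
    constant that does not depend on [n]. *)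
Lemma max_principle t f B : 0 < t -> holo_on t f ->
  (forall z, bsquare t z -> cabs (f z) <= B) ->
  forall a, osquare t a -> cabs (f a) <= B.
Proof.
move=> t0 Hf HB a ta.
have B0 : 0 <= B.
  apply: le_trans (cabs_ge0 (f (t +i* 0))) _; apply: HB.
  by rewrite /bsquare /brect /crect /= oppr_le0 (ltW t0) lexx eqxx orbT; apply/andP;
    split=> //; apply/andP; split=> //; lra.
have [s [s0 st sa]] := osquare_shrink ta.
have p0 : 0 < cabs two_pi_i by rewrite cabs_gt0 two_pi_i_neq0.
apply: (@pow_bounded_le _ _ (16 * t / (t - s) / cabs two_pi_i));
  rewrite ?cabs_ge0 // => n.
have Hn z : csquare t z -> exists d, holo (fun u => f u ^+ n) z d.
  move=> /Hf[d Hd]; elim: n => [|n [d' Hd']].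
    by exists 0; apply: wdiff_ext (wdiff_cst 1 z) => u; rewrite expr0.
  eexists; apply: wdiff_ext (holoM Hd Hd') => u; by rewrite exprS.
have := cauchy_formula Hn ta => E.
have : cabs (square_int t (fun z => f z ^+ n * (z - a)^-1)) <=
  16 * (B ^+ n / (t - s)) * t.
  apply: square_int_bound => //.
    apply: square_contM; [exact: holo_on_square_cont|exact: square_cont_kernel].
  move=> z tz; rewrite cabsM cabsV cabsX; apply: ler_pM.
  - by rewrite exprn_ge0 // cabs_ge0.
  - by rewrite invr_ge0 cabs_ge0.
  - by rewrite lerXn2r ?nnegrE ?cabs_ge0 // HB.
  - have d1 : 0 < t - s by rewrite subr_gt0.
    have d2 := bsquare_dist tz sa.
    by rewrite lef_pV2 ?posrE //; apply: lt_le_trans d2.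
rewrite E cabsM cabsX -ler_pdivlMr // => /le_trans; apply.
rewrite le_eqVlt; apply/orP; left; apply/eqP; ring.
Qed.

End Cauchy.

(** * Integrals over plane rectangles *)

Section Plane.
Variable R : realType.
Local Notation RM := (measurableTypeR R).
Local Notation mu := (@lebesgue_measure R).
Local Notation mu2 := (mu \x mu)%E.

(** The integral of a nonnegative function is a supremum over the simple
    functions below it, so it is monotone for arbitrary functions. This
    compares the area, whose integrand and domain are arbitrary here, with
    integrals of continuous functions. *)
Lemma ge0_integral_mono d (T : measurableType d) (m : {measure set T -> \bar R})
  (f1 f2 : T -> \bar R) : (forall x, 0 <= f1 x)%E -> (forall x, f1 x <= f2 x)%E ->
  (\int[m]_x f1 x <= \int[m]_x f2 x)%E.
Proof.
move=> f0 f12; have f20 x : (0 <= f2 x)%E by exact: le_trans (f12 x).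
rewrite !ge0_integralTE //; apply: le_ereal_sup => _ [h hf <-]; exists h => // x.
exact: le_trans (f12 x).
Qed.

Definition jcont (g : R * R -> R) := forall p, forall e : R, 0 < e ->
  exists2 d : R, 0 < d & forall q, `|q.1 - p.1| < d -> `|q.2 - p.2| < d ->
    `|g q - g p| <= e.

(** Superlevel sets are countable unions of open rectangles with rational
    vertices. *)
Lemma jcont_measurable (g : RM * RM -> R) : jcont g -> measurable_fun setT g.
Proof.
move=> gc mT; apply: (measurability _ (RGenOInfty.measurableE R)) => //.
move=> _ [_ [c ->] <-]; rewrite setTI.
pose I (a b : rat) : set RM := [set` `]ratr a, ratr b[%R].
pose ok a b a' b' := forall q : R * R,
  ratr a < q.1 < ratr b -> ratr a' < q.2 < ratr b' -> c < g q.
rewrite (_ : g @^-1` _ = \bigcup_(a : rat) \bigcup_(b : rat) \bigcup_(a' : rat)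
  \bigcup_(b' : rat) [set p | ok a b a' b' /\ (I a b `*` I a' b') p]); last first.
  apply/seteqP; split => p /=.
    rewrite in_itv /= andbT => cg.
    have e0 : 0 < (g p - c) / 2 by rewrite divr_gt0 // subr_gt0.
    have [d d0 Hd] := gc p _ e0.
    have [a] := @rat_in_itvoo R (p.1 - d) p.1 ltac:(by rewrite ltrBlDr ltrDl).
    have [b] := @rat_in_itvoo R p.1 (p.1 + d) ltac:(by rewrite ltrDl).
    have [a'] := @rat_in_itvoo R (p.2 - d) p.2 ltac:(by rewrite ltrBlDr ltrDl).
    have [b'] := @rat_in_itvoo R p.2 (p.2 + d) ltac:(by rewrite ltrDl).
    rewrite !in_itv /= => /andP[x1 x2] /andP[x3 x4] /andP[x5 x6] /andP[x7 x8].
    exists a => //; exists b => //; exists a' => //; exists b' => //; split.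
      move=> q /andP[q1 q2] /andP[q3 q4].
      have : `|g q - g p| <= (g p - c) / 2.
        by apply: Hd; rewrite ltr_norml; apply/andP; split; lra.
      rewrite ler_norml => /andP[]; lra.
    by split; rewrite /I /= in_itv /=; apply/andP.
  move=> [a _ [b _ [a' _ [b' _ [okk [/= p1 p2]]]]]].
  rewrite in_itv /= andbT; apply: okk.
    by move: p1; rewrite /I /= in_itv.
  by move: p2; rewrite /I /= in_itv.
have mI a b : measurable (I a b) by exact: measurable_itv.
have mP (P : Prop) (A B : set RM) : measurable A -> measurable B ->
    measurable [set p : RM * RM | P /\ (A `*` B) p].
  move=> mA mB; have [HP|HP] := pselect P.
    rewrite (_ : [set p | _] = A `*` B); first exact: measurableX.
    by apply/seteqP; split => p // [].
  rewrite (_ : [set p | _] = set0); first exact: measurable0.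
  by apply/seteqP; split => p // [].
apply: bigcupT_measurable_rat => a; apply: bigcupT_measurable_rat => b.
apply: bigcupT_measurable_rat => a'; apply: bigcupT_measurable_rat => b'.
exact: mP.
Qed.

(** Half-open, so that a rectangle is the disjoint union of the two parts of a
    cut. *)
Definition hrect (x0 x1 y0 y1 : R) : set (RM * RM) :=
  ([set` `]x0, x1]%R] : set RM) `*` ([set` `]y0, y1]%R] : set RM).

Lemma hrectP x0 x1 y0 y1 (p : R * R) :
  hrect x0 x1 y0 y1 p <-> x0 < p.1 <= x1 /\ y0 < p.2 <= y1.
Proof. by rewrite /hrect /= !in_itv. Qed.

Lemma measurable_hrect x0 x1 y0 y1 : measurable (hrect x0 x1 y0 y1).
Proof. by apply: measurableX; exact: measurable_itv. Qed.

Lemma mu2_hrect x0 x1 y0 y1 : x0 <= x1 -> y0 <= y1 ->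
  mu2 (hrect x0 x1 y0 y1) = ((x1 - x0) * (y1 - y0))%:E.
Proof.
move=> x01 y01; rewrite product_measure1E; [|exact: measurable_itv..].
have E (a b : R) : a <= b -> mu [set` `]a, b]%R] = (b - a)%:E.
  move=> ab; rewrite lebesgue_measure_itv /= lte_fin.
  case: ltP => [//|ba]; have -> : b = a by apply/eqP; rewrite eq_le ab ba.
  by rewrite subrr.
by rewrite EFinM; congr (_ * _)%E; exact: E.
Qed.

Section Additive.
Variables (g : R * R -> R) (K : R).
Hypothesis gc : jcont g.
Hypothesis g0 : forall p, 0 <= g p.
Hypothesis gK : forall p, g p <= K.

Definition plane_int x0 x1 y0 y1 : \bar R :=
  (\int[mu2]_(p in hrect x0 x1 y0 y1) (g p)%:E)%E.
Definition plane_rint x0 x1 y0 y1 : R := fine (plane_int x0 x1 y0 y1).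

Lemma jcont_measurable_EFin (D : set (RM * RM)) :
  measurable_fun D (EFin \o (g : RM * RM -> R)).
Proof.
by apply/measurable_EFinP; apply: measurable_funTS; exact: jcont_measurable.
Qed.

Lemma plane_int_ge0 x0 x1 y0 y1 : (0 <= plane_int x0 x1 y0 y1)%E.
Proof. by apply: integral_ge0 => p _; rewrite lee_fin. Qed.

Lemma plane_int_bounds a b x0 x1 y0 y1 : x0 <= x1 -> y0 <= y1 ->
  (forall p, x0 <= p.1 <= x1 -> y0 <= p.2 <= y1 -> a <= g p <= b) -> 0 <= a ->
  ((a * ((x1 - x0) * (y1 - y0)))%:E <= plane_int x0 x1 y0 y1 /\
   plane_int x0 x1 y0 y1 <= (b * ((x1 - x0) * (y1 - y0)))%:E)%E.
Proof.
move=> x01 y01 H a0; have mh := measurable_hrect x0 x1 y0 y1.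
have Hh p : hrect x0 x1 y0 y1 p -> a <= g p <= b.
  by move=> /hrectP[/andP[/ltW h1 h2] /andP[/ltW h3 h4]]; apply: H; apply/andP; split.
have b0 : 0 <= b.
  have /andP[h1 h2] := H (x0, y0) ltac:(by rewrite /= lexx) ltac:(by rewrite /= lexx).
  by apply: le_trans a0 _; apply: le_trans h2.
rewrite !EFinM -EFinM -mu2_hrect // -!integral_cst //.
split; apply: ge0_le_integral => //; try exact: jcont_measurable_EFin.
- by move=> p /Hh /andP[? ?]; rewrite lee_fin.
- by move=> p _; rewrite lee_fin.
- by move=> p /Hh /andP[? ?]; rewrite lee_fin.
Qed.

Lemma plane_int_fin x0 x1 y0 y1 : x0 <= x1 -> y0 <= y1 ->
  plane_int x0 x1 y0 y1 = (plane_rint x0 x1 y0 y1)%:E.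
Proof.
move=> x01 y01; rewrite /plane_rint fineK // ge0_fin_numE ?plane_int_ge0 //.
have [_] := @plane_int_bounds 0 K x0 x1 y0 y1 x01 y01
  (fun p _ _ => introT andP (conj (g0 p) (gK p))) (lexx _).
by move=> /le_lt_trans; apply; rewrite ltry.
Qed.

Lemma plane_rint_bounds a b x0 x1 y0 y1 : x0 <= x1 -> y0 <= y1 ->
  (forall p, x0 <= p.1 <= x1 -> y0 <= p.2 <= y1 -> a <= g p <= b) -> 0 <= a ->
  a * ((x1 - x0) * (y1 - y0)) <= plane_rint x0 x1 y0 y1 <= b * ((x1 - x0) * (y1 - y0)).
Proof.
move=> x01 y01 H a0; have [] := plane_int_bounds x01 y01 H a0.
by rewrite plane_int_fin // !lee_fin => -> ->.
Qed.

Lemma plane_rint_cutx x0 x1 y0 y1 c : x0 <= c <= x1 -> y0 <= y1 ->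
  plane_rint x0 x1 y0 y1 = plane_rint x0 c y0 y1 + plane_rint c x1 y0 y1.
Proof.
move=> /andP[c0 c1] y01; have x01 := le_trans c0 c1.
apply: EFin_inj; rewrite EFinD -!plane_int_fin // /plane_int.
rewrite -ge0_integral_setU; [|exact: measurable_hrect..|exact: jcont_measurable_EFin| |].
- congr (integral _ _ _); apply/seteqP; split => p.
    move=> /hrectP[/andP[h1 h2] h3]; have [pc|pc] := leP p.1 c.
      by left; apply/hrectP; split => //; apply/andP.
    by right; apply/hrectP; split => //; apply/andP.
  by case=> /hrectP[/andP[h1 h2] h3]; apply/hrectP; split => //; apply/andP; split; lra.
- by move=> p _; rewrite lee_fin.
- apply/disj_setPS => p [] /hrectP[/andP[_ h1] _] /hrectP[/andP[h2 _] _] /=; lra.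
Qed.

Lemma plane_rint_cuty x0 x1 y0 y1 c : y0 <= c <= y1 -> x0 <= x1 ->
  plane_rint x0 x1 y0 y1 = plane_rint x0 x1 y0 c + plane_rint x0 x1 c y1.
Proof.
move=> /andP[c0 c1] x01; have y01 := le_trans c0 c1.
apply: EFin_inj; rewrite EFinD -!plane_int_fin // /plane_int.
rewrite -ge0_integral_setU; [|exact: measurable_hrect..|exact: jcont_measurable_EFin| |].
- congr (integral _ _ _); apply/seteqP; split => p.
    move=> /hrectP[h3 /andP[h1 h2]]; have [pc|pc] := leP p.2 c.
      by left; apply/hrectP; split => //; apply/andP.
    by right; apply/hrectP; split => //; apply/andP.
  by case=> /hrectP[h3 /andP[h1 h2]]; apply/hrectP; split => //; apply/andP; split; lra.
- by move=> p _; rewrite lee_fin.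
- apply/disj_setPS => p [] /hrectP[_ /andP[_ h1]] /hrectP[_ /andP[h2 _]] /=; lra.
Qed.

(** The continuous function [g] is the density of its integral at every point.
    This is the local condition of [green]. *)
Lemma plane_rint_local p e : 0 < e -> exists2 d : R, 0 < d & forall x0 x1 y0 y1,
  x0 <= p.1 <= x1 -> y0 <= p.2 <= y1 -> x1 - x0 < d -> y1 - y0 < d ->
  `|plane_rint x0 x1 y0 y1 - g p * ((x1 - x0) * (y1 - y0))| <=
    e * ((x1 - x0) * (y1 - y0)).
Proof.
move=> e0; have [d d0 Hd] := gc p e0; exists d => // x0 x1 y0 y1 xI yI w h.
have [x01 y01] : x0 <= x1 /\ y0 <= y1 by lra.
have a0 : 0 <= (x1 - x0) * (y1 - y0) by rewrite mulr_ge0 // subr_ge0.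
have gb q : x0 <= q.1 <= x1 -> y0 <= q.2 <= y1 -> `|g q - g p| <= e.
  by move=> q1 q2; apply: Hd; rewrite ltr_norml; apply/andP; split; lra.
have H : forall q, x0 <= q.1 <= x1 -> y0 <= q.2 <= y1 ->
   Num.max 0 (g p - e) <= g q <= g p + e.
  move=> q q1 q2; have := gb q q1 q2; rewrite ler_norml => /andP[h1 h2].
  by rewrite ge_max g0 /=; apply/andP; split; lra.
have m0 : 0 <= Num.max 0 (g p - e) by rewrite le_max lexx.
have /andP[l u] := plane_rint_bounds x01 y01 H m0.
have l' : (g p - e) * ((x1 - x0) * (y1 - y0)) <= plane_rint x0 x1 y0 y1.
  by apply: le_trans l; rewrite ler_wpM2r // le_max lexx orbT.
by rewrite ler_norml; apply/andP; split; lra.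
Qed.

End Additive.

End Plane.

(** * Extension off a square, and a truncation of class C^1 *)

Section ClipTruncation.
Variable R : realType.
Implicit Types (f : R[i] -> R[i]) (z : R[i]) (s t x y a b : R).

Definition clip t x := Num.max (- t) (Num.min t x).

Lemma clip_in t x : 0 <= t -> - t <= clip t x <= t.
Proof.
move=> t0; rewrite /clip le_max lexx /= ge_max ge_min lexx /= andbT; lra.
Qed.

Lemma clip_id t x : - t <= x <= t -> clip t x = x.
Proof.
by move=> /andP[h1 h2]; rewrite /clip (min_idPr _) // (max_idPr _).
Qed.

Lemma max_lip c x y : `|Num.max c x - Num.max c y| <= `|x - y|.
Proof.
have n1 := ler_norm (x - y); have n2 := ler_norm (- (x - y)); rewrite normrN in n2.
rewrite ler_norml.
by case: (leP c x) => ?; case: (leP c y) => ?; apply/andP; split; lra.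
Qed.

Lemma min_lip c x y : `|Num.min c x - Num.min c y| <= `|x - y|.
Proof.
have n1 := ler_norm (x - y); have n2 := ler_norm (- (x - y)); rewrite normrN in n2.
rewrite ler_norml.
by case: (leP c x) => ?; case: (leP c y) => ?; apply/andP; split; lra.
Qed.

Lemma clip_lip t x y : `|clip t x - clip t y| <= `|x - y|.
Proof. exact: le_trans (max_lip _ _ _) (min_lip _ _ _). Qed.

(** Functions defined near a closed square are extended continuously to the
    whole plane by projection onto the square, which makes them measurable on
    the plane. *)
Definition clip_ext (G : R[i] -> R) t (p : R * R) := G (clip t p.1 +i* clip t p.2).

Lemma clip_ext_csquare G t z : 0 <= t -> csquare t z ->
  clip_ext G t (complex.Re z, complex.Im z) = G z.
Proof.
move=> t0 /andP[h1 h2]; rewrite /clip_ext /= !clip_id //.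
by case: z {h1 h2}.
Qed.

Lemma clip_csquare t x y : 0 <= t -> csquare t (clip t x +i* clip t y).
Proof. by move=> t0; rewrite /csquare /crect /= !clip_in. Qed.

Lemma clip_ext_jcont G t : 0 <= t ->
  (forall z, csquare t z -> ccont (fun w => (G w)%:C) z) -> jcont (clip_ext G t).
Proof.
move=> t0 H p e e0; set z := clip t p.1 +i* clip t p.2.
have [d d0 {}H] := H z (clip_csquare _ _ t0) e e0.
exists (d / 2); first by rewrite divr_gt0.
move=> q h1 h2; rewrite /clip_ext -/z.
set w := clip t q.1 +i* clip t q.2.
have := H (w - z); rewrite [z + _]addrC subrK -rmorphB cabs_real; apply.
apply: le_lt_trans (cabs_ReIm _) _; rewrite !ReImE /=.
have := clip_lip t q.1 p.1; have := clip_lip t q.2 p.2; lra.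
Qed.

Definition pos_part x := Num.max 0 x.

Lemma ge0_pos_part x : 0 <= x -> pos_part x = x.
Proof. by move=> h; rewrite /pos_part (max_idPr _). Qed.

Lemma le0_pos_part x : x <= 0 -> pos_part x = 0.
Proof. by move=> h; rewrite /pos_part (max_idPl _). Qed.

Lemma rdiff_pos_part_sqr c s :
  rdiff (fun u => pos_part (c - u) ^+ 2) s (- (2 * pos_part (c - s))).
Proof.
move=> e e0; exists e => // k ke.
apply: (@le_trans _ _ (`|k| ^+ 2)); last first.
  by rewrite expr2 ler_wpM2r // ltW.
rewrite real_normK ?num_real //.
rewrite opprD addrA; set u := c - s.
have k2 := sqr_ge0 k.
have [u0|u0] := leP 0 u; have [v0|v0] := leP 0 (u - k).
- rewrite !ge0_pos_part // (_ : _ - _ = k ^+ 2) ?ger0_norm //; ring.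
- rewrite (ge0_pos_part u0) (le0_pos_part (ltW v0)) ler_norml; apply/andP; split.
    have : 0 <= u * (2 * k - u) by rewrite mulr_ge0 //; lra.
    by rewrite expr0n /=; lra.
  have := sqr_ge0 (u - k); rewrite expr0n /=; lra.
- rewrite (ge0_pos_part v0) (le0_pos_part (ltW u0)) ler_norml; apply/andP; split.
    have := sqr_ge0 (u - k); rewrite expr0n /=; lra.
  have : 0 <= (- u) * (u - 2 * k) by rewrite mulr_ge0 //; lra.
  by rewrite expr0n /=; lra.
- rewrite (le0_pos_part (ltW u0)) (le0_pos_part (ltW v0)) (_ : _ - _ = 0) ?normr0 //;
  ring.
Qed.

Lemma rdiffD (f g : R -> R) x d d' : rdiff f x d -> rdiff g x d' ->
  rdiff (fun u => f u + g u) x (d + d').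
Proof.
move=> /rdiffP H /rdiffP H'; apply/rdiffP; exact: is_deriveD.
Qed.

Lemma rdiffZ (c : R) (f : R -> R) x d : rdiff f x d -> rdiff (fun u => c * f u) x (c * d).
Proof. by move=> /rdiffP H; apply/rdiffP; exact: is_deriveZ. Qed.

Lemma rdiff_cst (c x : R) : rdiff (fun=> c) x 0.
Proof. by apply/rdiffP; exact: is_derive_cst. Qed.

(** A truncation of class C^1: [ctrunc a b s] is [s] for [s <= a] and is
    constant, equal to the mean of [a] and [b], for [s >= b]. *)
Definition ctrunc a b s :=
  (2 * (b - a))^-1 * ((b ^+ 2 - a ^+ 2) +
    (- 1 * pos_part (b - s) ^+ 2 + pos_part (a - s) ^+ 2)).
Definition dctrunc a b s := (b - a)^-1 * (pos_part (b - s) - pos_part (a - s)).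

Section Ctrunc.
Variables a b : R.
Hypothesis ab : a < b.
Let ba0 : 0 < b - a. Proof. by rewrite subr_gt0. Qed.

Lemma rdiff_ctrunc s : rdiff (ctrunc a b) s (dctrunc a b s).
Proof.
have -> : dctrunc a b s =
  (2 * (b - a))^-1 * (0 + (-1 * (- (2 * pos_part (b - s))) + (- (2 * pos_part (a - s))))).
  by rewrite /dctrunc; field; rewrite gt_eqF.
apply: rdiffZ; apply: (rdiffD (rdiff_cst _ _)).
by apply: (rdiffD (rdiffZ _ (rdiff_pos_part_sqr _ _)) (rdiff_pos_part_sqr _ _)).
Qed.

Lemma ctrunc_low s : s <= a -> ctrunc a b s = s.
Proof.
move=> sa; have h := ab; rewrite /ctrunc !ge0_pos_part; [|lra..]; field;
  by rewrite gt_eqF.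
Qed.

Lemma ctrunc_high s : b <= s -> ctrunc a b s = (a + b) / 2.
Proof.
move=> sb; have h := ab; rewrite /ctrunc !le0_pos_part; [|lra..]; field;
  by rewrite gt_eqF.
Qed.

Lemma dctrunc_low s : s <= a -> dctrunc a b s = 1.
Proof.
move=> sa; have h := ab.
by rewrite /dctrunc !ge0_pos_part; [field; rewrite gt_eqF|lra..].
Qed.

Lemma dctrunc_high s : b <= s -> dctrunc a b s = 0.
Proof.
move=> sa; have h := ab.
by rewrite /dctrunc !le0_pos_part; [rewrite subrr mulr0|lra..].
Qed.

Lemma dctrunc01 s : 0 <= dctrunc a b s <= 1.
Proof.
have h := ab; have h' := ba0;
  rewrite /dctrunc mulrC ler_pdivrMr // divr_ge0 ?mul1r ?(ltW ba0) //; last first.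
  rewrite subr_ge0 /pos_part ge_max le_max lexx /= le_max; apply/orP; right; lra.
rewrite /pos_part; case: (leP 0 (b - s)) => ?; case: (leP 0 (a - s)) => ?; lra.
Qed.

Lemma pos_part_lip x y : `|pos_part x - pos_part y| <= `|x - y|.
Proof. exact: max_lip. Qed.

Lemma dctrunc_cont s : rcont (dctrunc a b) s.
Proof.
move=> e e0; exists (e * (b - a) / 2); first by rewrite divr_gt0 // mulr_gt0.
move=> k ke; rewrite /dctrunc -mulrBr normrM ger0_norm ?invr_ge0 ?(ltW ba0) //.
rewrite mulrC ler_pdivrMr //.
have -> : pos_part (b - (s + k)) - pos_part (a - (s + k)) -
    (pos_part (b - s) - pos_part (a - s)) =
  (pos_part (b - (s + k)) - pos_part (b - s)) -
    (pos_part (a - (s + k)) - pos_part (a - s)) by ring.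
apply: le_trans (ler_normB _ _) _.
have := pos_part_lip (b - (s + k)) (b - s); have := pos_part_lip (a - (s + k)) (a - s).
have -> : a - (s + k) - (a - s) = - k by ring.
have -> : b - (s + k) - (b - s) = - k by ring.
rewrite normrN; lra.
Qed.

End Ctrunc.

Lemma ccont_comp (U : R[i] -> R) (f : R -> R) z :
  ccont (fun w => (U w)%:C) z -> rcont f (U z) -> ccont (fun w => (f (U w))%:C) z.
Proof.
move=> HU Hf e e0; have [r r0 {}Hf] := Hf e e0.
have r20 : 0 < r / 2 by rewrite divr_gt0.
have [d d0 {}HU] := HU _ r20; exists d => // h /HU.
rewrite -!rmorphB !cabs_real => H; have := Hf (U (z + h) - U z).
rewrite [U z + _]addrC subrK; apply; lra.
Qed.

Definition sqmod f z := cabs (f z) ^+ 2.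

Lemma sqmodE f z : (sqmod f z)%:C = f z * (f z)^*%C.
Proof. by rewrite mul_conj. Qed.

Lemma ccont_sqmod f z : ccont f z -> ccont (fun w => (sqmod f w)%:C) z.
Proof.
move=> H; apply: (ccont_local ltr01 (F := fun w => f w * (f w)^*%C)).
  by move=> w _; rewrite sqmodE.
by apply: ccontM => //; exact: ccont_conj.
Qed.

Lemma ccont_sqmod_lt f z c : ccont f z -> sqmod f z < c ->
  exists2 r : R, 0 < r & forall w, cabs (w - z) < r -> sqmod f w < c.
Proof.
move=> /ccont_sqmod H hc.
have e0 : 0 < (c - sqmod f z) / 2 by rewrite divr_gt0 // subr_gt0.
have [d d0 {}H] := H _ e0; exists d => // w /H.
rewrite [z + _]addrC subrK -rmorphB cabs_real ler_norml => /andP[]; lra.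
Qed.

Lemma ccont_sqmod_gt f z c : ccont f z -> c < sqmod f z ->
  exists2 r : R, 0 < r & forall w, cabs (w - z) < r -> c < sqmod f w.
Proof.
move=> /ccont_sqmod H hc.
have e0 : 0 < (sqmod f z - c) / 2 by rewrite divr_gt0 // subr_gt0.
have [d d0 {}H] := H _ e0; exists d => // w /H.
rewrite [z + _]addrC subrK -rmorphB cabs_real ler_norml => /andP[]; lra.
Qed.

End ClipTruncation.

(** * Winding numbers and area *)

Section WindingArea.
Variable R : realType.
Implicit Types (f g : R[i] -> R[i]) (z : R[i]) (s t T x y a b : R).

(** The squared derivative, cut off smoothly where [|f|^2] exceeds [b]. For [b
    <= M ^+ 2] it is a continuous minorant of the integrand of the area. *)
Definition trunc_dens f a b z := sqmod (derive1 f) z * dctrunc a b (sqmod f z).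

Lemma trunc_dens_ge0 f a b z : a < b -> 0 <= trunc_dens f a b z.
Proof.
by move=> /dctrunc01 H; rewrite mulr_ge0 ?sqr_ge0 //; case/andP: (H (sqmod f z)).
Qed.

Lemma trunc_dens_le f a b z : a < b -> trunc_dens f a b z <= sqmod (derive1 f) z.
Proof.
by move=> /dctrunc01 H; rewrite ler_piMr ?sqr_ge0 //; case/andP: (H (sqmod f z)).
Qed.

Lemma trunc_dens_eq0 f a b z : a < b -> b <= sqmod f z -> trunc_dens f a b z = 0.
Proof. by move=> ab h; rewrite /trunc_dens dctrunc_high ?mulr0. Qed.

Section OneSquare.
Variables (T t : R) (f : R[i] -> R[i]).
Hypotheses (t0 : 0 < t) (tT : t < T) (Hf : holo_on T f).

Lemma csquare_osquare_lt z : csquare t z -> osquare T z.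
Proof. exact: csquare_osquare. Qed.

Lemma holo_on_derive_bounded :
  exists2 K, 0 <= K & forall z, csquare t z -> sqmod (derive1 f) z <= K.
Proof.
have h0 := t0; have hT := tT.
set s := (t + T) / 2; have ts : t < s by rewrite /s; lra.
have sT : s < T by rewrite /s; lra.
have s0 : 0 < s by lra.
have Hd : holo_on s (derive1 f).
  by move=> z sz; apply: holo_derive2 Hf _; apply: csquare_osquare sz.
have [B B0 HB] := square_cont_bounded s0 (holo_on_square_cont Hd).
exists (B ^+ 2); first exact: sqr_ge0.
move=> z tz; rewrite /sqmod ler_sqr ?nnegrE ?cabs_ge0 //.
by apply: (max_principle s0 Hd HB); apply: csquare_osquare tz.
Qed.

Lemma holo_on_ccont z : csquare t z -> ccont f z.
Proof. by move=> /csquare_osquare_lt/(holo_derive Hf); apply: wdiff_cont. Qed.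

Lemma holo_on_derive_ccont z : csquare t z -> ccont (derive1 f) z.
Proof. by move=> /csquare_osquare_lt/(holo_derive2 Hf)[d]; apply: wdiff_cont. Qed.

Lemma ccont_trunc_dens a b z : a < b -> csquare t z ->
  ccont (fun w => (trunc_dens f a b w)%:C) z.
Proof.
move=> ab tz.
apply: (ccont_local ltr01
  (F := fun w => (sqmod (derive1 f) w)%:C * (dctrunc a b (sqmod f w))%:C)).
  by move=> w _; rewrite -rmorphM.
apply: ccontM; first by apply: ccont_sqmod; exact: holo_on_derive_ccont.
apply: ccont_comp; last exact: dctrunc_cont.
by apply: ccont_sqmod; exact: holo_on_ccont.
Qed.

Lemma trunc_dens_jcont a b : a < b -> jcont (clip_ext (trunc_dens f a b) t).
Proof.
by move=> ab; apply: clip_ext_jcont; [exact: ltW|move=> z; exact: ccont_trunc_dens].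
Qed.

Lemma trunc_dens_bound a b : a < b ->
  exists K, forall p, clip_ext (trunc_dens f a b) t p <= K.
Proof.
move=> ab; have [K K0 H] := holo_on_derive_bounded; exists K => p.
apply: le_trans (trunc_dens_le _ _ ab) _; apply: H; apply: clip_csquare; exact: ltW.
Qed.

Let F a b z := if sqmod f z < a then (f z)^*%C * derive1 f z
  else (ctrunc a b (sqmod f z))%:C * (derive1 f z / f z).

(** [F] is [H(|f|^2) f'/f], where [H] is the truncation; this is the conjugate
    of [f] times [f'] where [|f|^2 < a], which removes the singularity at the
    zeros of [f]. As [f'/f] is holomorphic, only [H(|f|^2)] has a derivative
    with respect to the conjugate variable, and the zero of [H] at 0 leaves
    [H'(|f|^2) |f'|^2]. *)
Lemma wdiff_trunc_logder a b z : 0 < a -> a < b -> csquare t z ->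
  exists A, wdiff (F a b) z A (trunc_dens f a b z)%:C.
Proof.
move=> a0 ab tz; have Tz := csquare_osquare_lt tz.
have Hd := holo_derive Hf Tz; have [d2 Hd2] := holo_derive2 Hf Tz.
have [za|za] := ltP (sqmod f z) a.
  have [r r0 Hr] := ccont_sqmod_lt (holo_on_ccont tz) za.
  have H := wdiffM (wdiff_conj Hd) Hd2.
  eexists; apply: wdiff_eq; [|reflexivity|].
    apply: (wdiff_local r0 _ H) => w wr.
    by rewrite /F Hr.
  rewrite /trunc_dens dctrunc_low ?ltW // mulr1 sqmodE; ring.
have sf0 : 0 < sqmod f z by apply: lt_le_trans za.
have fz0 : f z != 0 by rewrite -cabs_gt0; move: sf0;
  rewrite /sqmod exprn_even_gt0 //= lt_def cabs_ge0 andbT.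
have [r r0 Hr] := ccont_sqmod_gt (holo_on_ccont tz) sf0.
have HU : wdiff (fun w => (sqmod f w)%:C) z (derive1 f z * (f z)^*%C + f z * 0^*%C)
   (0 * (f z)^*%C + f z * (derive1 f z)^*%C).
  apply: wdiff_ext (wdiffM Hd (wdiff_conj Hd)) => w; by rewrite sqmodE.
have HT := wdiff_comp_real HU (rdiff_ctrunc ab (sqmod f z)).
have H := wdiffM HT (holoM Hd2 (holoV fz0 Hd)).
eexists; apply: wdiff_eq; [|reflexivity|].
  apply: (wdiff_local r0 _ H) => w wr; rewrite /F.
  have fw0 : f w != 0.
    apply/eqP => E; have := Hr w wr; by rewrite /sqmod E cabs0 expr0n ltxx.
  case: ifP => // wa; rewrite ctrunc_low ?(ltW wa) // sqmodE.
  by field.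
have -> : (trunc_dens f a b z)%:C =
  (sqmod (derive1 f) z)%:C * (dctrunc a b (sqmod f z))%:C.
  exact: rmorphM.
by rewrite sqmodE; field; exact: fz0.
Qed.

(** On the boundary the truncation is constant, equal to [(a + b) / 2], and
    can be taken out of the contour integral. *)
Lemma green_winding a b : 0 < a -> a < b ->
  (forall z, bsquare t z -> b <= sqmod f z) ->
  square_int t (fun z => derive1 f z / f z) * ((a + b) / 2)%:C =
  (0 +i* 2) * (plane_rint (clip_ext (trunc_dens f a b) t) (- t) t (- t) t)%:C.
Proof.
move=> a0 ab Hb; have h0 := t0; have hT := tT.
have tt : - t <= t by lra.
have f0 z : bsquare t z -> f z != 0.
  move=> /Hb h; apply/eqP => E; move: h; rewrite /sqmod E cabs0 expr0n /=; lra.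
set g := clip_ext _ _.
have gc : jcont g by exact: trunc_dens_jcont.
have g0 p : 0 <= g p by exact: trunc_dens_ge0.
have [K gK] := trunc_dens_bound ab.
have -> : square_int t (fun z => derive1 f z / f z) * ((a + b) / 2)%:C =
  square_int t (F a b).
  rewrite mulrC -square_intZ //; last first.
    move=> z tz; apply: ccontM; first by apply: holo_on_derive_ccont;
      exact: bsquare_csquare.
    by apply: ccontV; [exact: f0|apply: holo_on_ccont; exact: bsquare_csquare].
  apply: square_int_ext => // z tz; have hb := Hb z tz.
  by rewrite /F ltNge (le_trans (ltW ab) hb) /= ctrunc_high.
rewrite /square_int.
rewrite (@green _ (F a b) (fun z => (trunc_dens f a b z)%:C)
  (fun x0 x1 y0 y1 => (0 +i* 2) * (plane_rint g x0 x1 y0 y1)%:C)) //.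
- by move=> z; exact: wdiff_trunc_logder.
- move=> x0 x1 y0 y1 c h1 h2 h3 h4 h5 h6.
  by rewrite -mulrDr -rmorphD (plane_rint_cutx gc g0 gK h2 h5).
- move=> x0 x1 y0 y1 c h1 h2 h3 h4 h5 h6.
  by rewrite -mulrDr -rmorphD (plane_rint_cuty gc g0 gK h2 h5).
move=> z tz e e0.
have e2 : 0 < e / 2 by rewrite divr_gt0.
have [d d0 Hd] := plane_rint_local gc g0 gK (complex.Re z, complex.Im z) e2.
exists d => // x0 x1 y0 y1 h1 h2 h3 h4 zI w1 w2.
move: (zI) => /andP[zx zy].
have := Hd x0 x1 y0 y1 zx zy w1 w2.
rewrite /g clip_ext_csquare ?(ltW h0) // -/g => H.
have -> : (0 +i* 2) * (plane_rint g x0 x1 y0 y1)%:C -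
    (trunc_dens f a b z)%:C * ((0 +i* 2) * ((x1 - x0) * (y1 - y0))%:C) =
  (0 +i* 2) * (plane_rint g x0 x1 y0 y1 - trunc_dens f a b z *
    ((x1 - x0) * (y1 - y0)))%:C.
  by rewrite rmorphB !rmorphM /=; ring.
rewrite cabsM cabs_real.
have -> : cabs (0 +i* 2 : R[i]) = 2.
  by rewrite cabsE /= expr0n add0r sqrtr_sqr ger0_norm.
have w0 : 0 <= x1 - x0 by case/andP: zx; lra.
have v0 : 0 <= y1 - y0 by case/andP: zy; lra.
apply: (@le_trans _ _ (2 * (e / 2 * ((x1 - x0) * (y1 - y0)))));
  first by rewrite ler_wpM2l.
have -> : 2 * (e / 2 * ((x1 - x0) * (y1 - y0))) = e * ((x1 - x0) * (y1 - y0)) by field.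
apply: ler_wpM2l; first exact: ltW.
have := mulr_ge0 w0 v0; have := sqr_ge0 (x1 - x0); have := sqr_ge0 (y1 - y0).
by rewrite sqrrD; lra.
Qed.

(** The number pi times the winding number of [f] about 0 along the boundary
    of the square, that is, half the increment of the argument. Its sign, its
    additivity and its value for [z - a] take the place of integrality. *)
Definition pi_winding := complex.Im (square_int t (fun z => derive1 f z / f z)) / 2.

Lemma pi_winding_area a b : 0 < a -> a < b -> (forall z, bsquare t z -> b <= sqmod f z) ->
  pi_winding * ((a + b) / 2) = plane_rint (clip_ext (trunc_dens f a b) t) (- t) t (- t) t.
Proof.
move=> a0 ab Hb; move: (green_winding a0 ab Hb); rewrite /pi_winding.
move: (square_int _ _) (plane_rint _ _ _ _ _) ((a + b) / 2) => [p q] Y c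
  /(congr1 (@complex.Im R)) /= H.
by rewrite mulrAC -[q * c]add0r -(mulr0 p) H mul0r add0r mulrAC mulfV ?mul1r ?pnatr_eq0.
Qed.

(** It is a positive multiple of the integral of a nonnegative function. *)
Lemma pi_winding_ge0 : (forall z, bsquare t z -> f z != 0) -> 0 <= pi_winding.
Proof.
move=> f0.
have [m m0 Hm] := square_cont_min t0
  (fun z (zt : bsquare t z) => holo_on_ccont (bsquare_csquare zt)) f0.
have b0 : 0 < m ^+ 2 by rewrite exprn_gt0.
have Hb z : bsquare t z -> m ^+ 2 <= sqmod f z.
  by move=> /Hm h; rewrite /sqmod ler_sqr ?nnegrE ?cabs_ge0 // ltW.
have a0 : 0 < m ^+ 2 / 2 by rewrite divr_gt0.
have ab : m ^+ 2 / 2 < m ^+ 2 by lra.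
have := pi_winding_area a0 ab Hb.
have : 0 <= plane_rint (clip_ext (trunc_dens f (m ^+ 2 / 2) (m ^+ 2)) t) (- t) t (- t) t.
  by rewrite fine_ge0 // plane_int_ge0 // => p; exact: trunc_dens_ge0.
move=> h E; rewrite -E pmulr_lge0 // in h.
by rewrite divr_gt0 // addr_gt0.
Qed.

End OneSquare.

(** The logarithmic derivative of a product is the sum of the logarithmic
    derivatives. *)
Lemma pi_windingM T t f g h : 0 < t -> t < T -> holo_on T f -> holo_on T g ->
  (forall z, osquare T z -> h z = f z * g z) ->
  (forall z, bsquare t z -> f z != 0) -> (forall z, bsquare t z -> g z != 0) ->
  pi_winding t h = pi_winding t f + pi_winding t g.
Proof.
move=> t0 tT Hf Hg hE f0 g0.
have cq k : holo_on T k -> (forall z, bsquare t z -> k z != 0) ->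
  square_cont t (fun z => derive1 k z / k z).
  move=> Hk k0 z tz; have stz := bsquare_csquare tz; apply: ccontM.
    exact: holo_on_derive_ccont tT Hk _ stz.
  by apply: ccontV; [exact: k0|exact: holo_on_ccont tT Hk _ stz].
rewrite /pi_winding -mulrDl -ImD -square_intD //; [|exact: cq..].
congr (complex.Im _ / 2); apply: square_int_ext => // z tz.
have stz := bsquare_csquare tz; have Tz := csquare_osquare tT stz.
have st : 0 < T - t by rewrite subr_gt0.
have H : holo h z (derive1 f z * g z + f z * derive1 g z).
  apply: (wdiff_local st _ (holoM (holo_derive Hf Tz) (holo_derive Hg Tz))) => w wz.
  by rewrite hE // -[w](subrK z) addrC; apply: osquareD stz _.
rewrite (holo_derive1 H) hE //.
by rewrite addf_div ?f0 ?g0 // [f z * _]mulrC.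
Qed.

Lemma pi_winding_sub t (a : R[i]) : osquare t a -> pi_winding t (fun z => z - a) = pi.
Proof.
move=> ta; have t0 : 0 < t by case/andP: ta => /andP[]; lra.
rewrite /pi_winding (square_int_ext t0 (G := fun z => (z - a)^-1)); last first.
  by move=> z tz; rewrite (holo_derive1 (holo_sub a z)) mul1r.
by rewrite square_int_inv //=; field.
Qed.

Lemma plane_int_le_Area f M t (G : R * R -> R) x0 x1 y0 y1 : t ^+ 2 < 1 / 2 ->
  - t <= x0 -> x1 <= t -> - t <= y0 -> y1 <= t ->
  (forall p, 0 <= G p) ->
  (forall z, csquare t z -> cabs (f z) < M ->
     G (complex.Re z, complex.Im z) <= cabs (derive1 f z) ^+ 2) ->
  (forall z, csquare t z -> M <= cabs (f z) -> G (complex.Re z, complex.Im z) = 0) ->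
  (plane_int G x0 x1 y0 y1 <= Area f M)%E.
Proof.
move=> t2 h1 h2 h3 h4 G0 Gle G00;
  rewrite /plane_int /Area integral_mkcond [leRHS]integral_mkcond.
apply: ge0_integral_mono => p.
  by rewrite patchE; case: ifP => // _; rewrite lee_fin.
rewrite !patchE; case: ifPn => [|_]; last first.
  by case: ifPn => // _; rewrite lee_fin sqr_ge0.
rewrite inE => /hrectP[/andP[p1 p2] /andP[p3 p4]].
set z := p.1 +i* p.2.
have tz : csquare t z by rewrite /csquare crectP /=; apply/and4P; split; lra.
have zD : cabs z < 1.
  rewrite -(@ltr_pXn2r _ 2) ?nnegrE ?cabs_ge0 // expr1n.
  by apply: le_lt_trans (csquare_cabs tz) _; lra.
have -> : G p = G (complex.Re z, complex.Im z) by congr G; exact: surjective_pairing.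
have [zM|zM] := ltP (cabs (f z)) M.
  rewrite ifT; first by rewrite lee_fin Gle.
  by rewrite inE /Omega /unit_disk /=.
rewrite G00 //; case: ifPn => // _; rewrite lee_fin sqr_ge0 //.
Qed.

(** Let [a] tend to [b = m ^+ 2] in [pi_winding_area]: the truncated area
    approximates from below [m ^+ 2] times the winding number. *)
Lemma pi_winding_le_Area T t f M m : 0 < t -> t < T -> t ^+ 2 < 1 / 2 -> holo_on T f ->
  0 < m -> m <= M -> (forall z, bsquare t z -> m <= cabs (f z)) ->
  ((pi_winding t f * m ^+ 2)%:E <= Area f M)%E.
Proof.
move=> t0 tT t2 Hf m0 mM Hm.
have b0 : 0 < m ^+ 2 by rewrite exprn_gt0.
have Hb z : bsquare t z -> m ^+ 2 <= sqmod f z.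
  by move=> /Hm h; rewrite /sqmod ler_sqr ?nnegrE ?cabs_ge0 // ltW.
have A0 : (0 <= Area f M)%E.
  by apply: integral_ge0 => p _; rewrite lee_fin sqr_ge0.
have H a : 0 < a -> a < m ^+ 2 ->
  ((pi_winding t f * ((a + m ^+ 2) / 2))%:E <= Area f M)%E.
  move=> a0 ab; rewrite (pi_winding_area t0 tT Hf a0 ab Hb).
  have [K gK] := trunc_dens_bound t0 tT Hf ab.
  rewrite -(plane_int_fin (trunc_dens_jcont t0 tT Hf ab) _ gK); [|by move=> p;
    exact: trunc_dens_ge0|lra|lra].
  apply: (@plane_int_le_Area _ _ t) => //; try lra.
  - by move=> p; exact: trunc_dens_ge0.
  - by move=> z tz _; rewrite clip_ext_csquare ?(ltW t0) //; exact: trunc_dens_le.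
  - move=> z tz zM; rewrite clip_ext_csquare ?(ltW t0) //; apply: trunc_dens_eq0 => //.
    by rewrite /sqmod ler_sqr ?nnegrE ?cabs_ge0 ?(ltW m0) //; apply: le_trans mM _.
have i0 : 0 <= pi_winding t f.
  apply: pi_winding_ge0 t0 tT Hf _ => z /Hm h; rewrite -cabs_gt0; exact: lt_le_trans h.
case E : (Area f M) => [A| |]; rewrite ?leey //; last by rewrite E in A0.
rewrite lee_fin leNgt; apply/negP => AI.
have [/eqP i00|i1] := boolP (pi_winding t f == 0).
  by move: A0; rewrite E lee_fin; rewrite i00 mul0r in AI; lra.
have ip : 0 < pi_winding t f by rewrite lt_def i1.
(* The defect that a = m^2 - e/2 would already contradict. *)
set e := (pi_winding t f * m ^+ 2 - A) / pi_winding t f.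
have e0 : 0 < e by rewrite divr_gt0 // subr_gt0.
have Ee : pi_winding t f * e = pi_winding t f * m ^+ 2 - A by rewrite /e mulrC divfK.
have A00 : 0 <= A by rewrite E lee_fin in A0.
have em : e <= m ^+ 2 by rewrite -(ler_pM2l ip) Ee; lra.
have := H (m ^+ 2 - e / 2) ltac:(lra) ltac:(lra); rewrite E lee_fin.
have -> : pi_winding t f * ((m ^+ 2 - e / 2 + m ^+ 2) / 2) = pi_winding t f * m ^+ 2 -
  pi_winding t f * e / 4.
  by field.
rewrite Ee; lra.
Qed.

End WindingArea.

(** * The oscillation of f along the boundary of a square *)

Section LengthArea.
Variable R : realType.
Implicit Types (f g : R[i] -> R[i]) (z : R[i]) (s t T x y a b : R).

Local Notation I := (0 +i* 1 : R[i]).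
(** Multiplication by [i] in the plane. It carries the right edge of a square
    to the top, left and bottom edges in turn, so that only right edges have
    to be studied. *)
Definition rot90 (p : R * R) : R * R := (- p.2, p.1).

Lemma rot90_jcont (g : R * R -> R) : jcont g -> jcont (fun p => g (rot90 p)).
Proof.
move=> H p e e0; have [d d0 {}H] := H (rot90 p) e e0; exists d => // q h1 h2.
apply: H => //=; by rewrite -opprD normrN.
Qed.

(** Both sides come from additive functions of rectangles with the same
    density, so that they agree by [additive_rect_eq0]. *)
Lemma plane_rint_rot90 (g : R * R -> R) K t : jcont g -> (forall p, 0 <= g p) ->
  (forall p, g p <= K) -> 0 <= t ->
  plane_rint (fun p => g (rot90 p)) (- t) t (- t) t = plane_rint g (- t) t (- t) t.
Proof.
move=> gc g0 gK t0.
have gc' := rot90_jcont gc.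
have g0' p : 0 <= g (rot90 p) by [].
have gK' p : g (rot90 p) <= K by [].
(* Multiplication by i maps [x0, x1] x [y0, y1] onto [- y1, - y0] x [x0, x1]. *)
pose D x0 x1 y0 y1 : R[i] :=
  (plane_rint (fun p => g (rot90 p)) x0 x1 y0 y1 - plane_rint g (- y1) (- y0) x0 x1)%:C.
suff : D (- t) t (- t) t = 0.
  by rewrite /D opprK => /complexI/eqP; rewrite subr_eq0 => /eqP.
have tt : - t <= t by lra.
apply: additive_rect_eq0 => //.
- move=> x0 x1 y0 y1 c h1 h2 h3 h4 h5 h6; rewrite /D.
  rewrite (plane_rint_cutx gc' g0' gK' h2 h5) (plane_rint_cuty gc g0 gK h2);
    last by rewrite lerN2.
  by rewrite -rmorphD; congr (_%:C); ring.
- move=> x0 x1 y0 y1 c h1 h2 h3 h4 h5 h6; rewrite /D.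
  rewrite (plane_rint_cuty gc' g0' gK' h2 h5).
  rewrite (@plane_rint_cutx _ _ _ gc g0 gK (- y1) (- y0) x0 x1 (- c)) //;
    last by rewrite !lerN2 andbC.
  by rewrite -rmorphD; congr (_%:C); ring.
move=> x y xI yI e e0; have e2 : 0 < e / 2 by rewrite divr_gt0.
have [d d0 Hd] := plane_rint_local gc g0 gK (- y, x) e2.
have [d' d'0 Hd'] := plane_rint_local gc' g0' gK' (x, y) e2.
exists (Num.min d d'); first by rewrite lt_min d0.
move=> x0 x1 y0 y1 h1 h2 h3 h4 h5 h6; rewrite !lt_min => /andP[w1 w2] /andP[v1 v2].
have w0 : 0 <= x1 - x0 by case/andP: h2; lra.
have v0 : 0 <= y1 - y0 by case/andP: h5; lra.
have := Hd' x0 x1 y0 y1 h2 h5 w2 v2.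
have := Hd (- y1) (- y0) x0 x1; rewrite /= !lerN2 andbC h2 h5 opprK [- y0 + _]addrC.
move=> /(_ isT isT v1 w1); rewrite /rot90 /=.
rewrite /D cabs_real; set j1 := plane_rint _ _ _ _ _;
  set j2 := plane_rint _ _ _ _ _ => H1 H2.
have -> : j2 - j1 = (j2 - g (- y, x) * ((x1 - x0) * (y1 - y0))) -
  (j1 - g (- y, x) * ((y1 - y0) * (x1 - x0))) by ring.
apply: le_trans (ler_normB _ _) _.
have := mulr_ge0 w0 v0; have := sqr_ge0 (x1 - x0); have := sqr_ge0 (y1 - y0).
rewrite sqrrD => q1 q2 q3.
apply: le_trans (lerD H2 H1) _.
have -> : e / 2 * ((x1 - x0) * (y1 - y0)) + e / 2 * ((y1 - y0) * (x1 - x0)) =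
  e * ((x1 - x0) * (y1 - y0)) by field.
by apply: ler_wpM2l; [exact: ltW|lra].
Qed.

Definition rotf f (k : nat) z := f (I ^+ k * z).

Lemma csquare_mul_i t z : csquare t z -> csquare t (I * z).
Proof.
rewrite /csquare !crectP !ReImE /= => /and4P[? ? ? ?]; apply/and4P; split; lra.
Qed.

Lemma csquare_mul_iX t k z : csquare t z -> csquare t (I ^+ k * z).
Proof.
elim: k => [|k IH] tz; first by rewrite expr0 mul1r.
by rewrite exprS -mulrA; apply: csquare_mul_i; apply: IH.
Qed.

Lemma holo_rot f c z d : holo f (c * z) d -> holo (fun w => f (c * w)) z (d * c).
Proof.
move=> H e e0; have c1 : 0 < cabs c + 1 by have := cabs_ge0 c; lra.
have ec : 0 < e / (cabs c + 1) by rewrite divr_gt0.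
have [r r0 {}H] := H _ ec.
exists (r / (cabs c + 1)); first by rewrite divr_gt0.
move=> h; rewrite ltr_pdivlMr // => hr.
have ch : cabs (c * h) <= cabs h * (cabs c + 1).
  by rewrite cabsM mulrC ler_wpM2l ?cabs_ge0 // lerDl.
have := H (c * h) (le_lt_trans ch hr); rewrite !mul0r !addr0 mulrDr mulrA.
move=> /le_trans; apply; rewrite -mulrA ler_wpM2l ?(ltW e0) //.
by rewrite mulrC ler_pdivrMr.
Qed.

Lemma holo_on_rot T f k : holo_on T f -> holo_on T (rotf f k).
Proof.
move=> Hf z Tz; have [d Hd] := Hf _ (csquare_mul_iX k Tz).
by eexists; exact: (holo_rot Hd).
Qed.

Lemma cabs_iX k : cabs (I ^+ k) = 1.
Proof. by rewrite cabsX cabs_i expr1n. Qed.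

Lemma trunc_dens_rotf T f k a b z : holo_on T f -> osquare T z ->
  osquare T (I ^+ k * z) ->
  trunc_dens (rotf f k) a b z = trunc_dens f a b (I ^+ k * z).
Proof.
move=> Hf Tz Tkz; rewrite /trunc_dens /sqmod
  (holo_derive1 (holo_rot (holo_derive Hf Tkz))).
by rewrite cabsM cabs_iX mulr1.
Qed.

Section EdgeOscillation.
Variables (T t a b lam : R).
Hypotheses (t0 : 0 < t) (tT : t < T) (ab : a < b) (a0 : 0 < a) (lam0 : 0 < lam).

Definition trunc_mod f z := ctrunc a b (sqmod f z).

(** The derivative of the truncation of [|f|^2] along the edge is at most [2
    |f| |f'|] times the derivative of the truncation, hence its square is at
    most [4 b] times [trunc_dens]. The inequality [X <= lam / 2 * X ^+ 2 + 1 /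
    (2 * lam)] then plays the role of the Cauchy-Schwarz inequality. *)
Lemma right_edge f p q : holo_on T f -> - t <= p -> p <= q -> q <= t ->
  `|trunc_mod f (t +i* q) - trunc_mod f (t +i* p)| <=
    2 * lam * b * rint (- t) t (fun y => trunc_dens f a b (t +i* y)) + t / lam.
Proof.
move=> Hf tp pq qt; have h0 := t0; have hT := tT; have hab := ab; have ha := a0.
have hl := lam0.
pose W z := (dctrunc a b (sqmod f z))%:C * (derive1 f z * (f z)^*%C * I -
                                     f z * (derive1 f z)^*%C * I).
have tz y : - t <= y <= t -> csquare t (t +i* y).
  by move=> H; rewrite /csquare /crect /= lexx H andbT; lra.
have Wc z : csquare t z -> ccont W z.
  move=> stz; have cf := holo_on_ccont tT Hf stz.
  have cd := holo_on_derive_ccont tT Hf stz.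
  have ccI := ccont_cst I z.
  apply: ccontM; first by apply: ccont_comp; [exact: ccont_sqmod|exact: dctrunc_cont].
  apply: ccontD; first by apply: ccontM => //; apply: ccontM => //; exact: ccont_conj.
  apply: (ccont_local ltr01 (F := fun w => (-1) * (f w * (derive1 f w)^*%C * I))).
    by move=> w _; rewrite mulN1r.
  apply: ccontM; first exact: ccont_cst.
  by apply: ccontM => //; apply: ccontM => //; exact: ccont_conj.
have Wseg : rcont_on (- t) t (fun y => complex.Re (W (t +i* y))).
  by apply: pcont_on_Re => y yI; apply: ccont_ver; apply: Wc; exact: tz.
have Gseg : rcont_on (- t) t (fun y => trunc_dens f a b (t +i* y)).
  apply: (@pcont_on_Re _ _ _ (fun y => (trunc_dens f a b (t +i* y))%:C)) => y yI.
  apply: (@ccont_ver _ (fun z => (trunc_dens f a b z)%:C)).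
  by apply: ccont_trunc_dens tT Hf _ _ _ ab (tz _ yI).
pose h y := 2 * lam * b * trunc_dens f a b (t +i* y) + 1 / (2 * lam).
have hseg : rcont_on (- t) t h by apply: rcont_onD;
  [exact: rcont_onZ|exact: rcont_on_cst].
have h_ge0 y : 0 <= h y.
  apply: addr_ge0; last by rewrite divr_ge0 //; lra.
  by rewrite mulr_ge0 // ?trunc_dens_ge0 // !mulr_ge0 //; lra.
have Wh y : `|complex.Re (W (t +i* y))| <= h y.
  set z := t +i* y; apply: le_trans (Re_cabs _) _.
  rewrite /W cabsM cabs_real.
  set ch := dctrunc a b (sqmod f z).
  have /andP[c0 c1] : 0 <= ch <= 1 by exact: dctrunc01.
  rewrite ger0_norm //.
  have B1 : cabs (derive1 f z * (f z)^*%C * I - f z * (derive1 f z)^*%C * I) <=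
     2 * (cabs (f z) * cabs (derive1 f z)).
    by apply: le_trans (cabsB _ _) _; rewrite !cabsM !cabs_conj cabs_i; lra.
  apply: le_trans (ler_wpM2l c0 B1) _.
  set F := cabs (f z); set F' := cabs (derive1 f z).
  set X := ch * (2 * (F * F')).
  have XX : X ^+ 2 <= 4 * b * trunc_dens f a b z.
    have -> : X ^+ 2 = 4 * (F' ^+ 2 * ch) * (ch * F ^+ 2) by rewrite /X; ring.
    have -> : trunc_dens f a b z = F' ^+ 2 * ch by [].
    have cF : ch * F ^+ 2 <= b.
      have [sb|bs] := leP (F ^+ 2) b.
        apply: le_trans sb; rewrite -[leRHS]mul1r ler_wpM2r ?sqr_ge0 //.
      by rewrite /ch dctrunc_high ?(ltW bs) // mul0r; lra.
    rewrite [4 * b * _]mulrAC; apply: ler_wpM2l => //.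
    by rewrite mulr_ge0 // mulr_ge0 // sqr_ge0.
  rewrite /h.
  have l1 : 0 <= 1 / (2 * lam) * (1 - lam * X) ^+ 2.
    by rewrite mulr_ge0 ?sqr_ge0 // divr_ge0 //; lra.
  have l2 : 1 / (2 * lam) * (1 - lam * X) ^+ 2 =
      1 / (2 * lam) - X + lam / 2 * X ^+ 2 by field; rewrite gt_eqF.
  have l3 : lam / 2 * X ^+ 2 <= lam / 2 * (4 * b * trunc_dens f a b z).
    by rewrite ler_wpM2l // divr_ge0 // ltW.
  lra.
have FTC : rint p q (fun y => complex.Re (W (t +i* y))) =
  trunc_mod f (t +i* q) - trunc_mod f (t +i* p).
  apply: (@rint_FTC _ p q _ (fun y => trunc_mod f (t +i* y))) => //.
    exact: rcont_on_sub Wseg.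
  move=> y yI; have yI' : - t <= y <= t by case/andP: yI => ? ?; apply/andP; split; lra.
  have stz := tz _ yI'; have Tz := csquare_osquare tT stz.
  have Hd := holo_derive Hf Tz.
  have HU : wdiff (fun w => (sqmod f w)%:C) (t +i* y)
     (derive1 f (t +i* y) * (f (t +i* y))^*%C + f (t +i* y) * 0^*%C)
     (0 * (f (t +i* y))^*%C + f (t +i* y) * (derive1 f (t +i* y))^*%C).
    by apply: wdiff_ext (wdiffM Hd (wdiff_conj Hd)) => w; rewrite sqmodE.
  have HT := wdiff_comp_real HU (rdiff_ctrunc ab (sqmod f (t +i* y))).
  have E u : t +i* u = (t +i* 0) + u%:C * I by apply: complexP => /=; ring.
  rewrite {1}E in HT.
  have [H _] := wdiff_line HT.
  have -> : complex.Re (W (t +i* y)) = complex.Re (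
    (dctrunc a b (sqmod f (t +i* y)))%:C *
         (derive1 f (t +i* y) * (f (t +i* y))^*%C + f (t +i* y) * 0^*%C) * I +
    (dctrunc a b (sqmod f (t +i* y)))%:C *
         (0 * (f (t +i* y))^*%C + f (t +i* y) * (derive1 f (t +i* y))^*%C) * I^*%C).
    congr (complex.Re _); have -> : I^*%C = - I by apply: complexP => /=; rewrite ?oppr0.
    by rewrite /W conjc0; ring.
  by apply: rdiff_ext H => u /=; rewrite -E.
rewrite -FTC.
have hp : rcont_on p q h by exact: rcont_on_sub hseg.
have Wp : rcont_on p q (fun y => complex.Re (W (t +i* y))) by exact: rcont_on_sub Wseg.
apply: (@le_trans _ _ (rint p q h)).
  rewrite ler_norml; apply/andP; split.
    rewrite -mulN1r -rintZ //; apply: rint_le => //; first exact: rcont_onZ.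
    by move=> y _; have := Wh y; rewrite ler_norml mulN1r => /andP[].
  apply: rint_le => // y _; have := Wh y; rewrite ler_norml => /andP[] //.
have -> : 2 * lam * b * rint (- t) t (fun y => trunc_dens f a b (t +i* y)) + t / lam =
  rint (- t) t h.
  rewrite /h rintD; [|exact: rcont_onZ|exact: rcont_on_cst].
  rewrite rintZ // rint_cst; last by lra.
  by congr (_ + _); field; rewrite gt_eqF.
rewrite (@rint_cat _ (- t) t p) //; last by apply/andP; split; lra.
rewrite (@rint_cat _ p t q) //; [|by apply/andP; split|exact: rcont_on_sub hseg].
have pos x y : - t <= x -> x <= y -> y <= t -> 0 <= rint x y h.
  move=> h1 h2 h3; have := @rint_ge_cst _ x y h 0 h2; rewrite mul0r; apply => //.
  exact: rcont_on_sub hseg.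
have := pos (- t) p; have := pos q t; lra.
Qed.

(** Every boundary point is joined to the lower right corner along at most
    three edges. *)
Lemma boundary_osc f z w : holo_on T f -> bsquare t z -> bsquare t w ->
  `|trunc_mod f z - trunc_mod f w| <= 2 * (2 * lam * b * (
     rint (- t) t (fun y => trunc_dens (rotf f 0) a b (t +i* y)) +
     rint (- t) t (fun y => trunc_dens (rotf f 1) a b (t +i* y)) +
     rint (- t) t (fun y => trunc_dens (rotf f 2) a b (t +i* y)) +
     rint (- t) t (fun y => trunc_dens (rotf f 3) a b (t +i* y))) + 4 * (t / lam)).
Proof.
move=> Hf; have h0 := t0.
pose V k := 2 * lam * b * rint (- t) t (fun y => trunc_dens (rotf f k) a b (t +i* y)) +
  t / lam.
have Ed k p q : - t <= p -> p <= q -> q <= t ->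
    `|trunc_mod (rotf f k) (t +i* q) - trunc_mod (rotf f k) (t +i* p)| <= V k.
  by apply: right_edge; exact: holo_on_rot.
have V0 k : 0 <= V k by apply: le_trans (Ed k t t _ _ _); rewrite ?normr_ge0 //; lra.
pose U := trunc_mod f.
have tfE k u : trunc_mod (rotf f k) u = U (I ^+ k * u) by [].
set c0 := t +i* (- t).
(* The edges are the images of the right edge under powers of i; the bound
   follows from the corner c0 counterclockwise, except on the bottom edge. *)
have key u : bsquare t u -> `|U u - U c0| <= V 0%N + V 1%N + V 2%N + V 3%N.
  clearbody U V.
  case: u => x y /andP[/andP[/= xI yI]] ub.
  have [[x1 x2] [y1 y2]] := (andP xI, andP yI).
  have nx1 : - t <= - x by rewrite lerN2.
  have ny1 : - t <= - y by rewrite lerN2.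
  have nx2 : - x <= t by rewrite lerNl.
  have ny2 : - y <= t by rewrite lerNl.
  have tt : - t <= t by apply: le_trans x2.
  have W0 := V0 0%N; have W1 := V0 1%N; have W2 := V0 2%N; have W3 := V0 3%N.
  have e0 : I ^+ 0 = 1 by rewrite expr0.
  have e1 : I ^+ 1 = I by rewrite expr1.
  have e2 : I ^+ 2 = -1 by rewrite sqr_i.
  have e3 : I ^+ 3 = - I by rewrite exprS sqr_i mulrN1.
  have c1 := Ed 0%N (- t) t (lexx _) tt (lexx _).
  have c2 := Ed 1%N (- t) t (lexx _) tt (lexx _).
  rewrite !tfE e0 !mul1r in c1; rewrite !tfE e1 in c2.
  rewrite (_ : I * (t +i* (- t)) = t +i* t) in c2; last by apply: complexP => /=; ring.
  rewrite (_ : I * (t +i* t) = (- t) +i* t) in c2; last by apply: complexP => /=; ring.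
  rewrite -/c0 in c1.
  move: ub => /or4P[] /eqP E; rewrite E.
  - have := Ed 2%N (- t) (- y) (lexx _) ny1 ny2; rewrite !tfE e2.
    rewrite (_ : -1 * (t +i* (- t)) = (- t) +i* t); last by apply: complexP => /=; ring.
    rewrite (_ : -1 * (t +i* (- y)) = (- t) +i* y); last by apply: complexP => /=; ring.
    move=> c3.
    have := ler_distD (U (- t +i* t)) (U (- t +i* y)) (U (t +i* t)).
    have := ler_distD (U (t +i* t)) (U (- t +i* y)) (U c0).
    lra.
  - have := Ed 0%N (- t) y (lexx _) y1 y2; rewrite !tfE e0 !mul1r -/c0; lra.
  - have := Ed 3%N x t x1 x2 (lexx _); rewrite !tfE e3.
    rewrite (_ : - I * (t +i* t) = c0); last by apply: complexP => /=; ring.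
    rewrite (_ : - I * (t +i* x) = x +i* (- t)); last by apply: complexP => /=; ring.
    rewrite distrC; lra.
  - have := Ed 1%N (- t) (- x) (lexx _) nx1 nx2; rewrite !tfE e1.
    rewrite (_ : I * (t +i* (- t)) = t +i* t); last by apply: complexP => /=; ring.
    rewrite (_ : I * (t +i* (- x)) = x +i* t); last by apply: complexP => /=; ring.
    have := ler_distD (U (t +i* t)) (U (x +i* t)) (U c0).
    lra.
move=> /key kz /key kw.
rewrite distrC in kw; apply: le_trans (ler_distD (U c0) _ _) _.
apply: le_trans (lerD kz kw) _; rewrite /V le_eqVlt; apply/orP; left; apply/eqP; ring.
Qed.

End EdgeOscillation.

End LengthArea.

(** * Length and area: existence of good squares *)

Section GoodSquare.
Variable R : realType.
Implicit Types (f : R[i] -> R[i]) (z : R[i]) (s t T x y a b : R).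
Local Notation RM := (measurableTypeR R).
Local Notation mu := (@lebesgue_measure R).
Local Notation I := (0 +i* 1 : R[i]).

Lemma rint_EFin x y (h : R -> R) : rcont_on x y h ->
  (rint x y h)%:E = (\int[mu]_(u in `[x, y]) (h u)%:E)%E.
Proof.
move=> H; rewrite /rint /Rintegral fineK //.
by apply: integrable_fin_num => //; exact: rcont_on_integrable.
Qed.

Lemma jcontD (g h : R * R -> R) : jcont g -> jcont h -> jcont (fun p => g p + h p).
Proof.
move=> H K p e e0; have e2 : 0 < e / 2 by rewrite divr_gt0.
have [r r0 {}H] := H p _ e2; have [r' r'0 {}K] := K p _ e2.
exists (Num.min r r'); first by rewrite lt_min r0.
move=> q; rewrite !lt_min => /andP[a1 a2] /andP[b1 b2].
rewrite opprD addrACA; apply: le_trans (ler_normD _ _) _.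
have := H q a1 b1; have := K q a2 b2; lra.
Qed.

Lemma jcont_rcont (g : R * R -> R) x y : jcont g -> rcont (fun u => g (x, u)) y.
Proof.
move=> H e e0; have [d d0 {}H] := H (x, y) e e0; exists d => // k kd.
by apply: H; rewrite /= ?subrr ?normr0 // addrC addKr.
Qed.

Lemma plane_intD (g h : R * R -> R) x0 x1 y0 y1 : jcont g -> jcont h ->
  (forall p, 0 <= g p) -> (forall p, 0 <= h p) ->
  plane_int (fun p => g p + h p) x0 x1 y0 y1 =
    (plane_int g x0 x1 y0 y1 + plane_int h x0 x1 y0 y1)%E.
Proof.
move=> gc hc g0 h0; rewrite /plane_int -ge0_integralD //.
- exact: measurable_hrect.
- by move=> p _; rewrite lee_fin.
- exact: jcont_measurable_EFin.
- by move=> p _; rewrite lee_fin.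
- exact: jcont_measurable_EFin.
Qed.

Lemma clipN s x : 0 <= s -> clip s (- x) = - clip s x.
Proof.
move=> s0.
have hi y : s <= y -> clip s y = s.
  by move=> sy; rewrite /clip (min_idPl sy) (max_idPr _) //; lra.
have lo y : y <= - s -> clip s y = - s.
  move=> sy; rewrite /clip (min_idPr _) ?(max_idPl _) //; lra.
have [h1|h1] := lerP s x; first by rewrite (hi x) // lo //; lra.
have [h2|h2] := lerP (- s) x; last by rewrite (lo x) ?hi //; lra.
by rewrite !clip_id //; apply/andP; split; lra.
Qed.

Lemma clip_ext_rot90 f s T k a b p : 0 <= s -> s < T -> holo_on T f ->
  clip_ext (trunc_dens (rotf f k) a b) s p =
    clip_ext (trunc_dens f a b) s (iter k (@rot90 R) p).
Proof.
move=> s0 sT Hf; rewrite /clip_ext.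
set z := clip s p.1 +i* clip s p.2.
have sz : csquare s z by exact: clip_csquare.
rewrite (trunc_dens_rotf a b Hf (csquare_osquare sT sz)
  (csquare_osquare sT (csquare_mul_iX k sz))).
congr (trunc_dens f a b _); elim: k => [|k IH]; first by rewrite expr0 mul1r.
rewrite exprS -mulrA IH /= /rot90 /= clipN //; apply: complexP => /=; ring.
Qed.

Lemma plane_int_rot90_iter (g : R * R -> R) K s k : jcont g -> (forall p, 0 <= g p) ->
  (forall p, g p <= K) -> 0 <= s ->
  jcont (fun p => g (iter k (@rot90 R) p)) /\
  plane_int (fun p => g (iter k (@rot90 R) p)) (- s) s (- s) s =
    plane_int g (- s) s (- s) s.
Proof.
move=> gc g0 gK s0; have ss : - s <= s by lra.
elim: k => [|k [IH1 IH2]]; first by [].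
have E : (fun p => g (iter k.+1 (@rot90 R) p)) =
   (fun p => g (iter k (@rot90 R) (rot90 p))) by apply/funext => p; rewrite iterSr.
rewrite E; split; first exact: (@rot90_jcont _ (fun p => g (iter k (@rot90 R) p))).
rewrite -IH2.
rewrite (@plane_int_fin _ _ K) //;
  last exact: (@rot90_jcont _ (fun p => g (iter k (@rot90 R) p))).
rewrite (@plane_int_fin _ _ K _ _ _ (- s) s (- s) s) //.
by congr (_%:E); exact: (plane_rint_rot90 IH1 (fun p => g0 _) (fun p => gK _) s0).
Qed.

(** Tonelli's theorem on a large square, of which only the vertical segments
    with abscissa in [[al, be]] are kept. *)
Lemma ge0_double_integral (g : R * R -> R) (S : R) (ph : R -> R) al be :
  0 < al -> al <= be -> be < S -> jcont g -> (forall p, 0 <= g p) ->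
  rcont_on al be ph -> (forall x, al <= x <= be -> 0 <= ph x) ->
  (forall x, al <= x <= be -> ph x <= rint (- x) x (fun y => g (x, y))) ->
  ((rint al be ph)%:E <= plane_int g (- S) S (- S) S)%E.
Proof.
move=> al0 albe beS gc g0 phc ph0 phg.
pose G : RM * RM -> \bar R := (EFin \o (g : RM * RM -> R)) \_ (hrect (- S) S (- S) S).
have Gm : measurable_fun setT G.
  apply/(measurable_restrictT _ _).1; first exact: measurable_hrect.
  exact: jcont_measurable_EFin.
have G0 p : (0 <= G p)%E by apply: erestrict_ge0 => q _ /=; rewrite lee_fin.
rewrite /plane_int integral_mkcond -/G (fubini_tonelli1 G Gm G0) rint_EFin //.
rewrite integral_mkcond; apply: ge0_integral_mono => x.
  by apply: erestrict_ge0 => u; rewrite /= in_itv /= lee_fin; exact: ph0.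
rewrite patchE; case: ifPn => [|_]; last by apply: integral_ge0.
rewrite inE /= in_itv /= => xI.
have [x1 x2] := andP xI.
have gx : rcont_on (- x) x (fun y => g (x, y)) by move=> y _; exact: jcont_rcont.
apply: (@le_trans _ _ (rint (- x) x (fun y => g (x, y)))%:E).
  by rewrite lee_fin; exact: phg.
rewrite rint_EFin // /fubini_F [leLHS]integral_mkcond; apply: ge0_integral_mono => y.
  by apply: erestrict_ge0 => u _; rewrite lee_fin.
rewrite patchE; case: ifPn => [|_]; last exact: G0.
rewrite inE /= in_itv /= => /andP[y1 y2].
rewrite /G patchE ifT //; rewrite inE; apply/hrectP => /=.
by split; apply/andP; split; lra.
Qed.

Lemma rdiff_ln x : 0 < x -> rdiff (@ln R) x x^-1.
Proof. by move=> x0; apply/rdiffP; exact: is_derive1_ln. Qed.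

Lemma rint_inv al be c : 0 < al -> al <= be ->
  rcont_on al be (fun x => c * x^-1) /\
  rint al be (fun x => c * x^-1) = c * (ln be - ln al).
Proof.
move=> al0 albe.
have ic : rcont_on al be (fun x => x^-1).
  move=> x /andP[x1 _]; apply/rcontP; apply: (@continuousV _ _ id x).
    by rewrite gt_eqF //; exact: lt_le_trans x1.
  exact: cvg_id.
split; first exact: rcont_onZ.
rewrite rintZ // (@rint_FTC _ al be _ (@ln R)) //.
by move=> x /andP[x1 _]; apply: rdiff_ln; exact: lt_le_trans x1.
Qed.

(** Otherwise the maximum principle would bound [|f|] on the circle of radius
    [r0], which the square contains. *)
Lemma boundary_large_value f M T r0 t : 0 < r0 -> r0 < t -> t <= T -> holo_on T f ->
  0 < M -> M <= circle_max f r0 ->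
  exists2 z, bsquare t z & 7 / 8 * M < cabs (f z).
Proof.
move=> r00 r0t tT Hf M0 Mc; apply: contrapT => none.
have H z : bsquare t z -> cabs (f z) <= 7 / 8 * M.
  by move=> zt; rewrite leNgt; apply/negP => B; apply: none; exists z.
have t0 : 0 < t by lra.
have Hft : holo_on t f by move=> z tz; apply: Hf; exact: csquare_sub tz.
have MP := max_principle t0 Hft H.
suff : circle_max f r0 <= 7 / 8 * M by lra.
apply: ge_sup.
  exists (cabs (f r0%:C)); exists r0%:C => //=.
  by rewrite cabs_real gtr0_norm.
move=> _ [z /= zr <-]; apply: MP.
have := Re_cabs z; have := Im_cabs z; rewrite zr !ler_norml => /andP[? ?] /andP[? ?].
by apply/andP; split; apply/andP; split; lra.
Qed.

(** The constants are those of the levels [3 / 4] and [7 / 8] of [|f| / M],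
    after squaring. *)
Lemma ctrunc_gap b s s' : 0 < b -> s < 9 / 16 * b -> 49 / 64 * b < s' ->
  b / 8 <= ctrunc (9 / 16 * b) b s' - ctrunc (9 / 16 * b) b s.
Proof.
move=> b0 hs hs'; have ab : 9 / 16 * b < b by lra.
rewrite (ctrunc_low ab (ltW hs)).
have [sb|sb] := leP b s'; first by rewrite ctrunc_high //; lra.
rewrite /ctrunc (ge0_pos_part (x := b - s')); last by lra.
rewrite (le0_pos_part (x := 9 / 16 * b - s')); last by lra.
have H : (b - s') ^+ 2 <= (15 / 64 * b) ^+ 2 by rewrite ler_sqr ?nnegrE; lra.
have b2 : 0 < b ^+ 2 by rewrite exprn_gt0.
suff : 11 / 16 * b <= (2 * (b - 9 / 16 * b))^-1 *
  (b ^+ 2 - (9 / 16 * b) ^+ 2 + (-1 * (b - s') ^+ 2 + 0 ^+ 2)) by lra.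
rewrite [_^-1 * _]mulrC ler_pdivlMr; last by lra.
rewrite !exprMn in H *; rewrite expr0n /=.
have -> : 11 / 16 * b * (2 * (b - 9 / 16 * b)) = 77 / 128 * b ^+ 2 by field.
lra.
Qed.

Lemma csquare_edge S x y : x <= S -> - x <= y <= x -> csquare S (x +i* y).
Proof.
move=> h /andP[? ?]; rewrite /csquare crectP /=; apply/and4P; split; lra.
Qed.

(** The oscillation given by [ctrunc_gap] is at most the bound of
    [boundary_osc]; solve for the integral of [trunc_dens]. *)
Lemma boundary_energy_ge f M T x z w : 0 < x -> x < T -> holo_on T f -> 0 < M ->
  bsquare x z -> bsquare x w -> cabs (f z) < 3 / 4 * M -> 7 / 8 * M < cabs (f w) ->
  M ^+ 2 / (64 * 128) * x^-1 <=
     rint (- x) x (fun y => trunc_dens (rotf f 0) (9 / 16 * M ^+ 2) (M ^+ 2) (x +i* y)) +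
     rint (- x) x (fun y => trunc_dens (rotf f 1) (9 / 16 * M ^+ 2) (M ^+ 2) (x +i* y)) +
     rint (- x) x (fun y => trunc_dens (rotf f 2) (9 / 16 * M ^+ 2) (M ^+ 2) (x +i* y)) +
     rint (- x) x (fun y => trunc_dens (rotf f 3) (9 / 16 * M ^+ 2) (M ^+ 2) (x +i* y)).
Proof.
move=> x0 xT Hf M0 zx wx zs wl.
have b0 : 0 < M ^+ 2 by rewrite exprn_gt0.
have ab : 9 / 16 * M ^+ 2 < M ^+ 2 by lra.
have a0 : 0 < 9 / 16 * M ^+ 2 by lra.
have zs' : sqmod f z < 9 / 16 * M ^+ 2.
  have -> : 9 / 16 * M ^+ 2 = (3 / 4 * M) ^+ 2 by field.
  by rewrite /sqmod ltr_pXn2r ?nnegrE ?cabs_ge0 //; lra.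
have wl' : 49 / 64 * M ^+ 2 < sqmod f w.
  have -> : 49 / 64 * M ^+ 2 = (7 / 8 * M) ^+ 2 by field.
  by rewrite /sqmod ltr_pXn2r ?nnegrE ?cabs_ge0 //; lra.
have gap := ctrunc_gap b0 zs' wl'.
(* Balances the two terms of the edge estimate. *)
pose lam := 128 * x / M ^+ 2.
have lam0 : 0 < lam by rewrite divr_gt0 // mulr_gt0.
have osc := boundary_osc x0 xT ab a0 lam0 Hf wx zx.
have e1 : 2 * lam * M ^+ 2 = 256 * x by rewrite /lam; field; rewrite gt_eqF.
have e2 : x / lam = M ^+ 2 / 128 by rewrite /lam; field; rewrite !gt_eqF.
rewrite e1 e2 in osc.
have {osc gap} := le_trans gap (le_trans (ler_norm _) osc).
set E := (X in _ -> _ <= X); rewrite -/E; move: (M ^+ 2) E => b E H.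
rewrite mulrAC ler_pdivrMr // ler_pdivrMr //; lra.
Qed.

(** If no square between [al] and [be] were good, [boundary_energy_ge] could
    be integrated over all of them. The four rotated densities have the same
    integral over the square, and this integral is at most the area. *)
Lemma good_square f M T S r0 al be : 0 < r0 -> r0 < al -> al < be -> be < S -> S < T ->
  S ^+ 2 < 1 / 2 -> holo_on T f -> 0 < M -> M <= circle_max f r0 ->
  256 * 128 * pi <= ln be - ln al -> (Area f M < (pi * M ^+ 2)%:E)%E ->
  exists2 t, al <= t <= be & forall z, bsquare t z -> 3 / 4 * M <= cabs (f z).
Proof.
move=> r00 r0al albe beS ST S2 Hf M0 Mc L A; apply: contrapT => none.
have bad t : al <= t <= be -> exists2 z, bsquare t z & cabs (f z) < 3 / 4 * M.
  move=> tI; apply: contrapT => no; apply: none; exists t => // z zt.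
  by rewrite leNgt; apply/negP => B; apply: no; exists z.
set b := M ^+ 2; have b0 : 0 < b by rewrite exprn_gt0.
set a := 9 / 16 * b; have ab : a < b by rewrite /a; lra.
have a0 : 0 < a by rewrite /a; lra.
have S0 : 0 < S by lra.
pose g := clip_ext (trunc_dens f a b) S.
have gc : jcont g by exact: trunc_dens_jcont S0 ST Hf _ _ ab.
have g0 p : 0 <= g p by exact: trunc_dens_ge0.
have [K gK] := trunc_dens_bound S0 ST Hf ab.
pose gk k p := g (iter k (@rot90 R) p).
have gkc k : jcont (gk k) by exact: (plane_int_rot90_iter k gc g0 gK (ltW S0)).1.
have Jk k : plane_int (gk k) (- S) S (- S) S = plane_int g (- S) S (- S) S.
  exact: (plane_int_rot90_iter k gc g0 gK (ltW S0)).2.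
pose gt p := gk 0%N p + gk 1%N p + gk 2%N p + gk 3%N p.
have gk0 k p : 0 <= gk k p by exact: g0.
have gtc : jcont gt by do 3! [apply: jcontD => //].
have gt0 p : 0 <= gt p by rewrite /gt !addr_ge0.
have JA : (plane_int g (- S) S (- S) S <= Area f M)%E.
  apply: (@plane_int_le_Area _ _ _ S) => //; try lra.
  - by move=> z tz _; rewrite /g clip_ext_csquare ?(ltW S0) //; exact: trunc_dens_le.
  - move=> z tz zM; rewrite /g clip_ext_csquare ?(ltW S0) //; apply: trunc_dens_eq0 => //.
    by rewrite /sqmod /b ler_sqr ?nnegrE ?cabs_ge0 ?(ltW M0).
set Jg := plane_int g (- S) S (- S) S in JA Jk.
have Jt : plane_int gt (- S) S (- S) S = (Jg + Jg + Jg + Jg)%E.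
  rewrite /gt plane_intD //; last 2 first.
  - by do 2! [apply: jcontD => //].
  - by move=> p; rewrite !addr_ge0.
  rewrite plane_intD //; [|by apply: jcontD|by move=> p; rewrite !addr_ge0].
  rewrite plane_intD // !Jk; reflexivity.
have al0 : 0 < al by lra.
have [phc phE] := rint_inv (b / (64 * 128)) al0 (ltW albe).
have main : ((rint al be (fun x => b / (64 * 128) * x^-1))%:E <=
  plane_int gt (- S) S (- S) S)%E.
  apply: (ge0_double_integral al0 (ltW albe) beS gtc gt0 phc).
    move=> x /andP[x1 _]; rewrite mulr_ge0 ?invr_ge0 ?divr_ge0 //; try exact: ltW; lra.
  move=> x xI; have [x1 x2] := andP xI; have x0 : 0 < x by lra.
  have xT : x < T by lra.
  have [z zx zs] := bad x xI.
  have [w wx wl] := boundary_large_value r00 (lt_le_trans r0al x1) (ltW xT) Hf M0 Mc.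
  have H := boundary_energy_ge x0 xT Hf M0 zx wx zs wl.
  apply: le_trans H _; rewrite -/b -/a.
  have Ek k : rint (- x) x (fun y => trunc_dens (rotf f k) a b (x +i* y)) =
      rint (- x) x (fun y => gk k (x, y)).
    apply: rint_ext => y yI.
    rewrite /gk /g -(clip_ext_rot90 k a b (x, y) (ltW S0) ST Hf).
    apply/esym; apply: (@clip_ext_csquare _ _ S (x +i* y) (ltW S0)).
    exact: csquare_edge (ltW (le_lt_trans x2 beS)) yI.
  rewrite (Ek 0%N) (Ek 1%N) (Ek 2%N) (Ek 3%N).
  have gks k : rcont_on (- x) x (fun y => gk k (x, y)) by move=> y _; exact: jcont_rcont.
  rewrite -(rintD (gks 0%N) (gks 1%N)).
  rewrite -(rintD (rcont_onD (gks 0%N) (gks 1%N)) (gks 2%N)).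
  rewrite -(rintD (rcont_onD (rcont_onD (gks 0%N) (gks 1%N)) (gks 2%N)) (gks 3%N)).
  exact: lexx.
have J0 : (0 <= Jg)%E := plane_int_ge0 g0 (- S) S (- S) S.
clearbody Jg.
have Af : exists A', Area f M = A'%:E.
  have h0 : (0 <= Area f M)%E by exact: le_trans J0 JA.
  move: A h0; case: (Area f M) => [r| |] // _ _; by exists r.
case: Af => A' EA; rewrite EA in JA A.
have JE : exists2 j, Jg = j%:E & j <= A'.
  move: J0 JA; case: (Jg) => [j| |] // _ h; by exists j; rewrite -?lee_fin.
case: JE => j jE jA; rewrite phE Jt jE -!EFinD lee_fin in main.
rewrite lte_fin in A.
have h1 : b / (64 * 128) * (256 * 128 * pi) <= b / (64 * 128) * (ln be - ln al).
  by rewrite ler_wpM2l // divr_ge0 // ltW.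
rewrite -/b in A; lra.
Qed.

End GoodSquare.

(** * Primitives along rays *)

Section RayPrimitive.
Variable R : realType.
Implicit Types (f g q : R[i] -> R[i]) (z : R[i]) (s t T x y a b m : R).

Lemma pcont_ray F z x : ccont F (x%:C * z) -> pcont (fun u => F (u%:C * z)) x.
Proof.
move=> H e e0; have [d d0 {}H] := H e e0.
have z1 : 0 < cabs z + 1 by have := cabs_ge0 z; lra.
exists (d / (cabs z + 1)); first by rewrite divr_gt0.
move=> k; rewrite ltr_pdivlMr // => kd; have := H (k%:C * z).
rewrite cabsM cabs_real -mulrDl -rmorphD; apply; apply: le_lt_trans kd.
by rewrite ler_wpM2l // lerDl.
Qed.

Lemma pcontD (F G : R -> R[i]) x : pcont F x -> pcont G x -> pcont (fun u => F u + G u) x.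
Proof.
move=> H K e e0; have e2 : 0 < e / 2 by rewrite divr_gt0.
have [r r0 {}H] := H _ e2; have [r' r'0 {}K] := K _ e2.
exists (Num.min r r'); first by rewrite lt_min r0.
move=> k; rewrite lt_min => /andP[/H h1 /K h2].
rewrite opprD addrACA; apply: le_trans (cabsD _ _) _; lra.
Qed.

Lemma pcontZ (c : R[i]) (F : R -> R[i]) x : pcont F x -> pcont (fun u => c * F u) x.
Proof.
move=> H e e0; have c1 : 0 < cabs c + 1 by have := cabs_ge0 c; lra.
have ec : 0 < e / (cabs c + 1) by rewrite divr_gt0.
have [r r0 {}H] := H _ ec; exists r => // k /H h.
rewrite -mulrBr cabsM; apply: (@le_trans _ _ ((cabs c + 1) * (e / (cabs c + 1)))).
  by apply: ler_pM; rewrite ?cabs_ge0 // lerDl.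
by rewrite mulrC divfK // gt_eqF.
Qed.

(** The primitive that vanishes at 0, as an integral over the segment from 0
    to [z]. *)
Definition ray_primitive q z := cint 0 1 (fun x => q (x%:C * z) * z).

Lemma ray_primitive0 q : ray_primitive q 0 = 0.
Proof.
rewrite /ray_primitive (cint_ext (G := fun=> 0)); last by move=> x _; rewrite mulr0.
by rewrite cint_cst // mul0r.
Qed.

Lemma csquare0 t : 0 <= t -> csquare t (0 : R[i]).
Proof. by move=> t0; rewrite /csquare crectP /= oppr_le0 t0. Qed.

Lemma pcont_on_ray q s T z : 0 <= s -> s < T -> holo_on T q -> csquare s z ->
  pcont_on 0 1 (fun x => q (x%:C * z)).
Proof.
move=> s0 sT Hq sz x xI; apply: pcont_ray.
exact: holo_on_ccont sT Hq _ (csquare_scale xI s0 sz).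
Qed.

(** The derivative of [q (x z) z] with respect to [z] is [q (x z) + x z q' (x
    z)], which is the derivative of [x q (x z)] with respect to [x] and
    integrates to [q z]. The remainder is quadratic, uniformly along the ray,
    by [holo_quad]. *)
Lemma ray_primitive_holo q T z : holo_on T q -> osquare T z ->
  holo (ray_primitive q) z (q z).
Proof.
move=> Hq /osquare_shrink[s0 [s00 s0T sz0]].
pose s := (s0 + T) / 2.
have sT : s < T by rewrite /s; lra.
have ss : s0 < s by rewrite /s; lra.
have sp : 0 < s by lra.
have sz : csquare s z by exact: csquare_sub (ltW ss) sz0.
have [C C0 HC] := holo_quad (ltW sp) sT Hq.
have [K K0 HK] := holo_on_derive_bounded sp sT Hq.
have HK' w : csquare s w -> cabs (derive1 q w) <= K + 1.
  move=> /HK; rewrite /sqmod => h.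
  have [l|l] := leP (cabs (derive1 q w)) 1; first by lra.
  apply: (@le_trans _ _ (cabs (derive1 q w) ^+ 2)); last by lra.
  by rewrite expr2 ler_peMl ?cabs_ge0 // ltW.
pose r := Num.min 1 (Num.min (s - s0) ((T - s) / 2)).
have r0 : 0 < r by rewrite !lt_min ltr01 /=; apply/andP; split; lra.
pose B := (K + 1) + C * (cabs z + 1).
have z0 := cabs_ge0 z.
have B0 : 0 <= B by rewrite /B addr_ge0 ?mulr_ge0 //; lra.
apply: (@holo_of_quad _ _ _ _ r (2 * B * (1 - 0))) => //;
  first by rewrite !mulr_ge0 ?subr_ge0.
move=> h; rewrite /r !le_min => /and3P[h1 h2 h3].
have szh : csquare s (z + h).
  have := @osquareD _ s0 s z (h / 2%:R) ss sz0.
  move: sz0; rewrite /csquare !crectP !ReImE => /and4P[? ? ? ?] _.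
  have := Re_cabs h; have := Im_cabs h; rewrite !ler_norml => /andP[? ?] /andP[? ?].
  by apply/and4P; split; lra.
pose D x := q (x%:C * z) + x%:C * z * derive1 q (x%:C * z).
have segz := pcont_on_ray (ltW sp) sT Hq sz.
have segzh := pcont_on_ray (ltW sp) sT Hq szh.
have xz x : 0 <= x <= 1 -> csquare s (x%:C * z) by move=> xI;
  exact: csquare_scale (ltW sp) sz.
have segD : pcont_on 0 1 D.
  move=> x xI; apply: pcontD; first exact: segz.
  apply: (@pcont_ray (fun w => w * derive1 q w)).
  apply: ccontM; first exact: ccont_id.
  exact: holo_on_derive_ccont sT Hq _ (xz _ xI).
have ID : cint 0 1 D = q z.
  rewrite (@cint_FTC _ 0 1 (fun x => x%:C * q (x%:C * z))) //.
    by rewrite mul0r subr0 !mul1r.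
  move=> x xI; have Hd := holo_derive Hq (csquare_osquare sT (xz _ xI)).
  have [z_0|zn0] := eqVneq z 0.
    have H := wdiffM (wdiff_id (x%:C * 1)) (wdiff_cst (q 0) (x%:C * 1)).
    have [H1 H2] := wdiff_line (z := 0) (eq_ind_r (fun u => wdiff _ u _ _) H (add0r _)).
    have E : (1 * q 0 + x%:C * 1 * 0) * 1 + (0 * q 0 + x%:C * 1 * 0) * 1^*%C = D x.
      by rewrite /D z_0 !mulr0; ring.
    rewrite E in H1 H2.
    by split; [apply: rdiff_ext H1|apply: rdiff_ext H2] => t;
      rewrite /= add0r mulr1 z_0 mulr0.
  (* x q(xz) is the value of w q(w) / z at w = xz, a function of w alone. *)
  have H := holoM (holoM (wdiff_id (x%:C * z)) (wdiff_cst z^-1 (x%:C * z))) Hd.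
  have [H1 H2] := wdiff_line (z := 0) (eq_ind_r (fun u => wdiff _ u _ _) H (add0r _)).
  have E : (((1 * z^-1 + x%:C * z * 0) * q (x%:C * z) +
     (x%:C * z) * z^-1 * derive1 q (x%:C * z)) * z + 0 * z^*%C) = D x.
    by rewrite /D; field.
  rewrite E in H1 H2.
  by split; [apply: rdiff_ext H1|apply: rdiff_ext H2] => t; rewrite /= add0r mulfK.
have psegc (F : R -> R[i]) c : pcont_on 0 1 F -> pcont_on 0 1 (fun x => c * F x).
  by move=> H x xI; apply: pcontZ; exact: H.
have psegc' (F : R -> R[i]) c : pcont_on 0 1 F -> pcont_on 0 1 (fun x => F x * c).
  move=> /(psegc _ c); congr (pcont_on _ _ _); apply/funext => x; exact: mulrC.
have -> : ray_primitive q (z + h) - ray_primitive q z - h * q z =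
  cint 0 1 (fun x => (q (x%:C * (z + h)) * (z + h) + -1 * (q (x%:C * z) * z)) +
    - h * D x).
  rewrite cintD; [|by move=> x xI; apply: pcontD; [exact: psegc'|apply: psegc => //;
    exact: psegc']|exact: psegc].
  rewrite cintD; [|exact: psegc'|by apply: psegc; exact: psegc'].
  rewrite !cintZ //; last exact: psegc'.
  by rewrite ID /ray_primitive; ring.
apply: (@le_trans _ _ (2 * (B * cabs h ^+ 2) * (1 - 0))); last by rewrite le_eqVlt;
  apply/orP; left; apply/eqP; ring.
apply: cint_bound => //.
  move=> x xI; apply: pcontD; last exact: psegc.
  by apply: pcontD; [exact: psegc'|apply: psegc => //; exact: psegc'].
move=> x xI; have [x0 x1] := andP xI.
have hx : cabs (x%:C * h) <= cabs h.
  by rewrite cabsM cabs_real ger0_norm // ler_piMl ?cabs_ge0.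
have := HC (x%:C * z) (x%:C * h) (xz _ xI) (le_trans hx h3).
rewrite -mulrDr; set rr := _ - _ - _; move=> Hr.
have -> : q (x%:C * (z + h)) * (z + h) + -1 * (q (x%:C * z) * z) + - h * D x =
  x%:C * h * h * derive1 q (x%:C * z) + rr * (z + h).
  by rewrite /rr /D; ring.
apply: le_trans (cabsD _ _) _; rewrite !cabsM cabs_real ger0_norm //.
have hh := cabs_ge0 h.
have dq := HK' _ (xz _ xI).
have zh : cabs (z + h) <= cabs z + 1 by apply: le_trans (cabsD _ _) _; lra.
have b1 : x * cabs h * cabs h * cabs (derive1 q (x%:C * z)) <= cabs h ^+ 2 * (K + 1).
  apply: ler_pM; rewrite ?cabs_ge0 ?mulr_ge0 //.
  by rewrite expr2 -mulrA ler_piMl ?mulr_ge0.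
have b2 : cabs rr * cabs (z + h) <= (C * cabs h ^+ 2) * (cabs z + 1).
  apply: ler_pM; rewrite ?cabs_ge0 //; apply: le_trans Hr _.
  apply: ler_wpM2l => //; rewrite ler_sqr ?nnegrE ?cabs_ge0 //.
by apply: le_trans (lerD b1 b2) _; rewrite /B; lra.
Qed.

End RayPrimitive.

(** * Schwarz's lemma and Harnack's inequality *)

Section Harnack.
Variable R : realType.
Implicit Types (f g q : R[i] -> R[i]) (z : R[i]) (s t T x y a b m : R).

Lemma holo_in_on s T f : s < T -> holo_in T f -> holo_on s f.
Proof. by move=> sT H z sz; apply: H; exact: csquare_osquare sz. Qed.

Lemma csquare_cases t z : csquare t z -> osquare t z \/ bsquare t z.
Proof.
move=> tz; move: (tz); rewrite /csquare crectP => /and4P[a1 a2 b1 b2].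
have [c|c] := boolP (bsquare t z); [by right|left].
move: c; rewrite /bsquare /brect; move: tz; rewrite /csquare => -> /=.
rewrite !negb_or => /and4P[n1 n2 n3 n4].
by rewrite /osquare !lt_neqAle a1 a2 b1 b2 !andbT [- t == complex.Re z]eq_sym
  [- t == complex.Im z]eq_sym n1 n2 n3 n4.
Qed.

(** The maximum principle for [1 / g]. *)
Lemma min_principle t g m : 0 < t -> 0 < m -> holo_on t g ->
  (forall z, csquare t z -> g z != 0) -> (forall z, bsquare t z -> m <= cabs (g z)) ->
  forall z, csquare t z -> m <= cabs (g z).
Proof.
move=> t0 m0 Hg g0 Hm z /[dup] sz /csquare_cases[tz|]; last exact: Hm.
have Hi : holo_on t (fun w => (g w)^-1).
  by move=> w tw; have [d Hd] := Hg w tw; eexists; exact: (holoV (g0 w tw) Hd).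
have gp w : csquare t w -> 0 < cabs (g w) by move=> /g0; rewrite cabs_gt0.
have B w : bsquare t w -> cabs (g w)^-1 <= m^-1.
  by move=> tw; rewrite cabsV lef_pV2 ?posrE ?Hm // gp // bsquare_csquare.
have := max_principle t0 Hi B tz; rewrite cabsV lef_pV2 ?posrE //; exact: gp.
Qed.

(** The quotient [q z / z] is holomorphic and is at most [1 / s] on the
    boundary of the square of size [s]. *)
Lemma schwarz t q : 0 < t -> holo_on t q -> q 0 = 0 ->
  (forall z, csquare t z -> cabs (q z) <= 1) ->
  forall s, 0 < s -> s < t -> forall z, osquare s z -> cabs (q z) <= cabs z / s.
Proof.
move=> t0 Hq q0 q1 s s0 st z sz.
have [h Hh E] := factor_root Hq (osquare0 t0) q0.
have Hs := holo_in_on st Hh.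
have tz w : csquare s w -> osquare t w by exact: csquare_osquare.
have B w : bsquare s w -> cabs (h w) <= s^-1.
  move=> sw; have ws := bsquare_cabs sw; have tw := tz _ (bsquare_csquare sw).
  have := q1 w (osquare_csquare tw); rewrite E // subr0 cabsM mulrC => H.
  rewrite -[s^-1]mul1r ler_pdivlMr //; apply: le_trans H.
  by rewrite ler_wpM2l ?cabs_ge0.
have := max_principle s0 Hs B sz => H.
by rewrite E ?tz ?osquare_csquare // subr0 cabsM ler_wpM2l ?cabs_ge0.
Qed.

(** The real part of [g'/g] along a ray is the derivative of [ln |g|], here
    written as half the logarithm of [|g|^2]. *)
Lemma Re_ray_primitive_logder t T g z : 0 <= t -> t < T -> holo_on T g ->
  (forall w, csquare t w -> g w != 0) -> csquare t z ->
  complex.Re (ray_primitive (fun w => derive1 g w / g w) z) =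
  2^-1 * ln (sqmod g z) - 2^-1 * ln (sqmod g 0).
Proof.
move=> t0 tT Hg g0 tz; rewrite /ray_primitive /=.
have xz x : 0 <= x <= 1 -> csquare t (x%:C * z) by move=> xI; exact: csquare_scale.
pose q w := derive1 g w / g w.
have qc w : csquare t w -> ccont q w.
  move=> tw; apply: ccontM; first exact: holo_on_derive_ccont tT Hg _ tw.
  by apply: ccontV; [exact: g0|exact: holo_on_ccont tT Hg _ tw].
rewrite (@rint_FTC _ 0 1 _ (fun x => 2^-1 * ln (sqmod g (x%:C * z)))) //.
- by rewrite mul1r mul0r.
- apply: (pcont_on_Re (F := fun x => q (x%:C * z) * z)) => x xI.
  have H := pcontZ z (pcont_ray (qc _ (xz x xI))).
  by move: H; congr (pcont _ _); apply/funext => u; exact: mulrC.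
move=> x xI; have tw := xz x xI; set w := x%:C * z in tw *.
have sp : 0 < sqmod g w by rewrite /sqmod exprn_gt0 // cabs_gt0 g0.
have Hd := holo_derive Hg (csquare_osquare tT tw).
have HU : wdiff (fun w => (sqmod g w)%:C) w
   (derive1 g w * (g w)^*%C + g w * 0^*%C)
   (0 * (g w)^*%C + g w * (derive1 g w)^*%C).
  by apply: wdiff_ext (wdiffM Hd (wdiff_conj Hd)) => u; rewrite sqmodE.
have HL := wdiff_comp_real HU (rdiff_ln sp).
have [H _] := wdiff_line (z := 0) (eq_ind_r (fun u => wdiff _ u _ _) HL (add0r _)).
have H2 := rdiffZ 2^-1 H.
suff E : 2^-1 * complex.Re ((sqmod g w)^-1%:C *
    (derive1 g w * (g w)^*%C + g w * 0^*%C) * z +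
    (sqmod g w)^-1%:C * (0 * (g w)^*%C + g w * (derive1 g w)^*%C) * z^*%C) =
    complex.Re (derive1 g w / g w * z).
  rewrite [0 + w]add0r E in H2.
  apply: (rdiff_ext _ H2) => u.
  by rewrite add0r.
have gw0 := g0 w tw.
have -> : (sqmod g w)^-1%:C * (derive1 g w * (g w)^*%C + g w * 0^*%C) * z +
    (sqmod g w)^-1%:C * (0 * (g w)^*%C + g w * (derive1 g w)^*%C) * z^*%C =
  derive1 g w / g w * z + (derive1 g w / g w * z)^*%C.
  have cj0 : (g w)^*%C != 0 by rewrite conjc_eq0.
  have cM (u v : R[i]) : (u * v)^*%C = u^*%C * v^*%C by exact: rmorphM.
  have -> : ((sqmod g w)^-1)%:C = (g w * (g w)^*%C)^-1.
    by rewrite -sqmodE; exact: fmorphV.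
  rewrite conjc0 !cM conjc_inv; field.
  by rewrite cj0 gw0.
rewrite ReD; have -> (u : R[i]) : complex.Re u^*%C = complex.Re u by case: u.
by field.
Qed.

(** Let [P] be the primitive of [g'/g] with [P 0 = 0], and [K = ln (|g 0| /
    m)]. By the minimum principle [Re P + K = ln (|g| / m) >= 0], so [P / (P +
    2 K)] has modulus at most 1 and vanishes at 0. By Schwarz's lemma its
    modulus is at most [3 / 4] where [|z| <= 3 s / 4], and this means [Re P +
    K >= K / 7] there. *)
Lemma harnack t T s g m : 0 < s -> s < t -> t < T -> 0 < m -> holo_on T g ->
  (forall z, csquare t z -> g z != 0) -> (forall z, bsquare t z -> m <= cabs (g z)) ->
  m < cabs (g 0) ->
  forall z, osquare s z -> cabs z <= 3 / 4 * s ->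
  (2^-1 * ln (sqmod g 0 / m ^+ 2)) / 7 <= 2^-1 * ln (sqmod g z / m ^+ 2).
Proof.
move=> s0 st tT m0 Hg g0 Hm m0' z sz zs.
have t0 : 0 < t by lra.
have Hgt : holo_on t g by move=> w tw; apply: Hg; exact: csquare_sub (ltW tT) tw.
have MP := min_principle t0 m0 Hgt g0 Hm.
pose q w := derive1 g w / g w.
have Hq : holo_on t q.
  move=> w tw; have Tw := csquare_osquare tT tw; have [d2 Hd2] := holo_derive2 Hg Tw.
  by eexists; exact: (holoM Hd2 (holoV (g0 w tw) (holo_derive Hg Tw))).
set P := ray_primitive q.
have m2 : 0 < m ^+ 2 by rewrite exprn_gt0.
have sp w : csquare t w -> 0 < sqmod g w by move=> /g0 h; rewrite exprn_gt0 // cabs_gt0.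
have t00 : csquare t (0 : R[i]) by apply: csquare0; exact: ltW.
set K := 2^-1 * ln (sqmod g 0 / m ^+ 2).
have K0 : 0 < K.
  rewrite /K mulr_gt0 ?invr_gt0 // ln_gt0 // ltr_pdivlMr // mul1r.
  by rewrite /sqmod ltr_pXn2r ?nnegrE ?cabs_ge0 // ltW.
have ReP w : csquare t w -> complex.Re (P w) = 2^-1 * ln (sqmod g w / m ^+ 2) - K.
  move=> tw; rewrite (Re_ray_primitive_logder (ltW t0) tT Hg g0 tw) /K.
  by rewrite !ln_div ?posrE ?sp //; ring.
have P0 : P 0 = 0 := ray_primitive0 q.
have PH w : osquare t w -> holo P w (q w) := ray_primitive_holo Hq (z := w).
clearbody P.
have PK w : csquare t w -> 0 <= complex.Re (P w) + K.
  move=> tw; rewrite ReP // subrK mulr_ge0 ?invr_ge0 // ln_ge0 //.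
  rewrite ler_pdivlMr // mul1r /sqmod ler_sqr ?nnegrE ?cabs_ge0 ?(ltW m0) //.
  exact: MP.
(* P / Q is the image of P + K under the Moebius transformation that sends
   the right half-plane to the unit disk and K to 0. *)
pose Q w := P w + (2 * K)%:C.
have nQ w : csquare t w -> Q w != 0.
  move=> /PK h; apply/eqP => E; have := congr1 (@complex.Re R) E.
  by rewrite /Q ReD /=; lra.
pose h w := P w / Q w.
set t' := (s + t) / 2; have st' : s < t' by rewrite /t'; lra.
have t't : t' < t by rewrite /t'; lra.
have Hh : holo_on t' h.
  move=> w tw; have HP := PH w (csquare_osquare t't tw).
  have HQ := holoD HP (wdiff_cst (2 * K)%:C w).
  by eexists; exact: (holoM HP (holoV (nQ w (csquare_sub (ltW t't) tw)) HQ)).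
have PQ w : cabs (Q w) ^+ 2 - cabs (P w) ^+ 2 = 4 * K * (complex.Re (P w) + K).
  by rewrite !cabs_sqr /Q ReD ImD /=; ring.
have h1 w : csquare t' w -> cabs (h w) <= 1.
  move=> tw; have tw' := csquare_sub (ltW t't) tw.
  rewrite /h cabsM cabsV ler_pdivrMr ?cabs_gt0 ?nQ // mul1r.
  rewrite -ler_sqr ?nnegrE ?cabs_ge0 // -subr_ge0 PQ.
  by rewrite mulr_ge0 ?PK // mulr_ge0 // ltW.
have h0 : h 0 = 0 by rewrite /h P0 mul0r.
have := schwarz (lt_trans s0 st') Hh h0 h1 s0 st' sz.
have tz : csquare t z by apply: csquare_sub (ltW st) (osquare_csquare sz).
rewrite /h cabsM cabsV ler_pdivrMr ?cabs_gt0 ?nQ // => H.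
have H2 : cabs (P z) <= 3 / 4 * cabs (Q z).
  apply: le_trans H _; rewrite ler_wpM2r ?cabs_ge0 //.
  by rewrite ler_pdivrMr.
rewrite -/K; have := ReP z tz; have := PK z tz.
set X := 2^-1 * ln _; move=> Pp E.
have : cabs (P z) ^+ 2 <= (3 / 4 * cabs (Q z)) ^+ 2.
  by rewrite ler_sqr ?nnegrE ?cabs_ge0 ?mulr_ge0 ?cabs_ge0 //; lra.
rewrite exprMn !cabs_sqr /Q ReD ImD /= addr0 E.
have := sqr_ge0 (complex.Im (P z)); set y := complex.Im (P z) ^+ 2 => y0 H3.
have X0 : 0 <= X by move: Pp; rewrite E subrK.
have H4 : (X - K) ^+ 2 <= (3 / 4 * (X + K)) ^+ 2.
  have -> : X + K = X - K + 2 * K by ring.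
  rewrite exprMn; lra.
have H5 : K - X <= 3 / 4 * (X + K).
  have [l|l] := leP (K - X) 0; first by apply: le_trans l _; rewrite mulr_ge0 //; lra.
  rewrite -ler_sqr ?nnegrE; [|lra|lra].
  by rewrite -sqrrN opprB.
rewrite ler_pdivrMr //; lra.
Qed.

End Harnack.

(** * The two cases *)

Section TwoCases.
Variable R : realType.
Implicit Types (f g q : R[i] -> R[i]) (z : R[i]) (s t T x y m M : R).

(** A factor [z - a] with [a] inside the square adds one turn. *)
Lemma pi_winding_root T t f g a : 0 < t -> t < T -> holo_on T g -> osquare t a ->
  (forall z, osquare T z -> f z = (z - a) * g z) ->
  (forall z, bsquare t z -> g z != 0) -> pi_winding t f = pi + pi_winding t g.
Proof.
move=> t0 tT Hg ta E g0; rewrite -(pi_winding_sub ta).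
apply: (pi_windingM (T := T) t0 tT _ Hg E) => //.
  by move=> z _; exists 1; exact: holo_sub.
by move=> z tz; exact: bsquare_sub_neq0 ta tz.
Qed.

Lemma pi_winding_two_zeros T T' t f g a : 0 < t -> t < T -> T < T' ->
  holo_on T' f -> holo_on T' g ->
  (forall z, osquare T' z -> f z = (z - 0) * g z) ->
  (forall z, bsquare t z -> f z != 0) ->
  osquare t a -> g a = 0 -> 2 * pi <= pi_winding t f.
Proof.
move=> t0 tT TT' Hf Hg E f0 ta ga.
have sub z : osquare T z -> osquare T' z by move=> /osquare_csquare;
  exact: csquare_osquare.
have tT' z : csquare t z -> osquare T' z by apply: csquare_osquare; exact: lt_trans TT'.
have g0 z : bsquare t z -> g z != 0.
  move=> tz; have := f0 z tz; rewrite E ?tT' ?bsquare_csquare //.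
  by apply: contra_neq => ->; rewrite mulr0.
have T'a : osquare T' a by apply: tT'; exact: osquare_csquare.
have [h Hh Eh] := factor_root Hg T'a ga.
have h0 z : bsquare t z -> h z != 0.
  move=> tz; have := g0 z tz; rewrite Eh ?tT' ?bsquare_csquare //.
  by apply: contra_neq => ->; rewrite mulr0.
have HgT : holo_on T g by move=> z Tz; apply: Hg; exact: csquare_sub (ltW TT') Tz.
have HhT : holo_on T h by exact: holo_in_on TT' Hh.
rewrite (@pi_winding_root T t f g 0) //; [|exact: osquare0|by move=> z /sub/E].
rewrite (@pi_winding_root T t g h a) //; last by move=> z /sub/Eh.
by have := pi_winding_ge0 t0 tT HhT h0; lra.
Qed.

(** Write [f = z g]. On the small square of size [t1], [|f| >= m] forces [|g|
    >= m / (2 t1)], hence the same bound at 0, while [|g| >= m] on the square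
    of size [t2]. Harnack's inequality loses a seventh power, which is why
    [t1] is compared with the seventh power of [t3]. *)
Lemma large_on_small_square T t1 t2 t3 f g m M :
  0 < t1 -> t1 <= t2 -> t2 < T -> t2 <= 1 / 2 -> 0 < t3 -> 4 * t3 < t2 ->
  0 < m -> 3 / 4 * M <= m -> 0 < M -> t1 < 1 / 2 * (3 * t3 / 4) ^+ 7 ->
  t3 <= 1 -> holo_on T g ->
  (forall z, osquare T z -> f z = (z - 0) * g z) ->
  (forall z, csquare t2 z -> g z != 0) ->
  (forall z, bsquare t1 z -> m <= cabs (f z)) ->
  (forall z, bsquare t2 z -> m <= cabs (f z)) ->
  forall z, bsquare t3 z -> M <= cabs (f z).
Proof.
move=> t10 t12 t2T t2h t30 t32 m0 mM M0 t1s t31 Hg E g0 H1 H2 z tz.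
have t20 : 0 < t2 by lra.
have cE w : csquare t2 w -> cabs (f w) = cabs w * cabs (g w).
  by move=> tw; rewrite E ?subr0 ?cabsM //; exact: csquare_osquare tw.
have c2 t w : csquare t w -> cabs w <= 2 * t.
  rewrite /csquare crectP => /and4P[? ? ? ?]; apply: le_trans (cabs_ReIm _) _.
  have : `|complex.Re w| <= t by rewrite ler_norml; apply/andP; split.
  have : `|complex.Im w| <= t by rewrite ler_norml; apply/andP; split.
  lra.
have G2 w : bsquare t2 w -> m <= cabs (g w).
  move=> tw; have sw := bsquare_csquare tw; apply: le_trans (H2 w tw) _.
  rewrite cE // ler_piMl ?cabs_ge0 //; have := c2 _ _ sw; lra.
have G1 w : bsquare t1 w -> m / (2 * t1) <= cabs (g w).
  move=> tw; have sw := bsquare_csquare tw; have sw2 := csquare_sub t12 sw.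
  rewrite ler_pdivrMr; last by lra.
  apply: le_trans (H1 w tw) _; rewrite cE // mulrC ler_wpM2l ?cabs_ge0 //.
  exact: c2.
have g00 : m / (2 * t1) <= cabs (g 0).
  apply: (min_principle t10 _ _ _ G1); rewrite ?divr_gt0 ?mulr_gt0 //.
  - by move=> w tw; apply: Hg; apply: csquare_sub tw; lra.
  - by move=> w tw; apply: g0; exact: csquare_sub tw.
  - by apply: csquare0; exact: ltW.
pose r := 3 * t3 / 4.
have r0 : 0 < r by rewrite /r; lra.
have r1 : r <= 1 by rewrite /r; lra.
have r7 : 0 < r ^+ 7 by rewrite exprn_gt0.
have q1 : m / r ^+ 7 < cabs (g 0).
  apply: lt_le_trans g00; rewrite ltr_pM2l // ltf_pV2 ?posrE //; [|lra].
  by move: t1s; rewrite -/r; lra.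
have mg : m < cabs (g 0).
  apply: le_lt_trans q1; rewrite ler_pdivlMr // ler_piMr ?(ltW m0) //.
  by rewrite exprn_ile1 // ltW.
have t43 : 0 < 4 * t3 by lra.
have zI : osquare (4 * t3) z by apply: csquare_osquare (bsquare_csquare tz); lra.
have zb : cabs z <= 3 / 4 * (4 * t3) by have := c2 _ _ (bsquare_csquare tz); lra.
have Hk := harnack t43 t32 t2T m0 Hg g0 G2 mg zI zb.
have m2 : 0 < m ^+ 2 by rewrite exprn_gt0.
have tz2 : csquare t2 z by apply: csquare_sub (bsquare_csquare tz); lra.
have gz : 0 < cabs (g z) by rewrite cabs_gt0 g0.
have lnE w : 0 < cabs (g w) -> 2^-1 * ln (sqmod g w / m ^+ 2) = ln (cabs (g w) / m).
  move=> gw; rewrite /sqmod -expr_div_n lnXn ?divr_gt0 //.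
  by move: (ln _) => l; rewrite mulr2n; field.
rewrite !lnE // in Hk; last exact: lt_trans mg.
have l1 : ln (r^-1) <= ln (cabs (g 0) / m) / 7.
  rewrite ler_pdivlMr // mulr_natr -lnXn ?invr_gt0 //.
  rewrite ler_ln ?posrE ?exprn_gt0 ?invr_gt0 ?divr_gt0 //; last exact: lt_trans mg.
  rewrite exprVn ler_pdivlMr // mulrC ltW //.
  by lra.
have l2 : r^-1 <= cabs (g z) / m.
  have ri0 : 0 < r^-1 by rewrite invr_gt0.
  have gm0 : 0 < cabs (g z) / m by rewrite divr_gt0.
  by rewrite -ler_ln ?posrE //; exact: le_trans l1 Hk.
have l3 : m / r <= cabs (g z) by rewrite mulrC -ler_pdivlMr.
rewrite cE //; have z3 := bsquare_cabs tz.
apply: (@le_trans _ _ (t3 * (m / r))).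
  have -> : t3 * (m / r) = 4 / 3 * m by rewrite /r; field; rewrite gt_eqF.
  lra.
by apply: ler_pM => //; [exact: ltW|rewrite divr_ge0 // ltW].
Qed.

End TwoCases.

Lemma sqr_lt_half (R : realType) (t : R) : 0 <= t -> t <= 1 / 2 -> t ^+ 2 < 1 / 2.
Proof.
move=> t0 th; apply: (@le_lt_trans _ _ ((1 / 2) ^+ 2)); last by lra.
by rewrite ler_sqr ?nnegrE; lra.
Qed.

Theorem corollary1p3 (R : realType) :
  exists r0 : R, 0 < r0 < 1 /\
    forall f : R[i] -> R[i], analytic_on_disk f -> f 0 = 0 ->
    forall M : R, 0 <= M <= circle_max f r0 ->
      ((pi * M ^+ 2)%:E <= Area f M)%E.
Proof.
(* The logarithmic width required by good_square. *)
pose L : R := 256 * 128 * pi.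
have pi0 : 0 < pi :> R by exact: pi_gt0.
have L0 : 0 < L by rewrite /L !mulr_gt0 ?ltr0n.
pose k : R := expR (- L).
have k0 : 0 < k by exact: expR_gt0.
have k1 : k <= 1 by rewrite -expR0 ler_expR; lra.
(* The moderate good square has size between al2 and 1/2, the tiny one has
   size between al1 and tau, and |f| >= M will hold on the square of size t3. *)
pose al2 : R := 1 / 2 * k; have al20 : 0 < al2 by rewrite mulr_gt0.
pose t3 := al2 / 8.
have t30 : 0 < t3 by rewrite divr_gt0.
have al2h : al2 <= 1 / 2 by rewrite /al2; lra.
pose tau := 1 / 4 * (3 * t3 / 4) ^+ 7.
have r0 : 0 < 3 * t3 / 4 by rewrite divr_gt0 // mulr_gt0.
have r1 : 3 * t3 / 4 <= 1 by rewrite /t3; lra.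
have r70 : 0 < (3 * t3 / 4) ^+ 7 by rewrite exprn_gt0.
have r7 : (3 * t3 / 4) ^+ 7 <= 3 * t3 / 4.
  by rewrite exprS ler_piMr ?(ltW r0) // exprn_ile1 // ltW.
have tau0 : 0 < tau by rewrite mulr_gt0.
have taual : tau < al2 by rewrite /tau; rewrite /t3 in r7 *; lra.
pose al1 := tau * k; have al10 : 0 < al1 by rewrite mulr_gt0.
have al1t : al1 <= tau by rewrite ler_piMr // ltW.
exists (al1 / 2); split; first by apply/andP; split; lra.
have lnk x : 0 < x -> ln x - ln (x * k) = L.
  move=> x0; rewrite lnM ?posrE // expRK; ring.
have k1' : k < 1 by rewrite -expR0 ltr_expR; lra.
move=> f Hf f0 M /andP[M0]; move: M0; rewrite le_eqVlt => /orP[/eqP <- _|M0 Mc].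
  by rewrite expr0n mulr0; apply: integral_ge0 => p _; rewrite lee_fin sqr_ge0.
rewrite leNgt; apply/negP => A.
(* 69/100 is less than the square root of 1/2: this square lies in the disk. *)
have HfT : holo_on (69 / 100) f.
  move=> z tz; exists (derive1 f z); apply: derivable_holo; apply: Hf.
  rewrite /unit_disk /= -(@ltr_pXn2r _ 2) ?nnegrE ?cabs_ge0 // expr1n.
  apply: le_lt_trans (csquare_cabs tz) _; lra.
have [t1 /andP[t1a t1b] H1] := @good_square R f M (69 / 100) (3 / 5) (al1 / 2) al1 tau
  ltac:(lra) ltac:(lra) ltac:(by rewrite /al1 gtr_pMr) ltac:(lra) ltac:(lra) ltac:(lra)
  HfT M0 Mc ltac:(by rewrite lnk) A.
have [t2 /andP[t2a t2b] H2] := @good_square R f M (69 / 100) (3 / 5) (al1 / 2) al2 (1 / 2)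
  ltac:(lra) ltac:(lra) ltac:(by rewrite /al2 gtr_pMr) ltac:(lra) ltac:(lra) ltac:(lra)
  HfT M0 Mc ltac:(by rewrite lnk) A.
have m0 : 0 < 3 / 4 * M by lra.
have t20 : 0 < t2 by lra.
have t2T1 : t2 < 68 / 100 by clear -t2b; lra.
have pos (z : R[i]) t : (forall z, bsquare t z -> 3 / 4 * M <= cabs (f z)) ->
  bsquare t z -> f z != 0.
  by move=> H /H h; rewrite -cabs_gt0; lra.
have T00 : 0 < 69 / 100 :> R by lra.
have [g Hg E] := factor_root HfT (osquare0 T00) f0.
pose T1 : R := 68 / 100; pose T2 : R := 67 / 100.
have HgT : holo_on T1 g by apply: holo_in_on Hg; clear; rewrite /T1; lra.
have HfT1 : holo_on T1 f by move=> z tz; apply: HfT; apply: csquare_sub tz;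
  clear; rewrite /T1; lra.
have ET z : osquare T1 z -> f z = (z - 0) * g z.
  by move=> tz; apply: E; apply: csquare_osquare (osquare_csquare tz); clear; rewrite /T1; lra.
have [[a [ta ga]]|nz] := pselect (exists a, csquare t2 a /\ g a = 0).
  have ta' : osquare t2 a.
    have [//|bd] := csquare_cases ta.
    have := pos a t2 H2 bd; rewrite ET ?ga ?mulr0 ?eqxx //.
    exact: csquare_osquare t2T1 ta.
  have I2 : 2 * pi <= pi_winding t2 f.
    have T21 : T2 < T1 by clear; rewrite /T1 /T2; lra.
    have t2T2 : t2 < T2 by clear -t2b; rewrite /T2; lra.
    apply: pi_winding_two_zeros t20 t2T2 T21 HfT1 HgT ET _ ta' ga.
    by move=> z; exact: pos.
  have := @pi_winding_le_Area R (69 / 100) t2 f M (3 / 4 * M) t20 ltac:(clear -t2b; lra).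
  have t22 : t2 ^+ 2 < 1 / 2.
    by apply: sqr_lt_half => //; exact: ltW.
  move=> /(_ t22 HfT m0 ltac:(clear -M0; lra) H2) IA; have := le_lt_trans IA A.
  rewrite lte_fin exprMn => bad.
  have M2 : 0 < M ^+ 2 by rewrite exprn_gt0.
  have h : 2 * pi * ((3 / 4) ^+ 2 * M ^+ 2) <= pi_winding t2 f * ((3 / 4) ^+ 2 * M ^+ 2).
    by rewrite ler_wpM2r // mulr_ge0 ?sqr_ge0.
  have piM : 0 < pi * M ^+ 2 by rewrite mulr_gt0.
  lra.
have g0 z : csquare t2 z -> g z != 0 by move=> tz; apply/eqP => gz; apply: nz; exists z.
have t3t2 : 4 * t3 < t2 by clear -t2a al20; rewrite /t3; lra.
have t10 : 0 < t1 by exact: lt_le_trans al10 t1a.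
have t12 : t1 <= t2 by apply: le_trans t1b (le_trans (ltW taual) t2a).
have t1s : t1 < 1 / 2 * (3 * t3 / 4) ^+ 7.
  by clear -t1b r70; rewrite /tau in t1b; lra.
have t31 : t3 <= 1 by clear -al2h; rewrite /t3; lra.
have big := @large_on_small_square R T1 t1 t2 t3 f g (3 / 4 * M) M t10 t12 t2T1 t2b
  t30 t3t2 m0 (lexx _) M0 t1s t31 HgT ET g0 H1 H2.
have t3T : t3 < T1 by clear -al2h; rewrite /t3 /T1; lra.
have g03 z : bsquare t3 z -> g z != 0.
  by move=> tz; apply: g0; apply: csquare_sub (bsquare_csquare tz); clear -t3t2 t30; lra.
have I1 : pi <= pi_winding t3 f.
  rewrite (@pi_winding_root R T1 t3 f g 0) //; last exact: osquare0.
  by have := pi_winding_ge0 t30 t3T HgT g03; clear; lra.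
have t32 : t3 ^+ 2 < 1 / 2.
  by apply: sqr_lt_half; [exact: ltW|clear -al2h; rewrite /t3; lra].
have IA := pi_winding_le_Area t30 t3T t32 HfT1 M0 (lexx M) big.
have := le_lt_trans IA A; rewrite lte_fin ltNge => /negP; apply.
by rewrite ler_wpM2r // sqr_ge0.
Qed.
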